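(* Let $(\Gamma,q)$ be a polarized graph with edges $e_1,\ldots,e_m$. For $L=(L_1,\ldots,L_m)\in\mathbb{R}_{>0}^m$ let $\phi(\Gamma,q;L_1,\ldots,L_m)$ be the $\phi$-invariant of the polarized metrized graph $(\Gamma,q;L_1,\ldots,L_m)$ in which $e_i$ has length $L_i$. Then the function $\phi(\Gamma,q;L_1,\ldots,L_m)$ on $\mathbb{R}_{>0}^m$ extends to a continuous function on $\mathbb{R}_{\geqslant 0}^m$. Furthermore, the value of this extension at a boundary point $(L_1,\ldots,L_m)\in\mathbb{R}_{\geqslant 0}^m$ is the $\phi$-invariant of the polarized metrized graph parametrized by that point (i.e. the degenerate graph obtained by contracting all edges $e_i$ with $L_i=0$, with its induced polarization).
   Context: Metrized graphs. A metrized graph $\Gamma$ is a finite connected graph (loops and multiple edges allowed; a single point is allowed) in which every edge $e$ is parametrized as a closed segment of length $L(e)>0$ (with endpoints glued accordingly). The valence $v(p)$ of $p\in\Gamma$ is the number of directions emanating from $p$. The finite non-empty vertex set $V(\Gamma)$ contains all points with $v(p)\ne 2$, and may be enlarged by valence-2 points; $E(\Gamma)$ is the edge set. $\ell(\Gamma)$ is the total length and $dx$ the Lebesgue measure. The genus is $g(\Gamma)=\mathrm{rank}\,H^1(\Gamma,\mathbb{Z})$. Laplacian. For continuous $f:\Gamma\to\mathbb{R}$ that is $C^2$ off $V(\Gamma)$ with $f''\in L^1$, $\Delta f=-f''(x)\,dx-\sum_{p\in V(\Gamma)}\big(\sum_{\vec v\text{ at }p}d_{\vec v}f(p)\big)\delta_p$,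 where $\vec v$ runs over unit tangent directions at $p$ and $d_{\vec v}f(p)$ is the one-sided directional derivative. Voltage and resistance. For $y,z\in\Gamma$, $j_z(x,y)$ is the unique continuous piecewise linear function of $x$ with $\Delta_x j_z(x,y)=\delta_y-\delta_z$ and $j_z(z,y)=0$. Put $r(x,y)=j_y(x,x)$. Green functions. For a finite signed Borel measure $\mu$ with $\mu(\Gamma)=1$, $g_\mu(x,y)$ is the continuous symmetric function on $\Gamma\times\Gamma$ characterized by $\Delta_x g_\mu(x,y)=\delta_y-\mu$ and $\int_\Gamma g_\mu(x,y)\,d\mu(x)=0$. Canonical measure. $\mu_{\mathrm{can}}=\sum_{p\in V(\Gamma)}(1-\tfrac12 v(p))\delta_p+\sum_{e\in E(\Gamma)}\frac{dx}{L(e)+R(e)}$, where, with $e^0$ the interior of $e$ and $p,q$ its endpoints, $R(e)$ is the resistance between $p$ and $q$ computed in $\Gamma\setminus e^0$ if this is connected, and $R(e)=\infty$ otherwise. Polarization. A polarization is a function $q:V(\Gamma)\to\mathbb{Z}_{\geqslant0}$ with $v(p)-2+2q(p)\geqslant0$ for all $p\in V(\Gamma)$. Put $\delta_K=\sum_{p\in V(\Gamma)}(v(p)-2+2q(p))\delta_p$, $g=g(\Gamma,q)=g(\Gamma)+\sum_p q(p)$, and $\mu_{\mathrm{ad}}=\frac{1}{2g}(2\mu_{\mathrm{can}}+\delta_K)$ (the admissible measure). The $\phi$-invariant. $\phi(\Gamma,q)=-\frac14\ell(\Gamma)+\frac14\int_\Gamma g_{\mu_{\mathrm{ad}}}(x,x)\big((10g+2)\mu_{\mathrm{ad}}-\delta_K\big)$.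 Degeneration. A polarized graph $(\Gamma,q)$ (without metric) is given. For $L\in\mathbb{R}_{\geqslant0}^{m}=\mathbb{R}_{\geqslant 0}^{E(\Gamma)}$ let $E_0$ be the subgraph consisting of the edges of length $0$. The metrized graph $(\Gamma,L)$ is the graph obtained from $\Gamma$ by contracting each connected component of $E_0$ to a point; the remaining edges keep their lengths $L(e)>0$. With $F:\Gamma\to(\Gamma,L)$ the quotient map, its polarization is $q'(p')=\sum_{p\in V(F^{-1}(p'))}q(p)+g(F^{-1}(p'))$ for each vertex $p'$, where $g(F^{-1}(p'))$ is the genus of the connected subgraph $F^{-1}(p')$. This is the polarized metrized graph parametrized by $L$. *)

(* Defs.v *)
From HB Require Import structures.
From mathcomp Require Import all_boot all_order all_algebra.
From mathcomp Require Import all_classical all_reals all_analysis.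
From mathcomp Require Import measurable_realfun.

Set Implicit Arguments.
Unset Strict Implicit.
Unset Printing Implicit Defensive.

Import Order.TTheory GRing.Theory Num.Theory.
Import numFieldNormedType.Exports.

Local Open Scope classical_set_scope.
Local Open Scope ring_scope.

(* Finite multigraphs.  The orientation [src], [tgt] of an edge only serves to
   parametrize it; loops ([src e = tgt e]) and multiple edges are allowed.
   Connectedness is a separate predicate, because deleting an edge may destroy
   it. *)
Record multigraph := MultiGraph {
  vert : finType;
  edge : finType;
  src : edge -> vert;
  tgt : edge -> vert;
  vert_gt0 : (0 < #|vert|)%N }.

Section Graph.
Variable G : multigraph.

Definition adj (B : pred (edge G)) : rel (vert G) := fun v w =>
  [exists e, B e && (((src e == v) && (tgt e == w)) ||
                     ((src e == w) && (tgt e == v)))].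

Definition connected_graph : Prop := forall v w, connect (adj predT) v w.

(* A loop contributes 2. *)
Definition valence (v : vert G) : nat :=
  (#|[pred e | src e == v]| + #|[pred e | tgt e == v]|)%N.

(* The cellular coboundary C^0 -> C^1 (acting on row vectors), with rational
   coefficients; rank H^1(G, Z) is the dimension of its cokernel. *)
Definition coboundary : 'M[rat]_(#|vert G|, #|edge G|) :=
  \matrix_(i, j) ((tgt (enum_val j) == enum_val i)%:R
                  - (src (enum_val j) == enum_val i)%:R).

Definition genus : nat := \rank (cokermx coboundary).

Definition polarization (q : vert G -> nat) : Prop :=
  forall v, 0 <= (valence v)%:Z - 2 + 2 * (q v)%:Z.

Definition base_vert : vert G := enum_val (Ordinal (vert_gt0 G)).

End Graph.

Record metrized_graph (R : realType) := MetrizedGraph {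
  mg_graph :> multigraph;
  len : edge mg_graph -> R;
  len_gt0 : forall e, 0 < len e }.

(* The points of the metrized graph: the vertices, and for each edge [e] the
   interior points [(e, t)] with [0 < t < len e]. *)
Definition mpoint (R : realType) (Gam : metrized_graph R) : Type :=
  (vert Gam + {et : edge Gam * R | 0 < et.2 < len et.1})%type.

HB.instance Definition _ (R : realType) (Gam : metrized_graph R) :=
  Choice.copy (mpoint Gam)
    (vert Gam + {et : edge Gam * R | 0 < et.2 < len et.1})%type.
HB.instance Definition _ (R : realType) (Gam : metrized_graph R) :=
  isPointed.Build (mpoint Gam) (inl (base_vert Gam)).

Section Topology.
Variables (R : realType) (Gam : metrized_graph R).
Implicit Types (e : edge Gam) (t : R).

Definition vpt (v : vert Gam) : mpoint Gam := inl v.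

(* The parametrization [0, len e] -> Gam of [e], extended to all of R by the
   retraction of R onto [0, len e]. *)
Definition edge_pt e t : mpoint Gam :=
  match insub (e, t) with
  | Some u => inr u
  | None => if t <= 0 then vpt (src e) else vpt (tgt e)
  end.

(* The quotient topology from the disjoint union of the closed segments. *)
Definition point_open : set_system (mpoint Gam) :=
  [set U | forall e, open (edge_pt e @^-1` U)].

Lemma point_openT : point_open setT.
Proof. by move=> e; rewrite preimage_setT; exact: openT. Qed.

Lemma point_openI : setI_closed point_open.
Proof. by move=> A B oA oB e; rewrite preimage_setI; exact: openI. Qed.

Lemma point_open_bigU (I : Type) (f : I -> set (mpoint Gam)) :
  (forall i, point_open (f i)) -> point_open (\bigcup_i f i).
Proof.
by move=> of_ e; rewrite preimage_bigcup; apply: bigcup_open => i _; exact: of_.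
Qed.

HB.instance Definition _ := isOpenTopological.Build (mpoint Gam)
  point_openT point_openI point_open_bigU.

HB.instance Definition _ := @isMeasurable.Build
  (sigma_display (@open (mpoint Gam))) (mpoint Gam)
  <<s (@open (mpoint Gam)) >> (@sigma_algebra0 _ setT _) (@sigma_algebraC _ _)
  (@sigma_algebra_bigcup _ setT _).

Lemma measurable_edge_pt e : measurable_fun setT (edge_pt e).
Proof.
apply: (@measurability _ _ _ _ _ _ (@open (mpoint Gam))) => //.
move=> _ [U oU <-]; rewrite setTI; apply: open_measurable.
exact: oU.
Qed.

End Topology.

Section Measures.
Variables (R : realType) (Gam : metrized_graph R).
Implicit Types (e : edge Gam) (f : mpoint Gam -> R).
Local Open Scope ereal_scope.
Local Notation signed_measure := (charge (mpoint Gam) R).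

Definition dx_edge e (A : set (mpoint Gam)) : \bar R :=
  @lebesgue_measure R (`]0%R, len e[ `&` edge_pt e @^-1` A).

Let dx_edge0 e : dx_edge e set0 = 0.
Proof. by rewrite /dx_edge preimage_set0 setI0 measure0. Qed.

Let dx_edge_ge0 e A : 0 <= dx_edge e A.
Proof. exact: measure_ge0. Qed.

Let dx_edge_sigma_additive e : semi_sigma_additive (dx_edge e).
Proof.
have mpre A : measurable A -> measurable (`]0%R, len e[ `&` edge_pt e @^-1` A).
  move=> mA; apply: measurableI => //.
  by rewrite -[X in measurable X]setTI; exact: measurable_edge_pt.
move=> F mF tF mUF; rewrite /dx_edge preimage_bigcup setI_bigcupr.
apply: measure_semi_sigma_additive.
- by move=> n; exact: mpre.
- by move=> i j _ _ [t [[_ Fi] [_ Fj]]]; apply: tF => //; exists (edge_pt e t).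
- by rewrite -setI_bigcupr -preimage_bigcup; exact: mpre.
Qed.

HB.instance Definition _ e := isMeasure.Build _ _ _ (dx_edge e)
  (dx_edge0 e) (dx_edge_ge0 e) (@dx_edge_sigma_additive e).

Let dx_edge_fin e : fin_num_fun (dx_edge e).
Proof.
move=> A mA; rewrite ge0_fin_numE ?measure_ge0//.
apply: (@le_lt_trans _ _ (lebesgue_measure (`]0%R, len e[ : set R))).
  apply: le_measure; rewrite ?inE//.
  apply: measurableI => //.
  by rewrite -[X in measurable X]setTI; exact: measurable_edge_pt.
by rewrite lebesgue_measure_itv/=; case: ifP => _; rewrite ?ltry// -EFinD ltry.
Qed.

HB.instance Definition _ e :=
  Measure_isFinite.Build _ _ _ (dx_edge e) (dx_edge_fin e).

Definition charge_dirac (p : mpoint Gam) : signed_measure :=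
  charge_of_finite_measure (dirac p).
Definition charge_dx e : signed_measure :=
  charge_of_finite_measure (dx_edge e).
Definition charge_add (m n : signed_measure) : signed_measure := cadd m n.
Definition charge_scale (c : R) (m : signed_measure) : signed_measure :=
  cscale c m.
Definition charge_sum (I : finType) (m : I -> signed_measure) :
    signed_measure :=
  \big[charge_add/(czero : signed_measure)]_(i : I) m i.

(* The integral against a signed measure, through its Jordan decomposition. *)
Definition charge_integral (m : signed_measure) f : R :=
  let P := cid (Hahn_decomposition m) in
  let N := cid (projT2 P) in
  let H := projT2 N in
  (\int[jordan_pos H]_x f x - \int[jordan_neg H]_x f x)%R.

End Measures.

Section Laplacian.
Variables (R : realType) (Gam : metrized_graph R).
Implicit Types (e : edge Gam) (t : R).
Implicit Types (f : mpoint Gam -> R) (S : seq (mpoint Gam)).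

(* Derivatives of [f] at [edge_pt e t] in the two directions along [e]. *)
Definition d_fwd f e t : R :=
  lim ((h^-1 * (f (edge_pt e (t + h)) - f (edge_pt e t))) @[h --> 0^'+]).
Definition d_bwd f e t : R :=
  lim ((h^-1 * (f (edge_pt e (t - h)) - f (edge_pt e t))) @[h --> 0^'+]).

Definition sum_directional f (p : mpoint Gam) : R :=
  match p with
  | inl v => \sum_(e | src e == v) d_fwd f e 0
             + \sum_(e | tgt e == v) d_bwd f e (len e)
  | inr u => d_fwd f (val u).1 (val u).2 + d_bwd f (val u).1 (val u).2
  end.

(* A vertex set of the metrized graph, possibly enlarged by points of
   valence 2. *)
Definition vertex_set S : Prop := uniq S /\ forall v, vpt v \in S.

Definition C2_off S f : Prop :=
  forall e t, 0 < t < len e -> edge_pt e t \notin S ->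
    [/\ derivable (f \o edge_pt e) t 1,
        derivable (derive1 (f \o edge_pt e)) t 1 &
        {for t, continuous (derive1n 2 (f \o edge_pt e))}].

Definition laplacian S f (A : set (mpoint Gam)) : \bar R :=
  (- (\sum_e \int[lebesgue_measure]_(t in `]0%R, len e[ `&` edge_pt e @^-1` A)
        (derive1n 2 (f \o edge_pt e) t)%:E)
   - \sum_(p <- S) (sum_directional f p)%:E * \d_p A)%E.

(* [Delta f = nu]; for [f] of class C^2 off both [S] and [S'] the measures
   [laplacian S f] and [laplacian S' f] coincide. *)
Definition has_laplacian f (nu : set (mpoint Gam) -> \bar R) : Prop :=
  continuous f /\
  exists S, [/\ vertex_set S, C2_off S f,
    (forall e, lebesgue_measure.-integrable `]0, len e[
                 (EFin \o derive1n 2 (f \o edge_pt e))) &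
    forall A, measurable A -> laplacian S f A = nu A].

Definition piecewise_linear f : Prop :=
  exists S, forall e t, 0 < t < len e -> edge_pt e t \notin S ->
    exists a b : R, \forall s \near t, f (edge_pt e s) = a * s + b.

End Laplacian.

Section Resistance.
Variables (R : realType) (Gam : metrized_graph R).
Implicit Types (x y z : mpoint Gam) (e : edge Gam).

Definition is_voltage z y (f : mpoint Gam -> R) : Prop :=
  [/\ continuous f, piecewise_linear f,
      has_laplacian f (fun A => \d_y A - \d_z A)%E & f z = 0].

(* [j_z(x, y)]; note the order of the arguments of [is_voltage]. *)
Definition voltage z x y : R := xget (fun=> 0) [set f | is_voltage z y f] x.

Definition resistance x y : R := voltage y x x.

End Resistance.

Section Deletion.
Variables (R : realType) (Gam : metrized_graph R) (e : edge Gam).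

Definition del_graph : multigraph :=
  @MultiGraph (vert Gam) {e' : edge Gam | e' != e}
    (fun e' => src (val e')) (fun e' => tgt (val e')) (vert_gt0 Gam).

Definition del_edge : metrized_graph R :=
  @MetrizedGraph R del_graph
    (fun e' => len (val e')) (fun e' => len_gt0 (val e')).

Definition edge_resistance : \bar R :=
  if `[< connected_graph del_edge >]
  then (@resistance R del_edge (@vpt R del_edge (src e))
                               (@vpt R del_edge (tgt e)))%:E
  else +oo%E.

End Deletion.

Section Phi.
Variables (R : realType) (Gam : metrized_graph R).
Local Notation signed_measure := (charge (mpoint Gam) R).
Implicit Types (g : mpoint Gam -> mpoint Gam -> R) (mu : signed_measure).

Definition is_green mu g : Prop :=
  [/\ continuous (fun z : mpoint Gam * mpoint Gam => g z.1 z.2),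
      (forall x y, g x y = g y x),
      (forall y, has_laplacian (g ^~ y) (fun A => \d_y A - mu A)%E) &
      (forall y, charge_integral mu (g ^~ y) = 0)].

Definition green mu : mpoint Gam -> mpoint Gam -> R :=
  xget (fun _ _ => 0) [set g | is_green mu g].

(* [1 / +oo = 0] in extended reals, so bridges get density 0. *)
Definition mu_can : signed_measure :=
  charge_add
    (charge_sum (fun v : vert Gam =>
       charge_scale (1 - 2^-1 * (valence v)%:R) (charge_dirac (vpt v))))
    (charge_sum (fun e : edge Gam =>
       charge_scale (fine (1 / ((len e)%:E + edge_resistance e)))%E
         (charge_dx e))).

Definition total_length : R := \sum_(e : edge Gam) len e.

Variable q : vert Gam -> nat.

Definition delta_K : signed_measure :=
  charge_sum (fun v : vert Gam =>
    charge_scale ((valence v)%:R - 2 + 2 * (q v)%:R) (charge_dirac (vpt v))).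

Definition pol_genus : nat := (genus Gam + \sum_(v : vert Gam) q v)%N.

Definition mu_ad : signed_measure :=
  charge_scale (2 * pol_genus%:R)^-1
    (charge_add (charge_scale 2 mu_can) delta_K).

Definition phi : R :=
  - 4^-1 * total_length
  + 4^-1 * charge_integral
      (charge_add (charge_scale (10 * pol_genus%:R + 2) mu_ad)
                  (charge_scale (-1) delta_K))
      (fun x => green mu_ad x x).

End Phi.

Section Contraction.
Variables (R : realType) (G : multigraph) (L : edge G -> R).

Definition zero_edge : pred (edge G) := fun e => L e == 0.

(* The vertex set of the component of [v] after deleting the edges of nonzero
   length; [v] alone when no edge of length 0 meets [v]. *)
Definition zero_comp (v : vert G) : {set vert G} :=
  [set w | connect (adj zero_edge) v w]%SET.

Definition contr_vert : finType :=
  {C : {set vert G} | C \in [set zero_comp v | v in [set: vert G]]%SET}.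

Definition quot_map (v : vert G) : contr_vert :=
  exist _ (zero_comp v) (imset_f zero_comp (finset.in_setT v)).

Lemma contr_vert_gt0 : (0 < #|contr_vert|)%N.
Proof. by apply/card_gt0P; exists (quot_map (base_vert G)). Qed.

Definition contr_graph : multigraph :=
  @MultiGraph contr_vert {e : edge G | 0 < L e}
    (fun e => quot_map (src (val e))) (fun e => quot_map (tgt (val e)))
    contr_vert_gt0.

Definition contr_mgraph : metrized_graph R :=
  @MetrizedGraph R contr_graph (fun e => L (val e)) (fun e => valP e).

Section Fibre.
Variable C : contr_vert.

Definition fibre_vert : finType := {v : vert G | v \in val C}.
Definition fibre_edge : finType :=
  {e : edge G | (L e == 0) && (src e \in val C)}.

Lemma fibre_src (e : fibre_edge) : src (val e) \in val C.
Proof. by case/andP: (valP e). Qed.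

Lemma fibre_tgt (e : fibre_edge) : tgt (val e) \in val C.
Proof.
have /andP[] := valP e; move: (val e) => {}e Le0.
have /imsetP[v _ ->] := valP C; rewrite !finset.inE => ve.
apply: (connect_trans ve); apply: connect1; apply/existsP; exists e.
by rewrite /zero_edge Le0 !eqxx.
Qed.

Lemma fibre_vert_gt0 : (0 < #|fibre_vert|)%N.
Proof.
case/imsetP: (valP C) => v _ Cv.
have vC : v \in val C by rewrite Cv finset.inE connect0.
by apply/card_gt0P; exists (exist _ v vC).
Qed.

(* The connected subgraph of [G] over the vertex [C] of the contraction. *)
Definition fibre : multigraph :=
  @MultiGraph fibre_vert fibre_edge
    (fun e => exist _ (src (val e)) (fibre_src e))
    (fun e => exist _ (tgt (val e)) (fibre_tgt e)) fibre_vert_gt0.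

End Fibre.

Definition contr_polarization (q : vert G -> nat) (C : vert contr_mgraph) :
    nat :=
  (\sum_(v in val C) q v + genus (fibre C))%N.

End Contraction.

(* The edge lengths given by a point of R^m, for the enumeration of the m edges
   fixed by [enum_rank]. *)
Definition edge_len (R : realType) (G : multigraph) (L : 'rV[R]_#|edge G|)
  (e : edge G) : R := L 0 (enum_rank e).

(* Main.v *)
Require Import Defs.
From mathcomp Require Import all_boot all_order all_algebra.
From mathcomp Require Import all_classical all_reals all_analysis.
From mathcomp Require Import measurable_realfun ring lra zify.
Import Order.TTheory GRing.Theory Num.Theory.
Import numFieldNormedType.Exports.
Local Open Scope classical_set_scope.
Local Open Scope ring_scope.

(** Write r(p, q) for the effective resistance between two vertices, r_e for the
    resistance between the ends s_e, t_e of the edge e, K(v) = val(v) - 2 + 2 q(v),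
    g for the genus, and fix a vertex b.  The theorem rests on the closed formula
    [phi_formulaE]
[[
  phi = - (1/4) sum_e L_e + ((5 g - 2) / g) tau
        + (1 / (4 g)) sum_{v, w} K(v) K(w) r(v, w),
  tau = (1/4) sum_e (r(t_e, b) - r(s_e, b))^2 / L_e
        + (1/12) sum_e (L_e - r_e)^2 / L_e.
]]

    Resistances keep a meaning when some of the lengths vanish.  The Kirchhoff
    equations u(s_e) - u(t_e) = L_e i_e, div i = delta_p - delta_q still
    determine u up to a constant, and u is constant on the connected subgraphs
    that are contracted: r is the resistance of the contracted graph
    ([res_contr]).  The divisor K of the contracted graph is the direct image of
    K, and the genus does not change ([kweight_contr], [pol_genus_contr]).  So
    the same formula, with 1/0 = 0, gives phi of the contracted graph at the
    boundary ([phi_formula_contr]), and the extension asked for is this formula.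

    It is continuous on the closed orthant.  By reciprocity the potentials for
    two length vectors L and L' differ by sum_e (L'_e - L_e) i'_e i_e, and a unit
    current is bounded by 1 on each edge of positive length
    ([pot_current_le1]); so resistances are continuous up to the boundary
    ([gpot_lipschitz]).  The terms of tau have numerators of order L_e^2, so they
    tend to 0 with L_e ([ratio_cvg]).  Other expressions of tau contain the
    quotients r_e / L_e, which in general have no limit at the boundary.

    The closed formula is obtained from the Green function.  The admissible
    measure mu has point masses at the vertices and a constant density on each
    edge.  For such a measure the function g_mu(., y) is quadratic on each edge,
    with a drop of the slope at y, and it is determined by its values at the
    vertices.  These form, up to a constant, the Green matrix of the measure
    obtained by moving half of the mass of each edge to each of its ends.  The
    function so constructed solves the Laplace equation
    ([has_laplacian_shape]), and solutions are unique up to a constant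
    ([laplacian_uniq]): testing the equation on open segments and on points
    shows that a solution is quadratic with prescribed kinks, so that the
    difference of two of them is harmonic.  The same two results identify the
    voltage functions, hence the density (L_e - r_e) / L_e^2 = 1 / (L_e + R(e))
    of mu_can ([edge_density]).  Finally the discrete equation
    Delta r(., w) = 2 mu_can - 2 delta_w ([lap_res]) evaluates all the sums in
    which mu_can occurs. *)

Set Implicit Arguments.
Unset Strict Implicit.
Unset Printing Implicit Defensive.

(** * Currents and potentials on a weighted graph *)

Lemma sum_fibres (R : nmodType) (I J : finType) (f : I -> J) (F : J -> I -> R) :
  \sum_j \sum_(i | f i == j) F j i = \sum_i F (f i) i.
Proof.
rewrite (exchange_big_dep predT) //=; apply: eq_bigr => i _.
by rewrite (big_pred1 (f i)) // => j; rewrite /= eq_sym.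
Qed.

Lemma sum_pred1 (R : pzSemiRingType) (I : finType) (p : I) (F : I -> R) :
  \sum_i (i == p)%:R * F i = F p.
Proof.
rewrite (bigD1 p) //= eqxx mul1r big1 ?addr0// => i /negbTE->.
by rewrite mul0r.
Qed.

(** The image of a symmetric matrix is the orthogonal complement of its kernel.
    Stated over an arbitrary index type because the Kirchhoff system is indexed
    by the disjoint union of the edges and the vertices. *)
Lemma symmetric_solve (F : fieldType) (T : finType) (a : T -> T -> F)
    (b : T -> F) :
  (forall s t, a s t = a t s) ->
  (forall x, (forall t, \sum_s x s * a s t = 0) -> \sum_s x s * b s = 0) ->
  exists x, forall t, \sum_s x s * a s t = b t.
Proof.
move=> asym bker.
pose A : 'M[F]_#|T| := \matrix_(i, j) a (enum_val i) (enum_val j).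
pose B : 'rV[F]_#|T| := \row_j b (enum_val j).
have sumT (f : T -> F) : \sum_(i < #|T|) f (enum_val i) = \sum_t f t.
  by rewrite (reindex (@enum_val T xpredT)) //=; exact/onW_bij/enum_val_bij.
have /submxP[D BD] : (B <= A)%MS.
  rewrite submxE; apply/eqP/rowP => j; rewrite !mxE.
  pose x t := cokermx A (enum_rank t) j.
  rewrite -[RHS](bker x).
    rewrite -[in RHS]sumT; apply: eq_bigr => i _.
    by rewrite /B mxE /x enum_valK mulrC.
  move=> t; have /matrixP/(_ (enum_rank t) j) := mulmx_coker A.
  rewrite !mxE => AC0; rewrite -[RHS]AC0 -[in LHS]sumT; apply: eq_bigr => i _.
  by rewrite /A mxE /x enum_valK enum_rankK asym mulrC.
exists (fun t => D 0 (enum_rank t)) => t.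
have /rowP/(_ (enum_rank t)) := BD; rewrite /B !mxE enum_rankK => ->.
rewrite -[in LHS]sumT; apply: eq_bigr => i _.
by rewrite /A mxE enum_valK enum_rankK.
Qed.

Section Flow.
Variables (R : realType) (G : multigraph).
Implicit Types (u s : vert G -> R) (i L : edge G -> R) (b p q v w x y : vert G).

(** Net flow out of [v] of the current [i], where [i e] flows from [src e] to
    [tgt e]. *)
Definition div i v : R :=
  \sum_(e | src e == v) i e - \sum_(e | tgt e == v) i e.

(** Summation by parts: [div] is the adjoint of the coboundary. *)
Lemma sum_div u i :
  \sum_v u v * div i v = \sum_e (u (src e) - u (tgt e)) * i e.
Proof.
under eq_bigr do rewrite mulrBr !mulr_sumr.
rewrite sumrB (sum_fibres _ (fun v e => u v * i e)).
rewrite (sum_fibres _ (fun v e => u v * i e)) -sumrB.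
by apply: eq_bigr => e _; rewrite mulrBl.
Qed.

Lemma sum_div0 i : \sum_v div i v = 0.
Proof.
under eq_bigr do rewrite -[div i _]mul1r.
by rewrite (sum_div (fun=> 1)) big1// => e _; rewrite subrr mul0r.
Qed.

Lemma div_lin a i i' v : div (fun e => a * i e + i' e) v = a * div i v + div i' v.
Proof. by rewrite /div !big_split /= -!mulr_sumr; ring. Qed.

Lemma eq_div i i' : i =1 i' -> div i =1 div i'.
Proof. by move=> ii' v; rewrite /div; congr (_ - _); apply: eq_bigr. Qed.

Lemma connect_const (T : Type) (B : pred (edge G)) (u : vert G -> T) v w :
  (forall e, B e -> u (src e) = u (tgt e)) -> connect (adj B) v w -> u v = u w.
Proof.
move=> uB /connectP[c + ->]; elim: c v => //= y c IHc v /andP[/existsP[e]].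
by case/andP=> Be /orP[]/andP[/eqP<- /eqP<-] /IHc <-; rewrite uB.
Qed.

Definition dipole p q v : R := (v == p)%:R - (v == q)%:R.

Lemma sum_dipole u p q : \sum_v u v * dipole p q v = u p - u q.
Proof.
by under eq_bigr do rewrite mulrC mulrBl; rewrite sumrB !sum_pred1.
Qed.

(** Ohm's law and Kirchhoff's law for the sources [s].  Ohm's law is not divided
    by [L e], so that a zero length forces equal potentials at its two ends and
    leaves the current free: this is the network of the contracted graph. *)
Definition is_pot L s u i : Prop :=
  (forall e, u (src e) - u (tgt e) = L e * i e) /\ div i =1 s.

Lemma is_pot_lin L a s s' u u' i i' : is_pot L s u i -> is_pot L s' u' i' ->
  is_pot L (fun v => a * s v + s' v) (fun v => a * u v + u' v)
    (fun e => a * i e + i' e).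
Proof.
move=> [ui kir] [ui' kir']; split => [e|v]; last by rewrite div_lin kir kir'.
by rewrite mulrDr (mulrCA _ a) -ui -ui'; ring.
Qed.

(** With [t] the divergence of the current of a second potential, the right-hand
    side is symmetric; this is the source of all reciprocity laws below. *)
Lemma pot_pairing L s t u i k : is_pot L s u i -> div k =1 t ->
  \sum_v u v * t v = \sum_e L e * i e * k e.
Proof.
move=> [ui _] kt; under eq_bigr do rewrite -kt.
by rewrite sum_div; apply: eq_bigr => e _; rewrite ui.
Qed.

(** The unit current cannot exceed 1 on an edge: cut the graph along the level
    set of points of potential higher than that of the lower end of [e].  All
    edges of the cut carry current outwards, and their sum is at most 1. *)
Lemma pot_current_le1 L p q u i e : (forall e, 0 <= L e) ->
  is_pot L (dipole p q) u i -> 0 < L e -> `|i e| <= 1.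
Proof.
move=> L0 + Le0.
suff H p' q' u' i' : is_pot L (dipole p' q') u' i' -> i' e <= 1.
  move=> ui; rewrite ler_norml (H _ _ _ _ ui) andbT lerNl.
  have H0 : is_pot L (dipole q q) (fun=> 0) (fun=> 0).
    by split=> [f|v]; rewrite ?subrr ?mulr0// /div /dipole !big1// !subrr.
  apply: (H q p (fun v => - u v) (fun e => - i e)).
  have [ui' kir'] := is_pot_lin (-1) ui H0.
  split=> [f|v].
    by have := ui' f; lra.
  rewrite -(_ : -1 * dipole p q v + dipole q q v = dipole q p v).
    by rewrite -kir'; apply: eq_div => f; rewrite mulN1r addr0.
  by rewrite /dipole; ring.
move=> ui; case: (lerP (i' e) 0) => [/le_trans->//|ie0]; have [ohm kir] := ui.
(* The indicator function of the cut. *)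
pose w v : R := (u' (tgt e) < u' v)%R%:R.
have : \sum_v w v * dipole p' q' v <= 1.
  by rewrite sum_dipole /w; case: (_ < _); case: (_ < _) => /=; lra.
have -> : \sum_v w v * dipole p' q' v = \sum_v w v * div i' v.
  by apply: eq_bigr => v _; rewrite kir.
rewrite sum_div (bigD1 e)//=; apply: le_trans.
have ue : u' (tgt e) < u' (src e) by rewrite -subr_gt0 ohm mulr_gt0.
rewrite /w ue ltxx subr0 mul1r lerDl; apply: sumr_ge0 => f _.
have := ohm f; case: ltP => us; case: ltP => ut uL; rewrite ?subrr ?mul0r//.
  rewrite subr0 mul1r; have : 0 < L f * i' f by rewrite -uL; lra.
  by move=> Lf; rewrite leNgt; apply/negP => if0; have := L0 f; nra.
rewrite sub0r mulN1r; have : L f * i' f < 0 by rewrite -uL; lra.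
by move=> Lf; rewrite oppr_ge0 leNgt; apply/negP => if0; have := L0 f; nra.
Qed.

Hypothesis G_conn : connected_graph G.

(** The energy [sum L e * i e ^+ 2] of a solution without sources vanishes. *)
Lemma harmonic_const L u i b v : (forall e, 0 <= L e) ->
  is_pot L (fun=> 0) u i -> u v = u b.
Proof.
move=> L0 ui; have [ohm kir] := ui.
apply: (connect_const (B := predT)) (G_conn v b) => e _.
apply/eqP; rewrite -subr_eq0 ohm.
have := pot_pairing ui kir; rewrite big1 => [|w _]; last by rewrite mulr0.
move/esym/eqP; rewrite psumr_eq0 => [|f _]; last by rewrite -mulrA mulr_ge0 ?L0// -expr2 sqr_ge0.
move/allP/(_ e (mem_index_enum _)); rewrite implyTb -mulrA mulf_eq0 => /orP[/eqP->|].
  by rewrite mul0r.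
by rewrite -expr2 expf_eq0 => /andP[_ /eqP->]; rewrite mulr0.
Qed.

Lemma pot_uniq L s u i u' i' b v : (forall e, 0 <= L e) ->
  is_pot L s u i -> is_pot L s u' i' -> u v - u b = u' v - u' b.
Proof.
move=> L0 ui ui'.
have [ohm kir] := is_pot_lin (-1) ui ui'.
suff /(harmonic_const b v L0) : is_pot L (fun=> 0) (fun v => -1 * u v + u' v)
   (fun e => -1 * i e + i' e) by lra.
by split=> // w; rewrite kir; ring.
Qed.

(** The Kirchhoff system in the unknowns [(i, u)] is symmetric, and its kernel
    pairs to zero with sources of total mass 0: along the kernel the potential
    is constant. *)
Lemma pot_exists L s : (forall e, 0 <= L e) -> \sum_v s v = 0 ->
  exists u i, is_pot L s u i.
Proof.
move=> L0 s0.
pose B v e : R := (src e == v)%:R - (tgt e == v)%:R.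
(* The block matrix of the equations: the rows and columns of [L] at the edges,
   the coboundary and its adjoint off the diagonal. *)
pose a (x y : edge G + vert G) := match x, y with
  | inl e, inl f => - (L e * (e == f)%:R)
  | inl e, inr v => B v e
  | inr v, inl e => B v e
  | inr _, inr _ => 0 end.
have aL (x : edge G + vert G -> R) e : \sum_t x t * a t (inl e) =
    - (L e * x (inl e)) + (x (inr (src e)) - x (inr (tgt e))).
  rewrite big_sumType /=; congr (_ + _).
    rewrite (bigD1 e)//= eqxx mulr1 big1 ?addr0 => [|f /negbTE->].
      by rewrite mulrN mulrC.
    by rewrite mulr0 oppr0 mulr0.
  under eq_bigr do rewrite mulrC /B [src e == _]eq_sym [tgt e == _]eq_sym.
  rewrite -[RHS](sum_dipole (fun v => x (inr v))).
  by apply: eq_bigr => v _; rewrite mulrC.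
have aR (x : edge G + vert G -> R) v :
    \sum_t x t * a t (inr v) = div (fun e => x (inl e)) v.
  rewrite big_sumType /= [X in _ + X]big1 ?addr0 => [|w _]; last by rewrite mulr0.
  rewrite /div /B [in RHS]big_mkcond [X in _ = _ - X]big_mkcond -sumrB; apply: eq_bigr => e _.
  by case: (src e == v); case: (tgt e == v) => /=; ring.
pose b (x : edge G + vert G) := match x with inl _ => 0 | inr v => s v end.
have [|x xker|x xP] := @symmetric_solve R (edge G + vert G)%type a b.
- by move=> [e|v] [f|w] //=; rewrite eq_sym; case: eqP => [->//|_]; rewrite !mulr0.
- rewrite big_sumType big1 /= ?add0r => [|e _]; last by rewrite mulr0.
  have ux : is_pot L (fun=> 0) (fun v => x (inr v)) (fun e => x (inl e)).
    split=> [e|v]; first by have := xker (inl e); rewrite aL; lra.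
    by rewrite -aR xker.
  under eq_bigr => v _ do rewrite (harmonic_const (base_vert G) v L0 ux).
  by rewrite -mulr_sumr s0 mulr0.
- exists (fun v => x (inr v)), (fun e => x (inl e)); split=> [e|v].
    by have := xP (inl e); rewrite aL /=; lra.
  by rewrite -aR xP.
Qed.
End Flow.

(** * Green matrix and effective resistance *)

Section GreenMatrix.
Variables (R : realType) (G : multigraph) (G_conn : connected_graph G).
Implicit Types (u s : vert G -> R) (i L : edge G -> R) (b p q v w x y : vert G).

(** Potential at the other vertices of a unit current from [w] to the ground
    [b]; as a function of two vertices, the Green matrix of the graph grounded
    at [b]. *)
Definition gpot L b w : vert G -> R :=
  xget (fun=> 0) [set u | u b = 0 /\ exists i, is_pot L (dipole R w b) u i].

(** Effective resistance, see [resE]; written with the Green matrix so that it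
    is defined by a formula. *)
Definition res L b p q := gpot L b p p + gpot L b q q - 2 * gpot L b p q.

Section Lengths.
Variables (L : edge G -> R) (b : vert G).
Hypothesis L_ge0 : forall e, 0 <= L e.

Lemma gpotP w :
  gpot L b w b = 0 /\ exists i, is_pot L (dipole R w b) (gpot L b w) i.
Proof.
rewrite /gpot; case: xgetP => [u -> //|noP]; exfalso.
have [|u [i ui]] := @pot_exists R G G_conn L (dipole R w b) L_ge0.
  by under eq_bigr do rewrite -[dipole _ _ _ _]mul1r; rewrite (sum_dipole (fun=> 1)) subrr.
apply: (noP (fun v => u v - u b)); split; first by rewrite subrr.
by exists i; split=> [e|v]; [rewrite -ui.1; ring|rewrite ui.2].
Qed.

Lemma gpot_base w : gpot L b w b = 0. Proof. by have [] := gpotP w. Qed.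

Lemma gpotB p q : exists i, is_pot L (dipole R p q)
  (fun v => gpot L b p v - gpot L b q v) i.
Proof.
have [_ [i ip]] := gpotP p; have [_ [k kq]] := gpotP q.
exists (fun e => -1 * k e + i e).
have [ohm kir] := is_pot_lin (-1) kq ip; split=> [e|v].
  by rewrite -ohm; ring.
by rewrite kir /dipole; ring.
Qed.

Lemma gpot_flow p q x y u i : is_pot L (dipole R p q) u i ->
  u x - u y = gpot L b p x - gpot L b q x - (gpot L b p y - gpot L b q y).
Proof. by move=> ui; have [k uk] := gpotB p q; exact: pot_uniq ui uk. Qed.

Lemma gpot_sym v w : gpot L b v w = gpot L b w v.
Proof.
have [v0 [i vi]] := gpotP v; have [w0 [k wk]] := gpotP w.
have := pot_pairing vi wk.2; have := pot_pairing wk vi.2.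
rewrite !sum_dipole v0 w0 !subr0 => -> ->.
by apply: eq_bigr => e _; rewrite mulrAC.
Qed.

Lemma resE p q u i : is_pot L (dipole R p q) u i -> res L b p q = u p - u q.
Proof.
by move=> ui; rewrite (gpot_flow p q ui) /res (gpot_sym q p); ring.
Qed.

Lemma res_sym p q : res L b p q = res L b q p.
Proof. by rewrite /res gpot_sym; ring. Qed.

Lemma res_base p : res L b p b = gpot L b p p.
Proof. by rewrite /res !gpot_base; ring. Qed.

Lemma res_diag p : res L b p p = 0.
Proof. by rewrite /res; ring. Qed.

Lemma res_ge0 p q : 0 <= res L b p q.
Proof.
have [i ui] := gpotB p q; rewrite (resE ui) -(sum_dipole (fun v => gpot L b p v - gpot L b q v)).
rewrite (pot_pairing ui ui.2); apply: sumr_ge0 => e _.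
by rewrite -mulrA mulr_ge0 // -expr2 sqr_ge0.
Qed.

(** Ohm's law with a current of absolute value at most 1. *)
Lemma edge_drop_le p q u i e : is_pot L (dipole R p q) u i ->
  `|u (src e) - u (tgt e)| <= L e.
Proof.
move=> ui; rewrite ui.1 normrM ger0_norm //.
have [->|Le0] := eqVneq (L e) 0; first by rewrite mul0r.
by rewrite ler_piMr // (pot_current_le1 L_ge0 ui) // lt_neqAle eq_sym Le0 L_ge0.
Qed.

Lemma res_edge_le e : res L b (src e) (tgt e) <= L e.
Proof.
have [i ui] := gpotB (src e) (tgt e); rewrite (resE ui).
exact: le_trans (ler_norm _) (edge_drop_le e ui).
Qed.

(** The diagonal entry at [v] is the resistance [r(v, b)].  By symmetry of the
    Green matrix its variation along [e] is the drop of the potential of the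
    sum of the currents from both ends of [e] to [b]. *)
Lemma gpot_diag_drop e :
  `|gpot L b (tgt e) (tgt e) - gpot L b (src e) (src e)| <= 2 * L e.
Proof.
have [_ [i si]] := gpotP (src e); have [_ [k tk]] := gpotP (tgt e).
have := edge_drop_le e si; have := edge_drop_le e tk.
rewrite (gpot_sym (src e) (tgt e)) !ler_norml => /andP[? ?] /andP[? ?].
by apply/andP; split; lra.
Qed.
End Lengths.

(** Reciprocity, with the current [k] for [L'] and the current [i] for [L],
    gives the difference of the potentials as [sum (L' e - L e) * k e * i e].
    The bound is uniform in [L'] because [k] is at most 1 on edges of positive
    length; the edges with [L' e = 0] have [L e = 0] by assumption. *)
Lemma gpot_lipschitz L b p q : (forall e, 0 <= L e) -> exists c : edge G -> R,
  forall L', (forall e, 0 <= L' e) -> (forall e, 0 < L e -> 0 < L' e) ->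
  `|gpot L' b p q - gpot L b p q| <= \sum_e `|L' e - L e| * c e.
Proof.
move=> L0; have [q0 [i qi]] := gpotP b L0 q.
exists (fun e => `|i e|) => L' L'0 LL'.
have [p0 [k pk]] := gpotP b L'0 p.
have [p1 [k' pk']] := gpotP b L0 p.
have E1 : gpot L' b p q = \sum_e L' e * k e * i e.
  by rewrite -(pot_pairing pk qi.2) sum_dipole p0 subr0.
have E2 : gpot L b p q = \sum_e L e * k e * i e.
  rewrite (gpot_sym b L0) -[LHS]subr0 -[in LHS]q0 -sum_dipole (pot_pairing qi pk.2).
  by apply: eq_bigr => e _; rewrite mulrAC.
rewrite E1 E2 -sumrB; apply: le_trans (ler_norm_sum _ _ _) _.
apply: ler_sum => e _; rewrite -!mulrA -mulrBl !normrM mulrA ler_wpM2r //.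
have [L'e|L'e] := eqVneq (L' e) 0.
  suff -> : L e = 0 by rewrite L'e subrr normr0 !mul0r.
  apply/eqP; rewrite eq_le L0 andbT leNgt; apply/negP => /LL'.
  by rewrite L'e ltxx.
rewrite ler_piMr // (pot_current_le1 L'0 pk) // lt_neqAle eq_sym L'e.
exact: L'0.
Qed.

Definition lap L u := div (fun e => (u (src e) - u (tgt e)) / L e).

Section PositiveLengths.
Variables (L : edge G -> R) (b : vert G).
Hypothesis L_gt0 : forall e, 0 < L e.
Let L_ge0 e : 0 <= L e. Proof. exact: ltW. Qed.

Lemma lap_pot s u i : is_pot L s u i -> lap L u =1 s.
Proof.
move=> [ohm kir] v; rewrite -kir; apply: eq_div => e.
by rewrite ohm mulrC mulKf // gt_eqF.
Qed.

Lemma pot_lap u : is_pot L (lap L u) u (fun e => (u (src e) - u (tgt e)) / L e).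
Proof. by split=> // e; rewrite mulrC divfK // gt_eqF. Qed.

Lemma lap_lin a u u' v :
  lap L (fun x => a * u x + u' x) v = a * lap L u v + lap L u' v.
Proof. by rewrite /lap -div_lin; apply: eq_div => e; ring. Qed.

Lemma lap_const c : lap L (fun=> c) =1 fun=> 0.
Proof. by move=> v; rewrite /lap /div !big1 ?subrr// => e _; rewrite mul0r. Qed.

Lemma lap_sum (c : vert G -> R) (F : vert G -> vert G -> R) v :
  lap L (fun x => \sum_w c w * F w x) v = \sum_w c w * lap L (F w) v.
Proof.
elim: (index_enum _) => [|w r IH].
  by rewrite big_nil -[RHS](lap_const 0 v); apply: eq_div => e /=; rewrite !big_nil.
rewrite big_cons -IH -lap_lin; apply: eq_div => e /=.
by rewrite !big_cons.
Qed.

Lemma lap_gpot w : lap L (gpot L b w) =1 dipole R w b.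
Proof. by have [_ [i wi]] := gpotP b L_ge0 w; exact: lap_pot wi. Qed.

Lemma lap0_const u v w : lap L u =1 (fun=> 0) -> u v = u w.
Proof.
move=> u0; apply: (harmonic_const G_conn w v L_ge0).
by split; [exact: (pot_lap u).1|exact: u0].
Qed.

Lemma sum_lap u : \sum_v lap L u v = 0. Proof. exact: sum_div0. Qed.

(** The canonical measure, with the mass [1 - r_e / L e] of each edge moved in
    halves to its ends; see [vertex_weight]. *)
Definition foster v : R := 1 - 2^-1 *
  (\sum_(e | src e == v) res L b (src e) (tgt e) / L e +
   \sum_(e | tgt e == v) res L b (src e) (tgt e) / L e).

(** Discrete form of the equation [Delta_x r(x, w) = 2 mu_can - 2 delta_w].  In
    [r(x, w) = G(x, x) + G(w, w) - 2 G(x, w)] only the first term needs work: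
    [G(v, v) - G(x, x) + r(v, x) = 2 (G(v, v) - G(x, v))] on each edge [vx]. *)
Lemma lap_res w v : lap L (fun x => res L b x w) v = 2 * foster v - 2 * (v == w)%:R.
Proof.
pose a x := gpot L b x x.
have -> : lap L (fun x => res L b x w) v = lap L a v - 2 * dipole R w b v.
  rewrite -lap_gpot addrC -mulNr -lap_lin.
  by apply: eq_div => e; rewrite /res !(gpot_sym b L_ge0 _ w) /a; ring.
suff : lap L a v + 2 * (1 - foster v) = 2 * dipole R v b v.
  by rewrite /dipole eqxx /=; lra.
rewrite -lap_gpot /foster /lap /div.
rewrite opprD addrA subrr add0r opprK mulrA divff // mul1r.
rewrite addrACA -!big_split /= -sumrN -!big_split /=.
rewrite mulrBr !mulr_sumr -sumrN; congr (_ + _); apply: eq_bigr => e /eqP ev.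
  by rewrite /a /res -ev gpot_sym //; ring.
by rewrite /a /res -ev (gpot_sym b L_ge0 (src e)) //; ring.
Qed.

(** Foster's theorem: a Laplacian has total mass 0. *)
Lemma sum_foster : \sum_v foster v = 1.
Proof.
have := sum_lap (fun x => res L b x b).
under eq_bigr do rewrite lap_res -mulrBr.
rewrite -mulr_sumr sumrB => /eqP; rewrite mulf_eq0 pnatr_eq0 /= subr_eq0 => /eqP->.
by under eq_bigr do rewrite -[_%:R]mulr1; rewrite sum_pred1.
Qed.

(** By [lap_res] the left-hand side has Laplacian 0 in [w], so it is constant;
    at [w = b] summation by parts turns it into the energy of [r(., b)]. *)
Lemma sum_foster_res w : 2 * \sum_v foster v * res L b v w =
  \sum_e (res L b (tgt e) b - res L b (src e) b) ^+ 2 / L e.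
Proof.
suff H x : 2 * \sum_v foster v * res L b v x = 2 * \sum_v foster v * res L b v b.
  rewrite H.
  transitivity (\sum_v res L b v b * lap L (fun x => res L b x b) v).
    under [RHS]eq_bigr do rewrite lap_res mulrBr.
    rewrite sumrB [X in _ - X](_ : _ = 0).
      by rewrite subr0 mulr_sumr; apply: eq_bigr => v _; ring.
    rewrite (_ : \sum_i _ = 2 * \sum_i (i == b)%:R * res L b i b).
      by rewrite sum_pred1 res_diag mulr0.
    by rewrite mulr_sumr; apply: eq_bigr => v _; ring.
  by rewrite sum_div; apply: eq_bigr => e _; ring.
congr (_ * _).
apply: (@lap0_const (fun x => \sum_v foster v * res L b v x)) => y.
rewrite lap_sum.
have E v : lap L (res L b v) y = 2 * foster y - 2 * (y == v)%:R.
  by rewrite -lap_res; apply: eq_div => e; rewrite !(res_sym b L_ge0 v).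
under eq_bigr do rewrite E mulrBr.
rewrite sumrB -mulr_suml sum_foster mul1r.
under eq_bigr do rewrite mulrC -mulrA eq_sym.
by rewrite -mulr_sumr sum_pred1 subrr.
Qed.

Section Projection.
Variable M : vert G -> R.
Hypothesis M1 : \sum_v M v = 1.

(** The Green matrix projected, on both sides, to the functions of [M]-mean 0. *)
Definition pgreen v w : R := gpot L b v w - \sum_x M x * gpot L b x w
  - \sum_x M x * gpot L b v x + \sum_x M x * \sum_y M y * gpot L b x y.

Lemma pgreen_sym v w : pgreen v w = pgreen w v.
Proof.
rewrite /pgreen gpot_sym //; congr (_ + _); rewrite addrAC.
by congr (_ - _ - _); apply: eq_bigr => x _; rewrite gpot_sym.
Qed.

Lemma lap_pgreen w v : lap L (pgreen w) v = (v == w)%:R - M v.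
Proof.
pose F x := \sum_y M y * gpot L b y x.
have -> : lap L (pgreen w) v = lap L (gpot L b w) v - lap L F v.
  rewrite -mulN1r addrC -lap_lin; apply: eq_div => e.
  by rewrite /pgreen /F; ring.
rewrite /F lap_sum lap_gpot /dipole.
under eq_bigr do rewrite lap_gpot /dipole mulrBr eq_sym mulrC.
by rewrite sumrB sum_pred1 -mulr_suml M1; ring.
Qed.

Lemma sum_pgreen w : \sum_v M v * pgreen v w = 0.
Proof.
rewrite /pgreen.
under eq_bigr do rewrite mulrDr !mulrBr.
rewrite !(big_split, sumrN) /= -!mulr_suml M1.
by ring.
Qed.

(** The projection depends on the Green matrix only through resistances. *)
Lemma pgreen_diag v : pgreen v v = \sum_x M x * res L b x v
  - 2^-1 * \sum_x \sum_y M x * M y * res L b x y.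
Proof.
have S w : \sum_x M x * res L b x w = \sum_x M x * gpot L b x x + gpot L b w w
   - 2 * \sum_x M x * gpot L b x w.
  have -> : gpot L b w w = \sum_x M x * gpot L b w w by rewrite -mulr_suml M1 mul1r.
  rewrite mulr_sumr -big_split -sumrB /=.
  by apply: eq_bigr => x _; rewrite /res; ring.
have SS : \sum_x \sum_y M x * M y * res L b x y =
    2 * \sum_x M x * gpot L b x x - 2 * \sum_x M x * \sum_y M y * gpot L b x y.
  under eq_bigr => x _ do under eq_bigr => y _ do rewrite -mulrA res_sym//.
  under eq_bigr => x _ do rewrite -mulr_sumr S mulrBr mulrDr.
  rewrite sumrB big_split /= -mulr_suml M1 [X in _ - X](_ : _ =
    2 * \sum_x M x * \sum_y M y * gpot L b x y); first by ring.
  rewrite mulr_sumr; apply: eq_bigr => x _; rewrite mulrCA; congr (_ * (_ * _)).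
  by apply: eq_bigr => y _; rewrite gpot_sym.
rewrite S SS /pgreen.
have -> : \sum_x M x * gpot L b v x = \sum_x M x * gpot L b x v.
  by apply: eq_bigr => x _; rewrite gpot_sym.
by field.
Qed.

Lemma pgreen_res v w :
  pgreen v v + pgreen w w - 2 * pgreen v w = res L b v w.
Proof.
have sw z : \sum_x M x * gpot L b z x = \sum_x M x * gpot L b x z.
  by apply: eq_bigr => x _; rewrite gpot_sym.
by rewrite /pgreen /res !sw; ring.
Qed.
End Projection.
End PositiveLengths.
End GreenMatrix.

(** * Points and open segments of a metrized graph *)

Section EdgePoints.
Variables (R : realType) (Gam : metrized_graph R).
Implicit Types (e : edge Gam) (t : R) (x y p : mpoint Gam).

(** The coordinate along [e], set to 0 outside the interior of [e]; the kernels
    evaluated at it vanish at both ends of [e]. *)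
Definition coord e x : R :=
  match x with
  | inl _ => 0
  | inr u => if (val u).1 == e then (val u).2 else 0
  end.

Lemma edge_pt_le0 e t : t <= 0 -> edge_pt e t = vpt (src e).
Proof. by move=> t0; rewrite /edge_pt insubF ?t0 //= ltNge t0. Qed.

Lemma edge_pt_ge e t : len e <= t -> edge_pt e t = vpt (tgt e).
Proof.
move=> tL; have t0 : 0 < t := lt_le_trans (len_gt0 e) tL.
rewrite /edge_pt insubF; first by rewrite leNgt t0.
by rewrite /= t0 ltNge tL.
Qed.

Lemma edge_ptE e t (t_in : 0 < t < len e) :
  edge_pt e t = inr (exist _ (e, t) t_in).
Proof. by rewrite /edge_pt (insubT (fun et : edge Gam * R => 0 < et.2 < len et.1)). Qed.

Lemma edge_pt_inj e t e' t' : 0 < t < len e -> edge_pt e t = edge_pt e' t' ->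
  e = e' /\ t = t'.
Proof.
move=> t_in; rewrite (edge_ptE t_in).
case: (leP t' 0) => [/edge_pt_le0->//|t'0].
case: (ltP t' (len e')) => [t'L|/edge_pt_ge->//].
have t'_in : 0 < t' < len e' by rewrite t'0.
by rewrite (edge_ptE t'_in) => -[].
Qed.

Variant mpoint_spec : mpoint Gam -> Type :=
  | VertexPoint v : mpoint_spec (vpt v)
  | EdgePoint e t of 0 < t < len e : mpoint_spec (edge_pt e t).

Lemma mpointP x : mpoint_spec x.
Proof.
case: x => [v|[[e t] t_in]]; first exact: VertexPoint.
by rewrite -(edge_ptE t_in); exact: EdgePoint.
Qed.

Lemma vpt_inj : injective (@vpt R Gam). Proof. by move=> v w []. Qed.

Lemma edge_pt_neq_vpt e t v : 0 < t < len e -> edge_pt e t <> vpt v.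
Proof. by move=> t_in; rewrite (edge_ptE t_in). Qed.

Lemma coord_edge_pt e t : 0 < t < len e -> coord e (edge_pt e t) = t.
Proof. by move=> t_in; rewrite (edge_ptE t_in) /= eqxx. Qed.

Lemma coord_neq e e' t : e' != e -> coord e (edge_pt e' t) = 0.
Proof.
move=> /negbTE ee'; rewrite /edge_pt; case: insubP => [u _|_].
  by case: u => -[e1 t1] /= ? [-> _]; rewrite ee'.
by case: ifP.
Qed.

Lemma coord_itv e x : 0 <= coord e x < len e.
Proof.
case: x => [v|[[e' t] t_in]] /=; first by rewrite lexx len_gt0.
case: eqP t_in => [<-|_ _]; last by rewrite lexx len_gt0.
by move=> /andP[/ltW /= -> ->].
Qed.

Lemma openPt (U : set (mpoint Gam)) :
  open U <-> forall e, open (edge_pt e @^-1` U).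
Proof. by []. Qed.

Lemma continuous_edge_pt e : continuous (@edge_pt R Gam e).
Proof. by apply/continuousP => U /openPt; exact. Qed.

Lemma continuous_mpoint (f : mpoint Gam -> R) :
  (forall e, continuous (f \o edge_pt e)) -> continuous f.
Proof.
move=> fe; apply/continuousP => U oU; apply/openPt => e.
by rewrite -comp_preimage; move/continuousP: (fe e); exact.
Qed.

Lemma continuous_on_edge (f : mpoint Gam -> R) e :
  continuous f -> continuous (f \o edge_pt e).
Proof. by move=> fc t; apply: continuous_comp; [exact: continuous_edge_pt|exact: fc]. Qed.

(* Open segment of an edge. *)
Definition segment e a b : set (mpoint Gam) := edge_pt e @` `]a, b[.

Lemma segment_preimage e e' a b : 0 <= a -> b <= len e ->
  edge_pt e' @^-1` segment e a b = if e' == e then `]a, b[%classic else set0.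
Proof.
move=> a0 bL; apply/seteqP; split=> [t [s] /= |t].
  rewrite in_itv /= => /andP[sa sb] /edge_pt_inj[|<- <-]; first by rewrite (le_lt_trans a0 sa) (lt_le_trans sb bL).
  by rewrite eqxx /= in_itv /= sa.
by case: eqP => // -> /= tab; exists t.
Qed.

Lemma segment_open e a b : 0 <= a -> b <= len e -> open (segment e a b).
Proof.
move=> a0 bL; apply/openPt => e'; rewrite segment_preimage //.
case: ifP => _; [exact: interval_open|exact: open0].
Qed.

Lemma open_measurable_mpoint (U : set (mpoint Gam)) : open U -> measurable U.
Proof. by move=> oU; apply: sub_sigma_algebra. Qed.

Lemma measurable_mpoint1 x : measurable [set x].
Proof.
rewrite -[X in measurable X]setCK; apply: measurableC; apply: open_measurable_mpoint.
apply/openPt => e; rewrite -preimage_setC; apply: closed_openC.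
case: (mpointP x) => [v|e' t t_in].
- pose Z := [set t : R | t <= 0]; pose W := [set t : R | len e <= t].
  have -> : edge_pt e @^-1` [set vpt v] = (if src e == v then Z else set0) `|`
      (if tgt e == v then W else set0).
    apply/seteqP; split=> [s /=|s [|]/=]; last 2 first.
    - by case: eqP => // <- /edge_pt_le0.
    - by case: eqP => // <- /edge_pt_ge.
    case: (leP s 0) => [s0|s0]; first by rewrite edge_pt_le0 // => -[<-]; left; rewrite eqxx.
    case: (ltP s (len e)) => [sL|sL].
      by move/edge_pt_neq_vpt; rewrite s0 sL => /(_ isT).
    by rewrite edge_pt_ge // => -[<-]; right; rewrite eqxx.
  apply: closedU; case: ifP => _; [exact: closed_le|exact: closed0|exact: closed_ge|exact: closed0].
- have [->|ee'] := eqVneq e e'.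
    suff -> : edge_pt e' @^-1` [set edge_pt e' t] = [set t] by exact: closed_eq.
    by apply/seteqP; split=> [s /= /esym /edge_pt_inj[]//|s /= ->].
  suff -> : edge_pt e @^-1` [set edge_pt e' t] = set0 by exact: closed0.
  by apply/seteqP; split=> [s /= /esym /edge_pt_inj[]// /esym/eqP|//]; rewrite (negbTE ee').
Qed.

(** A finite set of points leaves free a segment to the right of any point of
    an edge. *)
Lemma right_free (S : seq (mpoint Gam)) e t : 0 <= t < len e ->
  exists2 d, 0 < d & t + d <= len e /\
    forall s, t < s < t + d -> edge_pt e s \notin S.
Proof.
move=> /andP[t0 tL]; elim: S => [|p S [d d0 [dL dS]]].
  by exists (len e - t); [rewrite subr_gt0|split=> //; lra].
have [[u [u_in tu pu]]|np] := pselect (exists u, [/\ 0 < u < len e, t < u & p = edge_pt e u]).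
  exists (Num.min d (u - t)); first by rewrite lt_min d0; lra.
  have [d1 d2] : Num.min d (u - t) <= d /\ Num.min d (u - t) <= u - t.
    by rewrite !ge_min !lexx orbT.
  split=> [|s /andP[ts sd]]; first by lra.
  rewrite in_cons negb_or dS ?andbT; last by lra.
  by apply/eqP; rewrite pu => /edge_pt_inj[|_]; lra.
exists d => //; split=> // s /andP[ts sd].
rewrite in_cons negb_or dS ?ts ?sd // andbT; apply/eqP => ps; apply: np.
by exists s; split=> //; lra.
Qed.

Lemma left_free (S : seq (mpoint Gam)) e t : 0 < t <= len e ->
  exists2 d, 0 < d & d <= t /\
    forall s, t - d < s < t -> edge_pt e s \notin S.
Proof.
move=> /andP[t0 tL]; elim: S => [|p S [d d0 [dL dS]]].
  by exists t.
have [[u [u_in tu pu]]|np] := pselect (exists u, [/\ 0 < u < len e, u < t & p = edge_pt e u]).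
  exists (Num.min d (t - u)); first by rewrite lt_min d0; lra.
  have [d1 d2] : Num.min d (t - u) <= d /\ Num.min d (t - u) <= t - u.
    by rewrite !ge_min !lexx orbT.
  split=> [|s /andP[ts sd]]; first by lra.
  rewrite in_cons negb_or dS ?andbT; last by lra.
  by apply/eqP; rewrite pu => /edge_pt_inj[|_]; lra.
exists d => //; split=> // s /andP[ts sd].
rewrite in_cons negb_or dS ?ts ?sd // andbT; apply/eqP => ps; apply: np.
by exists s; split=> //; lra.
Qed.

End EdgePoints.

(** * Quadratic functions of a real variable *)

Section RealCalculus.
Variable R : realType.
Implicit Types (F : R -> R) (a b c t s A B : R).

Definition quad A B c s : R := A + B * s + c / 2 * s ^+ 2.

Lemma is_derive_quad A B c t : is_derive t (1 : R) (quad A B c) (B + c * t).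
Proof.
have dX := is_derive_id t (1 : R).
have dq := is_deriveD (is_deriveD (is_derive_cst A t 1) (is_deriveZ B dX))
                      (is_deriveZ (c / 2) (is_deriveM dX dX)).
have -> : quad A B c = cst A + B \*: id + (c / 2) \*: (id * id).
  by apply/funext => s; rewrite /quad !fctE expr2.
rewrite (_ : B + c * t = 0 + B *: 1 + (c / 2) *: (t *: 1 + t *: 1)) //.
by rewrite /GRing.scale /=; field.
Qed.

Lemma continuous_quad A B c : continuous (quad A B c).
Proof.
move=> t; apply: differentiable_continuous; apply/derivable1_diffP.
by have [] := is_derive_quad A B c t.
Qed.

(** The second derivative is taken as an iterated [derive1], so it is enough to
    know the function near [t]. *)
Lemma near_quad_derive F A B c t : (\forall s \near t, F s = quad A B c s) ->
  [/\ derivable F t 1, derivable (derive1 F) t 1,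
      {for t, continuous (derive1n 2 F)}, derive1 F t = B + c * t &
      derive1n 2 F t = c].
Proof.
move=> Fq.
have F1 s : (\forall r \near s, F r = quad A B c r) -> is_derive s (1 : R) F (B + c * s).
  move=> Fs; apply: near_eq_is_derive (is_derive_quad A B c s).
  by near=> r; apply/esym; near: r.
have d1 : \forall s \near t, derive1 F s = quad B c 0 s.
  move/near_join: Fq; apply: filterS => s /F1 Fs.
  by rewrite derive1E derive_val /quad; ring.
have F2 s : (\forall r \near s, derive1 F r = quad B c 0 r) ->
    is_derive s (1 : R) (derive1 F) c.
  move=> Fs; rewrite (_ : c = c + 0 * s); last by ring.
  apply: near_eq_is_derive (is_derive_quad B c 0 s).
  by near=> r; apply/esym; near: r.
have d2 : \forall s \near t, derive1n 2 F s = c.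
  move/near_join: d1; apply: filterS => s /F2 Fs.
  by rewrite /= derive1E derive_val.
have Ft := F1 _ Fq; have F't := F2 _ d1.
split.
- by have [] := Ft.
- by have [] := F't.
- suff : derive1n 2 F s @[s --> t] --> c by rewrite -[X in _ --> X](nbhs_singleton d2).
  have H : {near t, cst c =1 derive1n 2 F} by near=> s; apply/esym; near: s.
  exact: cvg_trans (near_eq_cvg H) (cvg_cst c).
- by rewrite derive1E derive_val.
- exact: nbhs_singleton d2.
Unshelve. all: by end_near. Qed.

Lemma zero_derive_const F a b : {within `[a, b], continuous F} ->
  (forall s, a < s < b -> is_derive s (1 : R) F 0) ->
  forall s, a <= s <= b -> F s = F a.
Proof.
move=> Fc F0 s /andP[a_s sb].
have [||r rab /eqP] := @MVT_segment R F (fun=> 0) a s a_s.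
- move=> r; rewrite in_itv /= => /andP[ar rs]; apply: F0.
  by rewrite ar (lt_le_trans rs sb).
- apply: continuous_subspaceW Fc => r /=; rewrite !in_itv /= => /andP[-> rs].
  exact: le_trans rs sb.
by rewrite mul0r subr_eq0 => /eqP.
Qed.

(** Measures only see integrals of the second derivative.  By the fundamental
    theorem of calculus the derivative is affine of slope [c] inside, and the
    mean value theorem carries the conclusion to the closed interval. *)
Lemma quad_of_mean_derive2 F a b c : a < b -> continuous F ->
  (forall s, a < s < b -> [/\ derivable F s 1, derivable (derive1 F) s 1 &
     {for s, continuous (derive1n 2 F)}]) ->
  (forall s1 s2, a < s1 -> s1 < s2 -> s2 < b ->
     (\int[lebesgue_measure]_(t in `]s1, s2[) (derive1n 2 F t)%:E)%E =
       (c * (s2 - s1))%:E) ->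
  exists A B, forall s, a <= s <= b -> F s = quad A B c s.
Proof.
move=> ab Fc F2 Fint.
have inc s1 s2 : a < s1 -> s1 < s2 -> s2 < b ->
    derive1 F s2 - derive1 F s1 = c * (s2 - s1).
  move=> as1 s12 s2b; apply: EFin_inj; rewrite -Fint //.
  have sab s : s1 <= s <= s2 -> a < s < b by move=> ?; lra.
  have F2c : {within `[s1, s2], continuous (derive1n 2 F)}.
    apply: continuous_in_subspaceT => s; rewrite inE /= in_itv /= => /sab/F2[_ _].
    exact.
  have F1c s : a < s < b -> {for s, continuous (derive1 F)}.
    by move=> /F2[_ /derivable1_diffP/differentiable_continuous].
  rewrite -(@integral_itv_bndoo _ _ _ _ true false); last first.
    apply/measurable_EFinP.
    apply: (@measurable_funS _ _ _ _ `[s1, s2]) => //.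
      by apply: subset_itvW; rewrite lexx.
    exact: subspace_continuous_measurable_fun.
  rewrite (@continuous_FTC2 _ _ (derive1 F)) //.
  split=> [s||].
  - by rewrite in_itv /= => s_in; have [] := F2 s _; [lra|].
  - by apply: cvg_at_right_filter; apply: F1c; lra.
  - by apply: cvg_at_left_filter; apply: F1c; lra.
pose m := (a + b) / 2; pose B := derive1 F m - c * m.
have dF s : a < s < b -> derive1 F s = B + c * s.
  move=> sab; rewrite /B; case: (ltgtP s m) => [sm|ms|->]; last by ring.
    by have := inc s m; rewrite /m in sm *; move: sab => /andP[? ?]; lra.
  by have := inc m s; rewrite /m in ms *; move: sab => /andP[? ?]; lra.
pose K s := F s - quad 0 B c s.
have K0 : forall s, a <= s <= b -> K s = K a.
  apply: zero_derive_const => [|s sab].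
    apply: continuous_subspaceT => s; apply: cvgB; first exact: Fc.
    exact: continuous_quad.
  have Fs : is_derive s (1 : R) F (B + c * s).
    have [Fs _ _] := F2 _ sab.
    by apply: DeriveDef => //; rewrite -derive1E dF.
  have qs := is_derive_quad 0 B c s.
  by apply: is_derive_eq; rewrite subrr.
by exists (K a), B => s /K0; rewrite /K /quad; lra.
Qed.

(** The one-sided derivatives of a function that is quadratic on one side. *)
Lemma right_quotient_quad F t d A B c : 0 < d ->
  (forall s, t <= s <= t + d -> F s = quad A B c s) ->
  (h^-1 * (F (t + h) - F t)) @[h --> 0^'+] --> B + c * t.
Proof.
move=> d0 Fq.
have H : \forall h \near (0 : R)^'+, quad (B + c * t) (c / 2) 0 h = h^-1 * (F (t + h) - F t).
  near=> h.
  have h0 : 0 < h by near: h; exact: nbhs_right_gt.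
  have hd : h <= d by near: h; exact: nbhs_right_le.
  rewrite !Fq ?lexx /= ?lerDl; [|lra|lra].
  by rewrite /quad; field; rewrite gt_eqF.
apply: (cvg_trans (near_eq_cvg H)).
apply: cvg_at_right_filter.
rewrite [X in _ --> X](_ : _ = quad (B + c * t) (c / 2) 0 0); last by rewrite /quad; ring.
exact: continuous_quad.
Unshelve. all: by end_near. Qed.

Lemma left_quotient_quad F t d A B c : 0 < d ->
  (forall s, t - d <= s <= t -> F s = quad A B c s) ->
  (h^-1 * (F (t - h) - F t)) @[h --> 0^'+] --> - (B + c * t).
Proof.
move=> d0 Fq.
have := @right_quotient_quad (F \o -%R) (- t) d A (- B) c d0.
rewrite (_ : - B + c * - t = - (B + c * t)); last by ring.
under eq_fun do rewrite /= opprD !opprK.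
apply=> s /andP[? ?]; rewrite /= Fq; last by lra.
by rewrite /quad; ring.
Qed.

End RealCalculus.

(** * Uniqueness for the Laplace equation *)

Section Uniqueness.
Variables (R : realType) (Gam : metrized_graph R).
Implicit Types (e : edge Gam) (t : R) (x y p : mpoint Gam).
Implicit Types (f : mpoint Gam -> R) (m : vert Gam -> R) (c : edge Gam -> R).

(** Point masses [m] at the vertices and constant density [c] on each edge: the
    form of the canonical and of the admissible measure. *)
Definition pc_measure m c (A : set (mpoint Gam)) : \bar R :=
  (\sum_v (m v)%:E * \d_(vpt v) A + \sum_e (c e)%:E * dx_edge e A)%E.

Definition vmass m p : R := if p is inl v then m v else 0.

Lemma has_laplacian_eq f nu nu' : (forall A, measurable A -> nu A = nu' A) ->
  has_laplacian f nu -> has_laplacian f nu'.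
Proof.
move=> nunu' [fc [S [S1 S2 S3 S4]]]; split=> //; exists S; split=> // A mA.
by rewrite S4 ?nunu'.
Qed.

Lemma edge_trace_segment e e' a b : 0 <= a -> b <= len e ->
  `]0, len e'[ `&` edge_pt e' @^-1` segment e a b =
  if e' == e then `]a, b[%classic else set0.
Proof.
move=> a0 bL; rewrite segment_preimage //; case: eqP => [->|_]; last by rewrite setI0.
apply/setIidr => s /=; rewrite !in_itv /= => /andP[as_ sb].
by rewrite (le_lt_trans a0) // (lt_le_trans sb).
Qed.

Lemma edge_trace1 e p : exists t,
  `]0, len e[ `&` edge_pt e @^-1` [set p] `<=` [set t].
Proof.
case: (pselect (exists2 t, 0 < t < len e & p = edge_pt e t)) => [[t t_in ->]|np].
  by exists t => s [/= _ /esym/edge_pt_inj[]].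
exists 0 => s [/=]; rewrite in_itv /= => s_in sp; exfalso; apply: np.
by exists s.
Qed.

Lemma pc_measure_segment m c e a b : 0 <= a -> a < b -> b <= len e ->
  pc_measure m c (segment e a b) = (c e * (b - a))%:E.
Proof.
move=> a0 ab bL; rewrite /pc_measure big1 => [|v _]; last first.
  rewrite diracE memNset ?mule0// => -[s] /=; rewrite in_itv /= => s_in.
  by apply: edge_pt_neq_vpt; lra.
rewrite add0e (bigD1 e) //= big1 => [|e' /negbTE e'e]; last first.
  by rewrite /dx_edge edge_trace_segment // e'e measure0 mule0.
by rewrite adde0 /dx_edge edge_trace_segment // eqxx lebesgue_measure_itv /= lte_fin ab.
Qed.

Lemma pc_measure1 m c p : pc_measure m c [set p] = (vmass m p)%:E.
Proof.
rewrite /pc_measure [X in (_ + X)%E]big1 => [|e _]; last first.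
  have [t sub] := edge_trace1 e p.
  rewrite /dx_edge (_ : lebesgue_measure _ = 0) ?mule0//.
  apply/eqP; rewrite eq_le measure_ge0 andbT -(lebesgue_measure_set1 t).
  apply: le_measure; rewrite ?inE //.
  apply: measurableI => //; rewrite -[X in measurable X]setTI.
  by apply: measurable_edge_pt => //; exact: measurable_mpoint1.
rewrite adde0 /vmass; case: p => [v|u].
  rewrite (bigD1 v) //= diracE mem_set // mule1 big1 ?adde0 // => w /eqP wv.
  by rewrite diracE memNset ?mule0// => -[].
by rewrite big1 // => w _; rewrite diracE memNset ?mule0.
Qed.

(** Testing on open segments isolates the density of the Laplacian, and testing
    on points ([laplacian1]) isolates its atoms. *)
Lemma laplacian_segment S f e a b : 0 <= a -> b <= len e ->
  (forall s, a < s < b -> edge_pt e s \notin S) ->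
  laplacian S f (segment e a b) =
  (- \int[lebesgue_measure]_(t in `]a, b[) (derive1n 2 (f \o edge_pt e) t)%:E)%E.
Proof.
move=> a0 bL free; rewrite /laplacian [X in (_ - X)%E]big1_seq ?sube0 => [|p /andP[_ pS]].
  congr (- _)%E; rewrite (bigD1 e) //= big1 => [|e' /negbTE e'e].
    by rewrite adde0 edge_trace_segment // eqxx.
  by rewrite edge_trace_segment // e'e integral_set0.
rewrite diracE memNset ?mule0 // => -[s] /=; rewrite in_itv /= => /free + sp.
by rewrite sp pS.
Qed.

Lemma laplacian1 S f p : uniq S -> laplacian S f [set p] =
  (- (if p \in S then sum_directional f p else 0)%:E)%E.
Proof.
move=> uS; rewrite /laplacian big1 => [|e _]; last first.
  by have [t] := edge_trace1 e p; exact: integral_Sset1.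
rewrite oppe0 add0e; congr (- _)%E.
case: ifPn => [pS|pS].
  rewrite (bigD1_seq p) //= diracE mem_set // mule1 big1 ?adde0 // => r rp.
  by rewrite diracE memNset ?mule0 // => /eqP; rewrite (negbTE rp).
rewrite big1_seq // => r /andP[_ rS]; rewrite diracE memNset ?mule0 // => rp.
by rewrite -rp rS in pS.
Qed.

Section OneFunction.
Variables (y : mpoint Gam) (m : vert Gam -> R) (c : edge Gam -> R) (f : mpoint Gam -> R).
Hypothesis f_lap : has_laplacian f (fun A => \d_y A - pc_measure m c A)%E.

(** Local form of a solution of [Delta f = delta_y - mu] for a measure [mu] with
    constant densities: it is quadratic away from finitely many points, and its
    outgoing slopes at each of these are prescribed by the atoms. *)
Lemma free_quad : exists2 S, vertex_set S & (forall e a b, 0 <= a -> a < b -> b <= len e ->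
  (forall s, a < s < b -> edge_pt e s \notin y :: S) ->
  exists A B, forall s, a <= s <= b -> f (edge_pt e s) = quad A B (c e) s) /\
  (forall p, p \in S -> sum_directional f p = vmass m p - (p == y)%:R) /\
  (forall p, p \notin S -> p != y).
Proof.
have [fc [S [S_vs S_C2 S_int S_lap]]] := f_lap; exists S => //.
have node p : ((p == y)%:R - vmass m p)%:E =
    (- (if p \in S then sum_directional f p else 0)%:E)%E.
  rewrite -laplacian1; last by have [] := S_vs.
  rewrite S_lap; last exact: measurable_mpoint1.
  rewrite pc_measure1 diracE EFinB; congr (((nat_of_bool _)%:R)%:E - _)%E.
  by apply/idP/idP => [/eqP->|/set_mem ->//]; exact: mem_set.
split; last split.
- move=> e a b a0 ab bL free.
  apply: (@quad_of_mean_derive2 R (f \o edge_pt e)) => //.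
  + exact: continuous_on_edge.
  + move=> s s_in; apply: S_C2; first by lra.
    by have := free s s_in; rewrite in_cons negb_or => /andP[].
  + move=> s1 s2 as1 s12 s2b.
    have free12 s : s1 < s < s2 -> edge_pt e s \notin y :: S by move=> ?; apply: free; lra.
    have := S_lap (segment e s1 s2); rewrite laplacian_segment; [|lra|lra|]; last first.
      by move=> s /free12; rewrite in_cons negb_or => /andP[].
    rewrite pc_measure_segment; [|lra|lra|lra].
    rewrite diracE memNset; last first.
      move=> [s] /=; rewrite in_itv /= => /free12 + sy.
      by rewrite sy inE eqxx.
    rewrite sub0e => H; apply: oppe_inj; rewrite H //.
    apply: open_measurable_mpoint; apply: segment_open; lra.
- by move=> p pS; have := node p; rewrite pS => -[]; lra.
- move=> p pS; have := node p; rewrite (negbTE pS).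
  have -> : vmass m p = 0.
    by case: (p) pS => // v; have [_ /(_ v) vS] := S_vs; rewrite /vpt in vS; rewrite vS.
  by case: eqP => // _ []; lra.
Qed.

(** Being quadratic on one side, a solution has one-sided derivatives, so that
    [d_fwd] is a genuine limit and not a default value. *)
Lemma right_quad e t : 0 <= t < len e -> exists d A B, [/\ 0 < d, t + d <= len e,
  forall s, t <= s <= t + d -> f (edge_pt e s) = quad A B (c e) s &
  d_fwd f e t = B + c e * t].
Proof.
move=> t_in; have [S _ [Sq _]] := free_quad.
have [d d0 [dL free]] := right_free (y :: S) t_in.
have [|||//|A [B fq]] := Sq e t (t + d); [lra..|].
exists d, A, B; split=> //; apply: cvg_lim => //.
exact: right_quotient_quad d0 fq.
Qed.

Lemma left_quad e t : 0 < t <= len e -> exists d A B, [/\ 0 < d, d <= t,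
  forall s, t - d <= s <= t -> f (edge_pt e s) = quad A B (c e) s &
  d_bwd f e t = - (B + c e * t)].
Proof.
move=> t_in; have [S _ [Sq _]] := free_quad.
have [d d0 [dL free]] := left_free (y :: S) t_in.
have [|||//|A [B fq]] := Sq e (t - d) t; [lra..|].
exists d, A, B; split=> //; apply: cvg_lim => //.
exact: left_quotient_quad d0 fq.
Qed.

(** At a point where the solution is of class C^2 it is quadratic on both sides
    with the same coefficients, and the two slopes cancel. *)
Lemma sum_directionalE p : sum_directional f p = vmass m p - (p == y)%:R.
Proof.
have [S S_vs [Sq [SS Sy]]] := free_quad.
have [/SS//|pS] := boolP (p \in S).
have := Sy _ pS; case: (mpointP p) pS => [v|e t t_in] pS py.
  by have [_ /(_ v)] := S_vs; rewrite (negbTE pS).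
rewrite (negbTE py) subr0 (edge_ptE t_in) /=.
have [|d1 d10 [d1L free1]] := @right_free _ _ (y :: S) e t; first lra.
have [|d2 d20 [d2L free2]] := @left_free _ _ (y :: S) e t; first lra.
have [||||A [B fq]] := Sq e (t - d2) (t + d1); [lra..| |].
  move=> s s_in; case: (ltgtP s t) => [st|ts|->].
  - by apply: free2; lra.
  - by apply: free1; lra.
  - by rewrite in_cons negb_or py.
rewrite (_ : d_fwd f e t = B + c e * t); last first.
  apply: cvg_lim => //; apply: (@right_quotient_quad _ (f \o edge_pt e) t d1 A) => // s s_in; apply: fq; lra.
rewrite (_ : d_bwd f e t = - (B + c e * t)) ?subrr//.
apply: cvg_lim => //; apply: (@left_quotient_quad _ (f \o edge_pt e) t d2 A) => // s s_in.
by apply: fq; lra.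
Qed.

End OneFunction.

(** Affine near each interior point means that the second derivative vanishes. *)
Lemma locally_affine_affine (F : R -> R) (L : R) : 0 < L -> continuous F ->
  (forall t, 0 < t < L -> exists d A B, 0 < d /\
     forall s, t - d <= s <= t + d -> F s = quad A B 0 s) ->
  exists A B, forall s, 0 <= s <= L -> F s = quad A B 0 s.
Proof.
move=> L0 Fc Floc.
have nearF t : 0 < t < L -> exists A B, \forall s \near t, F s = quad A B 0 s.
  move=> /Floc[d [A [B [d0 Fq]]]]; exists A, B; near=> s; apply: Fq.
  have : ball t d s by near: s; exact: nbhsx_ballx.
  by rewrite /ball /= ltr_norml => ?; lra.
apply: quad_of_mean_derive2 => //.
  by move=> s /nearF[A [B /near_quad_derive[]]].
move=> s1 s2 s10 s12 s2L; rewrite mul0r.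
rewrite -[RHS](integral0 (@lebesgue_measure R) `]s1, s2[).
apply: eq_integral => s; rewrite inE /= in_itv /= => s_in.
have [|A [B /near_quad_derive[_ _ _ _ F20]]] := nearF s; first lra.
by congr EFin; exact: F20.
Unshelve. all: by end_near. Qed.

Hypothesis Gam_conn : connected_graph Gam.

(** The difference of two solutions is affine on the edges, because the kinks
    and the quadratic terms cancel, and at the vertices its outgoing slopes add
    up to 0.  Its restriction to the vertices is harmonic, hence constant. *)
Lemma laplacian_uniq y m c f f' :
  has_laplacian f (fun A => \d_y A - pc_measure m c A)%E ->
  has_laplacian f' (fun A => \d_y A - pc_measure m c A)%E ->
  exists k, forall x, f x = f' x + k.
Proof.
move=> fl fl'; pose h x := f x - f' x.
have hc : continuous h.
  have [[fc _] [f'c _]] := (fl, fl').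
  by move=> x; exact: (cvgB (fc x) (f'c x)).
have haff e : exists A B, forall s, 0 <= s <= len e -> h (edge_pt e s) = quad A B 0 s.
  apply: (@locally_affine_affine (h \o edge_pt e)) => //; first exact: len_gt0.
    exact: continuous_on_edge.
  move=> t t_in.
  have tr : 0 <= t < len e by lra.
  have tl : 0 < t <= len e by lra.
  have [d1 [A1 [B1 [d10 d1L f1 g1]]]] := right_quad fl tr.
  have [d1' [A1' [B1' [d1'0 d1'L f1' g1']]]] := right_quad fl' tr.
  have [d2 [A2 [B2 [d20 d2L f2 g2]]]] := left_quad fl tl.
  have [d2' [A2' [B2' [d2'0 d2'L f2' g2']]]] := left_quad fl' tl.
  have := sum_directionalE fl (edge_pt e t); have := sum_directionalE fl' (edge_pt e t).
  rewrite !(edge_ptE t_in) /= g1 g1' g2 g2' => S' S.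
  have BB : B1 - B1' = B2 - B2' by lra.
  have [f1t f1t' f2t f2t'] : [/\ f (edge_pt e t) = quad A1 B1 (c e) t,
      f' (edge_pt e t) = quad A1' B1' (c e) t, f (edge_pt e t) = quad A2 B2 (c e) t &
      f' (edge_pt e t) = quad A2' B2' (c e) t].
    by split; [apply: f1|apply: f1'|apply: f2|apply: f2']; lra.
  have BBs s : B1 * s - B1' * s = B2 * s - B2' * s by rewrite -!mulrBl BB.
  have AA : A1 - A1' = A2 - A2'.
    by have := BBs t; move: f1t f1t' f2t f2t'; rewrite /quad; lra.
  pose d := Num.min (Num.min d1 d1') (Num.min d2 d2').
  have [dd1 dd1' dd2 dd2'] : [/\ d <= d1, d <= d1', d <= d2 & d <= d2'].
    by rewrite /d !ge_min !lexx !orbT.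
  exists d, (A1 - A1'), (B1 - B1').
  split=> [|s s_in]; first by rewrite !lt_min d10 d1'0 d20 d2'0.
  rewrite /= /h; case: (leP t s) => ts.
    by rewrite f1 ?f1' /quad; [ring|lra|lra].
  by rewrite f2 ?f2'; [have := BBs s; rewrite /quad; lra|lra|lra].
have slopes e : d_fwd f e 0 - d_fwd f' e 0 =
      - ((h (vpt (src e)) - h (vpt (tgt e))) / len e) /\
    d_bwd f e (len e) - d_bwd f' e (len e) =
      (h (vpt (src e)) - h (vpt (tgt e))) / len e.
  have L0 := len_gt0 e; have [A [B hAB]] := haff e.
  have hs : h (vpt (src e)) = A.
    by have := hAB 0; rewrite edge_pt_le0 // => ->; [rewrite /quad; ring|lra].
  have ht : h (vpt (tgt e)) = A + B * len e.
    by have := hAB (len e); rewrite edge_pt_ge // => ->; [rewrite /quad; ring|lra].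
  have -> : (h (vpt (src e)) - h (vpt (tgt e))) / len e = - B.
    by rewrite hs ht; field; rewrite gt_eqF.
  (* Two quadratic functions with the same leading coefficient, whose difference
     agrees with an affine function at two points. *)
  have slope B1 B1' A1 A1' s s' : s != s' ->
      (forall r, r = s \/ r = s' -> [/\ 0 <= r <= len e,
        f (edge_pt e r) = quad A1 B1 (c e) r & f' (edge_pt e r) = quad A1' B1' (c e) r]) ->
      B1 - B1' = B.
    move=> ss' rP.
    have [s1 s2 s3] := rP s (or_introl erefl); have [s1' s2' s3'] := rP s' (or_intror erefl).
    have := hAB s s1; have := hAB s' s1'; rewrite /h s2 s3 s2' s3' /quad => E1 E2.
    apply/eqP; rewrite -subr_eq0 -(mulIr_eq0 _ (mulIf (_ : s - s' != 0))) ?subr_eq0 //.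
    by apply/eqP; lra.
  have [|d1 [A1 [B1 [d10 d1L f1 ->]]]] := @right_quad _ _ _ _ fl e 0; first lra.
  have [|d1' [A1' [B1' [d1'0 d1'L f1' ->]]]] := @right_quad _ _ _ _ fl' e 0; first lra.
  have [|d2 [A2 [B2 [d20 d2L f2 ->]]]] := @left_quad _ _ _ _ fl e (len e); first lra.
  have [|d2' [A2' [B2' [d2'0 d2'L f2' ->]]]] := @left_quad _ _ _ _ fl' e (len e); first lra.
  have [dd1 dd1' dd0] : [/\ Num.min d1 d1' <= d1, Num.min d1 d1' <= d1' & 0 < Num.min d1 d1'].
    by rewrite !ge_min !lexx !orbT lt_min d10.
  have [dd2 dd2' dd02] : [/\ Num.min d2 d2' <= d2, Num.min d2 d2' <= d2' & 0 < Num.min d2 d2'].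
    by rewrite !ge_min !lexx !orbT lt_min d20.
  have : B1 - B1' = B.
    apply: (slope _ _ A1 A1' 0 (Num.min d1 d1')); first by rewrite lt_eqF.
    by move=> r [|] ->; split; [lra|apply: f1; lra|apply: f1'; lra|lra|apply: f1; lra|apply: f1'; lra].
  have : B2 - B2' = B.
    apply: (slope _ _ A2 A2' (len e) (len e - Num.min d2 d2')).
      by rewrite gt_eqF // gtrBl.
    by move=> r [|] ->; split; [lra|apply: f2; lra|apply: f2'; lra|lra|apply: f2; lra|apply: f2'; lra].
  by move=> <- B12; split; lra.
have hV v w : h (vpt v) = h (vpt w).
  pose hv u := h (vpt u).
  have H0 u : lap (@len R Gam) hv u = 0.
    have := sum_directionalE fl (vpt u); have := sum_directionalE fl' (vpt u).
    rewrite /= => S' S; apply: oppr_inj; rewrite oppr0.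
    transitivity (\sum_(e | src e == u) (d_fwd f e 0 - d_fwd f' e 0) +
      \sum_(e | tgt e == u) (d_bwd f e (len e) - d_bwd f' e (len e))).
      rewrite /lap /div opprB addrC -sumrN; congr (_ + _).
        by apply: eq_bigr => e _; rewrite (slopes e).1.
      by apply: eq_bigr => e _; rewrite (slopes e).2.
    by rewrite !sumrB; lra.
  exact: (@lap0_const R Gam Gam_conn (@len R Gam) (@len_gt0 R Gam) hv v w H0).
exists (h (vpt (base_vert Gam))) => x.
suff : h x = h (vpt (base_vert Gam)) by rewrite /h; lra.
case: (mpointP x) => [v|e t t_in]; first exact: hV.
have [A [B hAB]] := haff e; have L0 := len_gt0 e.
have hs : h (vpt (src e)) = A.
  by have := hAB 0; rewrite edge_pt_le0 // => ->; [rewrite /quad; ring|lra].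
have ht : h (vpt (tgt e)) = A + B * len e.
  by have := hAB (len e); rewrite edge_pt_ge // => ->; [rewrite /quad; ring|lra].
have /eqP : B * len e = 0 by have := hV (src e) (tgt e); rewrite hs ht; lra.
rewrite mulf_eq0 [len e == 0]gt_eqF // orbF => /eqP B0.
rewrite hAB; last by lra.
by rewrite -(hV (src e)) hs B0 /quad; ring.
Qed.

End Uniqueness.

(** * Explicit solutions of the Laplace equation *)

Section Shapes.
Variables (R : realType) (Gam : metrized_graph R).
Implicit Types (e : edge Gam) (t b : R) (x y p : mpoint Gam).
Implicit Types (f : mpoint Gam -> R) (u m : vert Gam -> R) (c : edge Gam -> R).

Definition clamp e t : R := Num.max 0 (Num.min t (len e)).

Lemma clamp_itv e t : 0 <= clamp e t <= len e.
Proof.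
rewrite /clamp le_max lexx /= ge_max ge_min lexx orbT andbT.
exact/ltW/len_gt0.
Qed.

Lemma edge_pt_clamp e t : edge_pt e (clamp e t) = edge_pt e t.
Proof.
have L0 := len_gt0 e; rewrite /clamp; case: (lerP t (len e)) => tL.
  by case: (lerP 0 t) => // t0; rewrite !edge_pt_le0 // ltW.
by rewrite max_r ?ltW // !edge_pt_ge // ltW.
Qed.

Lemma continuous_clamp e : continuous (clamp e).
Proof.
move=> t; apply: (@continuous_max R R (cst 0) (id \min cst (len e))); first exact: cvg_cst.
by apply: (@continuous_min R R id (cst (len e))); [exact: cvg_id|exact: cvg_cst].
Qed.

(** The affine interpolation on the edges of the vertex values [u]. *)
Definition interp u x : R :=
  match x with
  | inl v => u v
  | inr w => let: (e, t) := val w in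
      (1 - t / len e) * u (src e) + t / len e * u (tgt e)
  end.

(** Half of it has second derivative [- c e] on [e], and it vanishes at the
    vertices. *)
Definition bump c x : R :=
  match x with
  | inl v => 0
  | inr w => let: (e, t) := val w in c e * t * (len e - t)
  end.

(** The Green function of a segment of length [L] with Dirichlet conditions. *)
Definition tent1 (L a b : R) : R := Num.min (a * (L - b)) (b * (L - a)) / L.

Definition tent x y : R := \sum_e tent1 (len e) (coord e x) (coord e y).

(** The functions with values [u] at the vertices, second derivative [c e] on
    [e], and a unit drop of the slope at [y] when [y] is not a vertex. *)
Definition shape u c y x : R := interp u x - bump c x / 2 + tent x y.

Lemma interp_edge u e t : 0 <= t <= len e ->
  interp u (edge_pt e t) = (1 - t / len e) * u (src e) + t / len e * u (tgt e).
Proof.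
move=> /andP[t0 tL]; have L0 := len_gt0 e.
have [->|t_neq0] := eqVneq t 0; first by rewrite edge_pt_le0 //= mul0r; ring.
have [->|t_neqL] := eqVneq t (len e).
  by rewrite edge_pt_ge //= divff ?gt_eqF //; ring.
by rewrite edge_ptE ?lt_neqAle ?t0 ?tL ?t_neqL ?(eq_sym 0) ?t_neq0.
Qed.

Lemma bump_edge c e t : 0 <= t <= len e ->
  bump c (edge_pt e t) = c e * t * (len e - t).
Proof.
move=> /andP[t0 tL]; have L0 := len_gt0 e.
have [->|t_neq0] := eqVneq t 0; first by rewrite edge_pt_le0 //=; ring.
have [->|t_neqL] := eqVneq t (len e); first by rewrite edge_pt_ge //=; ring.
by rewrite edge_ptE ?lt_neqAle ?t0 ?tL ?t_neqL ?(eq_sym 0) ?t_neq0.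
Qed.

Lemma tent10 L b : 0 <= b <= L -> tent1 L 0 b = 0.
Proof.
by move=> b_in; rewrite /tent1 mul0r subr0 min_l ?mul0r // mulr_ge0; lra.
Qed.

Lemma tent1_sym L a b : tent1 L a b = tent1 L b a.
Proof. by rewrite /tent1 minC. Qed.

Lemma tent1L L b : 0 <= b <= L -> tent1 L L b = 0.
Proof.
by move=> b_in; rewrite /tent1 subrr mulr0 min_r ?mul0r // mulr_ge0; lra.
Qed.

Lemma coord_le e x : 0 <= coord e x <= len e.
Proof. by have /andP[-> /ltW] := coord_itv e x. Qed.

Lemma tent1_coord e t b : 0 <= t <= len e -> 0 <= b <= len e ->
  tent1 (len e) (coord e (edge_pt e t)) b = tent1 (len e) t b.
Proof.
move=> /andP[t0 tL] b_in.
have [->|t_neq0] := eqVneq t 0; first by rewrite edge_pt_le0.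
have [->|t_neqL] := eqVneq t (len e).
  by rewrite edge_pt_ge //= tent10 ?tent1L.
by rewrite coord_edge_pt ?lt_neqAle ?t0 ?tL ?t_neqL ?(eq_sym 0) ?t_neq0.
Qed.

Lemma tent_edge e t y : 0 <= t <= len e ->
  tent (edge_pt e t) y = tent1 (len e) t (coord e y).
Proof.
move=> t_in; rewrite /tent (bigD1 e) //= big1 => [|e' e'e].
  by rewrite addr0 tent1_coord // coord_le.
by rewrite coord_neq ?tent10 ?coord_le // eq_sym.
Qed.

Lemma tent_sym x y : tent x y = tent y x.
Proof. by apply: eq_bigr => e _; rewrite tent1_sym. Qed.

Lemma tent_vpt x v : tent x (vpt v) = 0.
Proof. by rewrite tent_sym /tent big1 // => e _; rewrite /= tent10 ?coord_le. Qed.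

(** Slope at [src e] of a shape with a kink at the coordinate [b > 0]. *)
Definition left_slope u c e b : R :=
  (u (tgt e) - u (src e)) / len e - c e * len e / 2 + (1 - b / len e).

(** In this form the kink is explicit, and continuity and the one-sided slopes
    can be read off. *)
Lemma shape_edge u c y e t : 0 <= t <= len e -> shape u c y (edge_pt e t) =
  quad (u (src e)) (left_slope u c e (coord e y)) (c e) t
   - Num.max (t - coord e y) 0.
Proof.
move=> t_in; have L0 := len_gt0 e.
rewrite /shape interp_edge // bump_edge // tent_edge // /tent1 /quad /left_slope.
set b := coord e y; have /andP[b0 bL] := coord_le e y.
case: (leP t b) => tb.
  rewrite max_r; last by lra.
  rewrite min_l; last by nra.
  by field; rewrite gt_eqF.
rewrite max_l; last by lra.
rewrite min_r; last by nra.
by field; rewrite gt_eqF.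
Qed.

Lemma continuous_shape u c y : continuous (shape u c y).
Proof.
apply: continuous_mpoint => e t.
pose P r := quad (u (src e)) (left_slope u c e (coord e y)) (c e) r - Num.max (r - coord e y) 0.
have -> : shape u c y \o edge_pt e = P \o clamp e.
  by apply/funext => s; rewrite /= -edge_pt_clamp shape_edge ?clamp_itv.
apply: continuous_comp; first exact: continuous_clamp.
apply: cvgB; first exact: continuous_quad.
apply: (@continuous_max R R (fun r => r - coord e y) (cst 0)); last exact: cvg_cst.
by apply: cvgB; [exact: cvg_id|exact: cvg_cst].
Qed.

Lemma shape_quad_l u c y e t : 0 <= t <= coord e y -> shape u c y (edge_pt e t) =
  quad (u (src e)) (left_slope u c e (coord e y)) (c e) t.
Proof.
move=> t_in; have := coord_le e y => ?; rewrite shape_edge; last by lra.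
by rewrite max_r ?subr0 //; lra.
Qed.

Lemma shape_quad_r u c y e t : coord e y <= t <= len e -> shape u c y (edge_pt e t) =
  quad (u (src e) + coord e y) (left_slope u c e (coord e y) - 1) (c e) t.
Proof.
move=> t_in; have := coord_le e y => ?; rewrite shape_edge; last by lra.
by rewrite max_l /quad; [ring|lra].
Qed.

Lemma shape_near u c y e t : 0 < t < len e -> edge_pt e t != y ->
  exists A B, \forall s \near t, (shape u c y \o edge_pt e) s = quad A B (c e) s.
Proof.
move=> t_in ty; have b_in := coord_le e y.
have tb : t != coord e y.
  apply/eqP => tb; move/eqP: ty; apply; case: (mpointP y) tb => [v /= t0|e' t' t'_in].
    by exfalso; lra.
  have [ee'|e'e] := eqVneq e' e; first by subst e'; rewrite coord_edge_pt // => ->.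
  by rewrite coord_neq // => t0; exfalso; lra.
case: (ltgtP t (coord e y)) => [tlt|tgt|/eqP]; last by rewrite (negbTE tb).
- exists (u (src e)), (left_slope u c e (coord e y)).
  have : t \in `]0, coord e y[ by rewrite in_itv /=; lra.
  move/near_in_itvoo; apply: filterS => s; rewrite in_itv /= => s_in.
  by apply: shape_quad_l; lra.
- exists (u (src e) + coord e y), (left_slope u c e (coord e y) - 1).
  have : t \in `]coord e y, len e[ by rewrite in_itv /=; lra.
  move/near_in_itvoo; apply: filterS => s; rewrite in_itv /= => s_in.
  by apply: shape_quad_r; lra.
Qed.

(** The value at the kink, where the second derivative is a default value, has
    no influence on integrals. *)
Lemma near_const_integral (D : set R) (g : R -> R) b (k : R) : measurable D ->
  (lebesgue_measure D < +oo)%E ->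
  (forall t, D t -> t != b -> g t = k) ->
  lebesgue_measure.-integrable D (EFin \o g) /\
  (\int[lebesgue_measure]_(t in D) (g t)%:E = k%:E * lebesgue_measure D)%E.
Proof.
move=> mD Dfin gk.
pose g' t := k + (g b - k) * \1_[set b] t.
have gg' : {in D, g' =1 g}.
  move=> t; rewrite inE => Dt; rewrite /g' indicE; have [->|tb] := eqVneq t b.
    by rewrite mem_set //=; ring.
  rewrite memNset /=; last by move=> tb'; rewrite tb' eqxx in tb.
  by rewrite (gk t) //; ring.
have mg : measurable_fun D g.
  apply: eq_measurable_fun gg' _; apply: measurable_funD => //.
  by apply: measurable_funM => //; exact: measurable_indic.
split.
  apply: measurable_bounded_integrable => //.
  exists (Num.max `|k| `|g b|); split=> // M ltM t Dt; apply: le_trans (ltW ltM).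
  rewrite le_max; have [->|tb] := eqVneq t b; first by rewrite lexx orbT.
  by rewrite gk ?lexx.
have mDb : measurable (D `\ b) by apply: measurableD => //; exact: measurable_set1.
rewrite -(integral_cst lebesgue_measure mD).
rewrite -(@integral_setD1 _ _ b) //; last first.
  by apply/measurable_EFinP; apply: measurable_funS mg => // t [].
rewrite -[RHS](@integral_setD1 _ _ b) //.
by apply: eq_integral => t; rewrite inE => -[Dt /eqP tb]; rewrite gk.
Qed.

(** The hat function of the vertex [v], as a function of [y]. *)
Definition hat v y : R := interp (fun w => (w == v)%:R) y.

Section ShapeLaplacian.
Variables (u m : vert Gam -> R) (c : edge Gam -> R) (y : mpoint Gam).
Hypothesis vertex_eq : forall v, lap (@len R Gam) u v
  + 2^-1 * (\sum_(e | src e == v) c e * len e + \sum_(e | tgt e == v) c e * len e)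
  = hat v y - m v.

Let f := shape u c y.

Lemma shape_d_fwd0 e : d_fwd f e 0 =
  (u (tgt e) - u (src e)) / len e - c e * len e / 2
  + (coord e y != 0)%:R * (1 - coord e y / len e).
Proof.
have L0 := len_gt0 e; apply: cvg_lim => //.
have /andP[b0 bL] := coord_le e y.
have [by0|by0] := eqVneq (coord e y) 0.
  rewrite mul0r [X in _ --> X](_ : _ = (left_slope u c e (coord e y) - 1) + c e * 0).
    apply: (@right_quotient_quad R (f \o edge_pt e) 0 (len e) (u (src e) + coord e y)) => //.
    by move=> s s_in; apply: shape_quad_r; lra.
  by rewrite /left_slope by0; ring.
rewrite mul1r [X in _ --> X](_ : _ = left_slope u c e (coord e y) + c e * 0).
  have {}by0 : 0 < coord e y by rewrite lt_neqAle eq_sym by0.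
  apply: (@right_quotient_quad R (f \o edge_pt e) 0 (coord e y) (u (src e))) => //.
  by move=> s s_in; apply: shape_quad_l; lra.
by rewrite /left_slope; ring.
Qed.

Lemma shape_d_bwdL e : d_bwd f e (len e) =
  (u (src e) - u (tgt e)) / len e - c e * len e / 2 + coord e y / len e.
Proof.
have L0 := len_gt0 e; apply: cvg_lim => //.
have /andP[b0 bL] := coord_itv e y.
rewrite [X in _ --> X](_ : _ = - ((left_slope u c e (coord e y) - 1) + c e * len e)).
  apply: (@left_quotient_quad R (f \o edge_pt e) (len e) (len e - coord e y) (u (src e) + coord e y)).
    by lra.
  by move=> s s_in; apply: shape_quad_r; lra.
by rewrite /left_slope; field; rewrite gt_eqF.
Qed.

(** The contributions of the kink at [y] to the slopes at [v].  When [y] is a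
    vertex there is no kink, and all coordinates of [y] vanish. *)
Lemma hat_sum v : hat v y = (vpt v == y)%:R +
  \sum_(e | src e == v) (coord e y != 0)%:R * (1 - coord e y / len e) +
  \sum_(e | tgt e == v) coord e y / len e.
Proof.
case: (mpointP y) => [w|e t t_in].
  rewrite big1 => [|e _]; last by rewrite eqxx mul0r.
  rewrite big1 => [|e _]; last by rewrite mul0r.
  by rewrite !addr0 /hat /= (inj_eq (@vpt_inj R Gam)) eq_sym.
have -> : (vpt v == edge_pt e t) = false by apply/eqP => /esym; exact: edge_pt_neq_vpt.
rewrite add0r /hat interp_edge; last by lra.
rewrite [X in _ = X + _]big_mkcond [X in _ = _ + X]big_mkcond; congr (_ + _).
  rewrite (bigD1 e) //= big1 => [|e' e'e].
    rewrite coord_edge_pt // (_ : t != 0 = true); last by apply/eqP; lra.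
    by case: eqP => _ /=; ring.
  by rewrite coord_neq ?eqxx ?mul0r ?if_same // eq_sym.
rewrite (bigD1 e) //= big1 => [|e' e'e].
  by rewrite coord_edge_pt //; case: eqP => _ /=; ring.
by rewrite coord_neq ?mul0r ?if_same // eq_sym.
Qed.

Lemma shape_sum_vertex v : sum_directional f (vpt v) = m v - (vpt v == y)%:R.
Proof.
rewrite /=; under eq_bigr do rewrite shape_d_fwd0.
under [X in _ + X]eq_bigr do rewrite shape_d_bwdL.
rewrite !big_split /= !sumrN; have := vertex_eq v; rewrite hat_sum /lap /div.
have E (P : pred (edge Gam)) : \sum_(e | P e) c e * len e / 2 =
    2^-1 * \sum_(e | P e) c e * len e.
  by rewrite mulr_sumr; apply: eq_bigr => e _; rewrite mulrC.
have -> : \sum_(e | src e == v) (u (tgt e) - u (src e)) / len e =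
    - \sum_(e | src e == v) (u (src e) - u (tgt e)) / len e.
  by rewrite -sumrN; apply: eq_bigr => e _; rewrite -mulNr opprB.
rewrite !E; lra.
Qed.

Lemma shape_sum_kink e t : 0 < t < len e -> y = edge_pt e t ->
  sum_directional f y = -1.
Proof.
move=> t_in yE; have by_ : coord e y = t by rewrite yE coord_edge_pt.
rewrite yE (edge_ptE t_in) /=.
rewrite (_ : d_fwd f e t = left_slope u c e t - 1 + c e * t); last first.
  apply: cvg_lim => //.
  apply: (@right_quotient_quad R (f \o edge_pt e) t (len e - t) (u (src e) + t)).
    by lra.
  by move=> s s_in; rewrite -by_; apply: shape_quad_r; lra.
rewrite (_ : d_bwd f e t = - (left_slope u c e t + c e * t)); first by ring.
apply: cvg_lim => //.
apply: (@left_quotient_quad R (f \o edge_pt e) t t (u (src e))); first by lra.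
by move=> s s_in; rewrite -{1}by_; apply: shape_quad_l; lra.
Qed.

Lemma shape_derive2 e t : 0 < t < len e -> t != coord e y ->
  [/\ derivable (f \o edge_pt e) t 1, derivable (derive1 (f \o edge_pt e)) t 1,
      {for t, continuous (derive1n 2 (f \o edge_pt e))} &
      derive1n 2 (f \o edge_pt e) t = c e].
Proof.
move=> t_in ty; have [|A [B /near_quad_derive[D1 D2 D3 _ D4]]] := shape_near u c (y := y) t_in.
  by apply: contra_neq ty => <-; rewrite coord_edge_pt.
exact: And4 D1 D2 D3 D4.
Qed.

(** The vertex equation says that the outgoing slopes have the prescribed sum at
    each vertex; on the edges the density and the atom at [y] hold for every
    shape. *)
Lemma has_laplacian_shape :
  has_laplacian f (fun A => \d_y A - pc_measure m c A)%E.
Proof.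
split; first exact: continuous_shape.
pose V := [seq @vpt R Gam v | v <- enum (vert Gam)].
have uV : uniq V by rewrite map_inj_uniq ?enum_uniq //; exact: vpt_inj.
(* [y] may be a vertex, whence [undup]. *)
pose S := undup (y :: V); exists S.
have d2 e : forall t, `]0, len e[%classic t -> t != coord e y ->
    derive1n 2 (f \o edge_pt e) t = c e.
  by move=> t /=; rewrite in_itv /= => t_in /(shape_derive2 t_in)[].
have fin e (D : set R) : measurable D -> D `<=` `]0, len e[ ->
    (lebesgue_measure D < +oo)%E.
  move=> mD DL; apply: (@le_lt_trans _ _ (lebesgue_measure (`]0, len e[%classic : set R))).
    by apply: le_measure; rewrite ?inE.
  by rewrite lebesgue_measure_itv /= lte_fin len_gt0 ltry.
split.
- split; first exact: undup_uniq.
  by move=> v; rewrite mem_undup in_cons map_f ?orbT // mem_enum.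
- move=> e t t_in; rewrite mem_undup in_cons negb_or => /andP[ty _].
  have [A [B /near_quad_derive[D1 D2 D3 _ _]]] := shape_near u c t_in ty.
  exact: And3 D1 D2 D3.
- move=> e; have mL : measurable `]0, len e[%classic by exact: measurable_itv.
  by have [] := near_const_integral mL (fin e _ mL (@subset_refl _ _)) (d2 e).
- move=> A mA; rewrite /laplacian /pc_measure.
  have -> : (\sum_e \int[lebesgue_measure]_(t in `]0%R, len e[ `&` edge_pt e @^-1` A)
      (derive1n 2 (f \o edge_pt e) t)%:E = \sum_e (c e)%:E * dx_edge e A)%E.
    apply: eq_bigr => e _.
    have mD : measurable (`]0, len e[ `&` edge_pt e @^-1` A).
      apply: measurableI => //; rewrite -[X in measurable X]setTI.
      exact: measurable_edge_pt.
    have [|_ ->] // := @near_const_integral _ (derive1n 2 (f \o edge_pt e)) (coord e y)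
        (c e) mD (fin e _ mD (@subIsetl _ _ _)).
    by move=> t [t_in _]; exact: d2.
  have -> : (\sum_(p <- S) (sum_directional f p)%:E * \d_p A =
      \sum_v (m v)%:E * \d_(vpt v) A - \d_y A)%E.
    have -> : (\sum_v (m v)%:E * \d_(vpt v) A = \sum_(p <- V) (vmass m p)%:E * \d_p A)%E.
      by rewrite big_map big_enum.
    have dE p : \d_p A = (\1_A p)%:E by rewrite diracE indicE.
    under eq_bigr do rewrite dE -EFinM.
    under [in RHS]eq_bigr do rewrite dE -EFinM.
    rewrite dE !sumEFin -EFinB; congr EFin.
    have yS : y \in S by rewrite mem_undup mem_head.
    rewrite (eq_big_seq (fun p => vmass m p * \1_A p - (p == y)%:R * \1_A p)); last first.
      move=> p; rewrite mem_undup in_cons -mulrBl => pS; congr (_ * _).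
      have [/mapP[v _ ->]|pV] := boolP (p \in V); first by rewrite shape_sum_vertex.
      move: pS; rewrite (negbTE pV) orbF => /eqP py; rewrite py eqxx.
      have [e [t [t_in ye]]] : exists e t, 0 < t < len e /\ y = edge_pt e t.
        case: (mpointP p) py pV => [v _|e t t_in <- _]; last by exists e, t.
        by rewrite map_f // mem_enum.
      rewrite (shape_sum_kink t_in ye) ye (edge_ptE t_in) /=; ring.
    rewrite sumrB; congr (_ - _).
      rewrite /S /=; case: ifPn => yV; rewrite undup_id // big_cons.
      have -> : vmass m y = 0.
        by case: (mpointP y) yV => [v|e t t_in _]; rewrite ?(edge_ptE t_in) // map_f // mem_enum.
      by rewrite mul0r add0r.
    rewrite (bigD1_seq y) ?undup_uniq //= eqxx mul1r big1 ?addr0 // => p /negbTE->.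
    by rewrite mul0r.
  have [a ->] : exists a, (\sum_e (c e)%:E * dx_edge e A)%E = a%:E.
    exists (\sum_e c e * fine (dx_edge e A)); rewrite -sumEFin; apply: eq_bigr => e _.
    by rewrite EFinM fineK // fin_num_measure.
  have [b ->] : exists b, (\sum_v (m v)%:E * \d_(vpt v) A)%E = b%:E.
    exists (\sum_v m v * \1_A (vpt v)); rewrite -sumEFin; apply: eq_bigr => v _.
    by rewrite EFinM diracE indicE.
  by rewrite !diracE; congr EFin => /=; ring.
Qed.

End ShapeLaplacian.

End Shapes.

(** * Integrals of quadratic functions with a kink *)

Section QuadraticIntegrals.
Variable R : realType.
Implicit Types (F : R -> R) (a b s A B c : R).
Local Notation mu := (@lebesgue_measure R).

Definition primitive A B c s : R := A * s + B / 2 * s ^+ 2 + c / 6 * s ^+ 3.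

Lemma is_derive_primitive A B c s : is_derive s (1 : R) (primitive A B c) (quad A B c s).
Proof.
have dX := is_derive_id s (1 : R).
have dq := is_deriveM dX (is_deriveD (is_derive_cst A s 1)
  (is_deriveD (is_deriveZ (B / 2) dX) (is_deriveZ (c / 6) (is_deriveM dX dX)))).
have -> : primitive A B c = id * (cst A + ((B / 2) \*: id + (c / 6) \*: (id * id))).
  by apply/funext => t; transitivity (t * (A + (B / 2 * t + c / 6 * (t * t)))) => //;
     rewrite /primitive; field.
rewrite (_ : quad A B c s = s *: (0 + ((B / 2) *: 1 + (c / 6) *: (s *: 1 + s *: 1)))
   + (A + ((B / 2) * s + (c / 6) * (s * s))) *: 1) //.
by rewrite /GRing.scale /quad /=; field.
Qed.

Lemma Rintegral_quad F A B c a b : a <= b ->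
  (forall s, a <= s <= b -> F s = quad A B c s) ->
  \int[mu]_(s in `[a, b]) F s = primitive A B c b - primitive A B c a.
Proof.
rewrite le_eqVlt => /predU1P[<- _|ab Fq].
  by rewrite set_itv1 Rintegral_set1 subrr.
rewrite (@eq_Rintegral _ _ _ mu `[a, b]%classic (quad A B c)); last first.
  by move=> s; rewrite inE /= in_itv /= => /Fq.
rewrite /Rintegral (@continuous_FTC2 _ _ (primitive A B c)) //.
- by apply: continuous_subspaceT; exact: continuous_quad.
- have Pc s : {for s, continuous (primitive A B c)}.
    apply: differentiable_continuous; apply/derivable1_diffP.
    by have [] := is_derive_primitive A B c s.
  split=> [s _||].
  + by have [] := is_derive_primitive A B c s.
  + by apply: cvg_at_right_filter; exact: Pc.
  + by apply: cvg_at_left_filter; exact: Pc.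
- move=> s _; have sP := is_derive_primitive A B c s.
  by rewrite derive1E derive_val.
Qed.

(** Split at the kink: the function is quadratic on both sides. *)
Lemma Rintegral_kink F A B c b L : 0 <= b <= L ->
  (forall s, 0 <= s <= L -> F s = quad A B c s - Num.max (s - b) 0) ->
  \int[mu]_(s in `]0, L[) F s = primitive A B c L - (L - b) ^+ 2 / 2.
Proof.
move=> /andP[b0 bL] Fq.
have Fl s : 0 <= s <= b -> F s = quad A B c s.
  by move=> s_in; rewrite Fq ?max_r ?subr0 //; lra.
have Fr s : b <= s <= L -> F s = quad (A + b) (B - 1) c s.
  by move=> s_in; rewrite Fq ?max_l /quad; [ring|lra|lra].
have Fc : continuous (fun s => quad A B c s - Num.max (s - b) 0).
  move=> s; apply: cvgB; first exact: continuous_quad.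
  apply: (@continuous_max R R (fun r => r - b) (cst 0)); last exact: cvg_cst.
  by apply: cvgB; [exact: cvg_id|exact: cvg_cst].
have intF : mu.-integrable `[0, L] (EFin \o F).
  apply: (@eq_integrable _ _ R mu `[0, L]%classic _
    (EFin \o (fun s => quad A B c s - Num.max (s - b) 0))) => //.
    by move=> s; rewrite inE /= in_itv /= => /Fq ->.
  apply: continuous_compact_integrable; first exact: segment_compact.
  exact: continuous_subspaceT.
have intS (i : interval R) : [set` i] `<=` `[0, L]%classic -> mu.-integrable [set` i] (EFin \o F).
  by move=> iL; apply: integrableS intF.
rewrite Rintegral_itv_bndo_bndc; last first.
  by apply: intS => s /=; rewrite !in_itv /= => ?; lra.
rewrite Rintegral_itv_obnd_cbnd; last first.
  by apply: intS => s /=; rewrite !in_itv /= => ?; lra.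
have /(_ b) := @Rintegral_itvB R F (BLeft 0) (BRight L) _ intF.
rewrite !bnd_simp => /(_ b0 bL) /eqP; rewrite subr_eq => /eqP ->.
rewrite Rintegral_itv_obnd_cbnd; last first.
  by apply: intS => s /=; rewrite !in_itv /= => ?; lra.
rewrite (Rintegral_quad b0 Fl) (Rintegral_quad bL Fr) /primitive.
by field.
Qed.

End QuadraticIntegrals.

(** * Integration against signed measures *)

Section ChargeIntegral.
Context d (T : measurableType d) (R : realType).
Implicit Types (p n : {measure set T -> \bar R}) (f : T -> R).

Lemma integrable_bounded p f M : fin_num_fun p -> measurable_fun setT f ->
  (forall x, `|f x| <= M) -> p.-integrable setT (EFin \o f).
Proof.
move=> pfin mf fM; apply: measurable_bounded_integrable => //.
  by rewrite ltey_eq pfin.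
by exists M; split; [exact: num_real|move=> N /ltW MN x _; exact: le_trans (fM x) MN].
Qed.

(** Two differences of finite measures that agree as set functions integrate in
    the same way: move the negative parts to the other side and integrate
    against sums of measures. *)
Lemma Rintegral_measure_sub p n p' n' f :
  fin_num_fun p -> fin_num_fun n -> fin_num_fun p' -> fin_num_fun n' ->
  (forall q : {measure set T -> \bar R}, fin_num_fun q -> q.-integrable setT (EFin \o f)) ->
  (forall A, measurable A -> p A - n A = p' A - n' A)%E ->
  \int[p]_x f x - \int[n]_x f x = \int[p']_x f x - \int[n']_x f x.
Proof.
move=> pf nf p'f n'f fint pn.
have E : (\int[measure_add p n']_x (f x)%:E = \int[measure_add p' n]_x (f x)%:E)%E.
  apply: eq_measure_integral => A mA _.
  suff : measure_add p n' A = measure_add p' n A by [].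
  rewrite !measure_addE.
  have := pn A mA; rewrite -(fineK (pf A mA)) -(fineK (nf A mA)) -(fineK (p'f A mA)).
  rewrite -(fineK (n'f A mA)) -!EFinB => -[H]; rewrite -!EFinD; congr EFin; lra.
have ex (q : {measure set T -> \bar R}) : fin_num_fun q ->
    (\int[q]_x (f x)%:E)%E = (\int[q]_x f x)%:E.
  move=> qfin; rewrite /Rintegral fineK //.
  by apply: integrable_fin_num => //; exact: fint.
move: E; rewrite integral_measure_add; [|exact: measurableT|exact: fint|exact: fint].
rewrite integral_measure_add; [|exact: measurableT|exact: fint|exact: fint].
rewrite (ex p pf) (ex n nf) (ex p' p'f) (ex n' n'f) => -[]; lra.
Qed.

Lemma Rintegral_mscale p (k : {nonneg R}) f :
  p.-integrable setT (EFin \o f) ->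
  \int[mscale k p]_x f x = k%:num * \int[p]_x f x.
Proof.
move=> fint; have mf := measurable_int _ fint.
rewrite /Rintegral (integralE (mscale k p)) !ge0_integral_mscale //=;
  [|exact: measurable_funeneg|exact: measurable_funepos].
rewrite [in RHS]integralE.
rewrite -(fineK (integrable_pos_fin_num measurableT fint)).
rewrite -(fineK (integrable_neg_fin_num measurableT fint)).
by rewrite /= mulrBr.
Qed.

End ChargeIntegral.

Section GraphIntegral.
Variables (R : realType) (Gam : metrized_graph R).
Implicit Types (e : edge Gam) (m : charge (mpoint Gam) R).
Implicit Types (f : mpoint Gam -> R) (p n q : {measure set (mpoint Gam) -> \bar R}).

Lemma continuous_measurable_mpoint f : continuous f -> measurable_fun setT f.
Proof.
move=> fc; apply: (measurability _ (RGenOpens.measurableE R)).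
move=> _ [_ [a [b ->]] <-]; rewrite setTI; apply: open_measurable_mpoint.
by move/continuousP: fc; apply; exact: interval_open.
Qed.

(** The graph is a finite union of images of compact segments. *)
Lemma continuous_bounded f : continuous f -> exists M, forall x, `|f x| <= M.
Proof.
move=> fc.
have /choice[N NP] e : exists N, forall t, 0 <= t <= len e -> `|f (edge_pt e t)| <= N.
  have L0 := ltW (len_gt0 e).
  have [|t _ tmax] := @EVT_max R (fun t => `|f (edge_pt e t)|) 0 (len e) L0.
    apply: continuous_subspaceT => t; apply: cvg_norm.
    exact: (continuous_on_edge (e := e) fc).
  by exists `|f (edge_pt e t)| => s s_in; apply: tmax; rewrite in_itv.
have N0 e : 0 <= N e.
  apply: le_trans (normr_ge0 _) (NP e 0 _).
  by rewrite lexx ltW ?len_gt0.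
exists (\sum_v `|f (vpt v)| + \sum_e N e) => x; case: (mpointP x) => [v|e t t_in].
  by rewrite (bigD1 v) //= -addrA lerDl addr_ge0 ?sumr_ge0.
rewrite [X in _ + X](bigD1 e) //= addrCA; apply: le_trans (NP e t _) _.
  by lra.
by rewrite lerDl addr_ge0 ?sumr_ge0.
Qed.

Lemma continuous_integrable f q : continuous f -> fin_num_fun q ->
  q.-integrable setT (EFin \o f).
Proof.
move=> fc qfin; have [M fM] := continuous_bounded fc.
by apply: integrable_bounded fM => //; exact: continuous_measurable_mpoint.
Qed.

Lemma charge_jordan m : exists p n, [/\ fin_num_fun p, fin_num_fun n,
  (forall A, measurable A -> m A = p A - n A)%E &
  forall f, charge_integral m f = \int[p]_x f x - \int[n]_x f x].
Proof.
rewrite /charge_integral; set P := cid _; set N := cid _; set H := projT2 N.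
exists (jordan_pos H), (jordan_neg H); split=> // A mA.
by rewrite {1}(jordan_decomp H mA) /cadd /= cscaleN1.
Qed.

(** The integral does not depend on the Hahn decomposition that defines it: any
    decomposition as a difference of finite measures computes it.  Linearity in
    the signed measure follows. *)
Lemma charge_integralE m p n f : continuous f -> fin_num_fun p -> fin_num_fun n ->
  (forall A, measurable A -> m A = p A - n A)%E ->
  charge_integral m f = \int[p]_x f x - \int[n]_x f x.
Proof.
move=> fc pfin nfin mpn; have [p' [n' [p'fin n'fin mpn' ->]]] := charge_jordan m.
apply: Rintegral_measure_sub => //; first by move=> q; exact: continuous_integrable.
by move=> A mA; rewrite -mpn // -mpn'.
Qed.

Lemma charge_integral_add m1 m2 f : continuous f ->
  charge_integral (charge_add m1 m2) f = charge_integral m1 f + charge_integral m2 f.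
Proof.
move=> fc; have [p1 [n1 [p1f n1f mpn1 ->]]] := charge_jordan m1.
have [p2 [n2 [p2f n2f mpn2 ->]]] := charge_jordan m2.
have addf p q : fin_num_fun p -> fin_num_fun q -> fin_num_fun (measure_add p q).
  move=> pf qf A mA; rewrite (_ : _ A = p A + q A)%E; last exact: measure_addE.
  by rewrite fin_numD pf ?qf.
rewrite (@charge_integralE _ (measure_add p1 p2) (measure_add n1 n2)) //.
- have E p q : fin_num_fun p -> fin_num_fun q ->
      \int[measure_add p q]_x f x = \int[p]_x f x + \int[q]_x f x.
    move=> pf qf; rewrite /Rintegral integral_measure_add //; try exact: continuous_integrable.
    by rewrite fineD //; apply: integrable_fin_num => //; exact: continuous_integrable.
  by rewrite !E //; ring.
- exact: addf.
- exact: addf.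
- move=> A mA; suff : (m1 A + m2 A = measure_add p1 p2 A - measure_add n1 n2 A)%E by [].
  rewrite !measure_addE mpn1 // mpn2 //.
  by rewrite -(fineK (p1f A mA)) -(fineK (n1f A mA)) -(fineK (p2f A mA)) -(fineK (n2f A mA))
    -!(EFinB, EFinD); congr EFin; ring.
Qed.

Lemma charge_integral_scale k m f : continuous f ->
  charge_integral (charge_scale k m) f = k * charge_integral m f.
Proof.
move=> fc; have [p [n [pf nf mpn ->]]] := charge_jordan m.
have scalef (h : {nonneg R}) q : fin_num_fun q -> fin_num_fun (mscale h q).
  by move=> qf A mA; rewrite /mscale /= fin_numM ?qf.
have [k0|k0] := leP 0 k.
  rewrite (@charge_integralE _ (mscale (NngNum k0) p) (mscale (NngNum k0) n)) //.
  - by rewrite !Rintegral_mscale //; [rewrite mulrBr|exact: continuous_integrable..].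
  - exact: scalef.
  - exact: scalef.
  - move=> A mA; suff : (k%:E * m A = k%:E * p A - k%:E * n A)%E by [].
    rewrite mpn //.
    by rewrite -(fineK (pf A mA)) -(fineK (nf A mA)) -!(EFinB, EFinM); congr EFin; ring.
have Nk0 : 0 <= - k by lra.
rewrite (@charge_integralE _ (mscale (NngNum Nk0) n) (mscale (NngNum Nk0) p)) //.
- by rewrite !Rintegral_mscale //=; [ring|exact: continuous_integrable..].
- exact: scalef.
- exact: scalef.
- move=> A mA; suff : (k%:E * m A = (- k)%:E * n A - (- k)%:E * p A)%E by [].
  rewrite mpn //.
  by rewrite -(fineK (pf A mA)) -(fineK (nf A mA)) -!(EFinB, EFinM, EFinN); congr EFin; ring.
Qed.

Lemma charge_integral_finite (q : {finite_measure set (mpoint Gam) -> \bar R}) f :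
  continuous f -> charge_integral (charge_of_finite_measure q) f = \int[q]_x f x.
Proof.
move=> fc; rewrite (@charge_integralE _ q mzero) //.
- by rewrite /Rintegral integral_measure_zero subr0.
- by move=> A mA; rewrite sube0.
Qed.

Lemma charge_integral_zero f : continuous f -> charge_integral (czero : charge (mpoint Gam) R) f = 0.
Proof.
move=> fc; rewrite (@charge_integralE _ mzero mzero) ?subrr //.
by move=> A mA; rewrite sube0.
Qed.

Lemma charge_integral_sum (I : finType) (m : I -> charge (mpoint Gam) R) f : continuous f ->
  charge_integral (charge_sum m) f = \sum_i charge_integral (m i) f.
Proof.
move=> fc; rewrite /charge_sum.
apply: (big_rec2 (fun (n : charge (mpoint Gam) R) (r : R) => charge_integral n f = r)).
  exact: charge_integral_zero.
by move=> i r n _ <-; rewrite charge_integral_add.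
Qed.

Lemma charge_sumE (I : finType) (m : I -> charge (mpoint Gam) R) A :
  charge_sum m A = (\sum_i m i A)%E.
Proof.
rewrite /charge_sum.
by apply: (big_rec2 (fun (n : charge (mpoint Gam) R) (r : \bar R) => n A = r)) => // i r n _ <-.
Qed.

Lemma charge_integral_dirac (x : mpoint Gam) f : continuous f ->
  charge_integral (charge_dirac x) f = f x.
Proof.
move=> fc; rewrite charge_integral_finite // /Rintegral integral_dirac //.
  by rewrite diracT mul1e.
by apply/measurable_EFinP; exact: continuous_measurable_mpoint.
Qed.

(** The measure [dx_edge e] is the image under [edge_pt e] of the Lebesgue
    measure of the open segment. *)
Lemma charge_integral_dx e f : continuous f ->
  charge_integral (charge_dx e) f =
  \int[lebesgue_measure]_(t in `]0, len e[) f (edge_pt e t).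
Proof.
move=> fc; rewrite charge_integral_finite //.
have mD : measurable (`]0, len e[%classic : set R) by exact: measurable_itv.
have fin : fin_num_fun (mrestr (@lebesgue_measure R) mD).
  move=> A mA; rewrite ge0_fin_numE ?measure_ge0 //.
  apply: (@le_lt_trans _ _ (lebesgue_measure (`]0, len e[%classic : set R))).
    by apply: le_measure; rewrite ?inE //; exact: measurableI.
  by rewrite lebesgue_measure_itv /= lte_fin len_gt0 ltry.
rewrite /Rintegral; congr fine.
transitivity (\int[pushforward (mrestr (@lebesgue_measure R) mD) (edge_pt e)]_x (f x)%:E)%E.
  apply: eq_measure_integral; first exact: measurable_edge_pt.
  by move=> mphi A mA _; rewrite /= /pushforward /mrestr /dx_edge setIC.
have [M fM] := continuous_bounded fc.
have mf : measurable_fun setT (f \o edge_pt e).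
  by apply: continuous_measurable_fun; exact: continuous_on_edge.
have fint : (mrestr (@lebesgue_measure R) mD).-integrable setT (EFin \o (f \o edge_pt e)).
  by apply: integrable_bounded fin mf _ => t; exact: fM.
rewrite integral_pushforward //; last 2 first.
  exact: measurable_edge_pt.
  by apply/measurable_EFinP; exact: continuous_measurable_mpoint.
rewrite preimage_setT.
have nullC : mrestr (@lebesgue_measure R) mD (~` `]0, len e[) = 0%E.
  by rewrite /mrestr setICl measure0.
rewrite (negligible_integral _ _ fint nullC); [|exact: measurableC|exact: measurableT].
rewrite setTD setCK; apply: eq_measure_integral => A mA AD.
by rewrite /= /mrestr setIidl.
Qed.

End GraphIntegral.

(** * Joint continuity of the edge kernels *)

Lemma sum_cvg (R : realType) (T I : Type) (F : set_system T) (r : seq I)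
    (f : I -> T -> R) (l : I -> R) : Filter F ->
  (forall i, f i t @[t --> F] --> l i) ->
  (\sum_(i <- r) f i t) @[t --> F] --> \sum_(i <- r) l i.
Proof.
move=> FF fl; elim: r => [|i r IH].
  by rewrite big_nil; under eq_fun do rewrite big_nil; exact: cvg_cst.
by rewrite big_cons; under eq_fun do rewrite big_cons; apply: cvgD.
Qed.

Section GreenFunction.
Variables (R : realType) (Gam : metrized_graph R).
Implicit Types (e : edge Gam) (v w : vert Gam) (x y : mpoint Gam).
Implicit Types (u m : vert Gam -> R) (c : edge Gam -> R).
Implicit Types (mu : charge (mpoint Gam) R).

(** Interpolations are shapes, hence continuous. *)
Lemma interp_shape u : interp u = shape u (fun=> 0) (vpt (base_vert Gam)).
Proof.
apply/funext => x; rewrite /shape tent_vpt.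
have -> : bump (fun=> 0) x = 0.
  by case: x => [//|[[e t] ?]] /=; rewrite !mul0r.
by rewrite mul0r subr0 addr0.
Qed.

Lemma continuous_interp u : continuous (interp u).
Proof. by rewrite interp_shape; exact: continuous_shape. Qed.

Lemma interp_hat u x : interp u x = \sum_v hat v x * u v.
Proof.
have S (k l : R) (p q : vert Gam) : k * u p + l * u q =
    \sum_v (k * (p == v)%:R + l * (q == v)%:R) * u v.
  under eq_bigr do rewrite mulrDl -!mulrA eq_sym [q == _]eq_sym.
  by rewrite big_split /= -!mulr_sumr !sum_pred1.
case: x => [w|[[e t] t_in]] /=; last exact: S.
by rewrite -[LHS](sum_pred1 w u); apply: eq_bigr => v _; rewrite eq_sym.
Qed.

Lemma sum_hat x : \sum_v hat v x = 1.
Proof.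
have := interp_hat (fun=> 1) x; under eq_bigr do rewrite mulr1.
by move=> <-; case: x => [//|[[e t] ?]] /=; rewrite !mulr1 subrK.
Qed.

Lemma interp_hat_const u k x : interp (fun v => u v + k) x = interp u x + k.
Proof.
rewrite !interp_hat -[k in RHS]mul1r -(sum_hat x) mulr_suml -big_split /=.
by apply: eq_bigr => v _; rewrite mulrDr.
Qed.

Lemma shape_const u k c y x : shape (fun v => u v + k) c y x = shape u c y x + k.
Proof. by rewrite /shape interp_hat_const; ring. Qed.

Lemma shape_vpt u c y v : shape u c y (vpt v) = u v.
Proof.
by rewrite /shape tent_sym tent_vpt /=; ring.
Qed.

Lemma continuous_bump c : continuous (bump c).
Proof.
have -> : bump c = fun x => -2 * shape (fun=> 0) c (vpt (base_vert Gam)) x.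
  apply/funext => x; rewrite /shape tent_vpt.
  by rewrite interp_hat big1 => [|v _]; [field|rewrite mulr0].
move=> x; exact: (cvgM (cvg_cst (-2 : R)) (@continuous_shape _ _ (fun=> 0) c (vpt (base_vert Gam)) x)).
Qed.

(** Distance on the circle of length [L].  The coordinate of a point leaving the
    edge jumps from [L] to 0, so distances must be measured on the circle. *)
Definition arc_dist (L a b : R) : R := Num.min `|a - b| (L - `|a - b|).

(** The tent functions are Lipschitz on the circle, uniformly in the position of
    the kink. *)
Lemma tent1_arc L a a' b : 0 <= a < L -> 0 <= a' < L -> 0 <= b <= L ->
  `|tent1 L a b - tent1 L a' b| <= arc_dist L a a'.
Proof.
move=> a_in a'_in b_in; have L0 : 0 < L by lra.
suff H r s : 0 <= r < L -> 0 <= s < L -> r <= s ->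
    `|tent1 L r b - tent1 L s b| <= arc_dist L r s.
  have [aa'|a'a] := leP a a'; first exact: H.
  rewrite distrC (_ : arc_dist L a a' = arc_dist L a' a); last by rewrite /arc_dist distrC.
  by apply: H => //; exact: ltW.
move=> r_in s_in rs; rewrite /arc_dist (distrC r s) (ger0_norm (_ : 0 <= s - r)); last by lra.
rewrite /tent1 -mulrBl normrM normfV (gtr0_norm L0) ler_pdivrMr // ler_norml.
rewrite minr_pMl; last lra.
case: (leP (r * (L - b)) (b * (L - r))) => ?; case: (leP (s * (L - b)) (b * (L - s))) => ?;
 case: (leP ((s - r) * L) ((L - (s - r)) * L)) => ?; apply/andP; split; nra.
Qed.

Lemma continuous_arc_dist e x0 :
  continuous (fun x => arc_dist (len e) (coord e x) (coord e x0)).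
Proof.
apply: continuous_mpoint => e' t; have L0 := len_gt0 e.
pose b := coord e x0; have b_in : 0 <= b <= len e := coord_le e x0.
have [<-|ee'] := eqVneq e e'; last first.
  rewrite (_ : _ \o _ = cst (arc_dist (len e) 0 b)); first exact: cvg_cst.
  by apply/funext => s /=; rewrite coord_neq // eq_sym.
rewrite (_ : _ \o _ = (fun r => arc_dist (len e) r b) \o clamp e).
  apply: continuous_comp; first exact: continuous_clamp.
  apply: (@continuous_min R R (fun r => `|r - b|) (fun r => len e - `|r - b|)).
    by apply: cvg_norm; apply: cvgB; [exact: cvg_id|exact: cvg_cst].
  apply: cvgB; first exact: cvg_cst.
  by apply: cvg_norm; apply: cvgB; [exact: cvg_id|exact: cvg_cst].
apply/funext => s /=; rewrite -edge_pt_clamp; move: (clamp_itv e s) => /andP[].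
set r := clamp e s => r0 rL.
have [->|r_neq0] := eqVneq r 0; first by rewrite edge_pt_le0.
have [rE|r_neqL] := eqVneq r (len e); last first.
  by rewrite coord_edge_pt ?lt_neqAle ?r0 ?rL ?r_neqL ?(eq_sym 0) ?r_neq0.
rewrite rE edge_pt_ge //= /arc_dist -/b sub0r normrN (ger0_norm (_ : 0 <= b)); last by lra.
rewrite ger0_norm; last by lra.
by rewrite minC; congr Num.min; ring.
Qed.

(** The graph carries a quotient topology and its square a product topology, so
    joint continuity cannot be read off on pairs of edges.  The bound of
    [tent1_arc], uniform in the other variable, squeezes the variation of [tent]
    by a sum of two functions of one variable. *)
Lemma continuous_tent : continuous (fun z : mpoint Gam * mpoint Gam => tent z.1 z.2).
Proof.
move=> [x0 y0]; apply: sum_cvg => e; have L0 := len_gt0 e.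
pose E (z : mpoint Gam * mpoint Gam) := arc_dist (len e) (coord e z.1) (coord e x0) +
  arc_dist (len e) (coord e z.2) (coord e y0).
have E0 : E z @[z --> (x0, y0)] --> 0.
  rewrite (_ : 0 = arc_dist (len e) (coord e x0) (coord e x0) +
    arc_dist (len e) (coord e y0) (coord e y0)); last first.
    by rewrite /arc_dist !subrr normr0 subr0 min_l ?addr0 // ltW.
  have E1 : arc_dist (len e) (coord e z.1) (coord e x0) @[z --> (x0, y0)] -->
      arc_dist (len e) (coord e x0) (coord e x0).
    apply: (@continuous_comp _ _ _ fst
      (fun x => arc_dist (len e) (coord e x) (coord e x0)) (x0, y0)); first exact: cvg_fst.
    exact: continuous_arc_dist.
  have E2 : arc_dist (len e) (coord e z.2) (coord e y0) @[z --> (x0, y0)] -->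
      arc_dist (len e) (coord e y0) (coord e y0).
    apply: (@continuous_comp _ _ _ snd
      (fun x => arc_dist (len e) (coord e x) (coord e y0)) (x0, y0)); first exact: cvg_snd.
    exact: continuous_arc_dist.
  exact: cvgD E1 E2.
apply/subr_cvg0; apply/norm_cvg0P => /=.
apply: (@squeeze_cvgr _ _ _ _ (cst 0) E) E0; last exact: cvg_cst.
near=> z; rewrite normr_ge0 /=.
apply: (@le_trans _ _ (`|tent1 (len e) (coord e z.1) (coord e z.2) -
    tent1 (len e) (coord e x0) (coord e z.2)| +
  `|tent1 (len e) (coord e z.2) (coord e x0) - tent1 (len e) (coord e y0) (coord e x0)|)).
  rewrite (tent1_sym _ (coord e y0)) (tent1_sym _ _ (coord e x0)).
  by apply: le_trans (ler_normD _ _); rewrite addrA subrK.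
by apply: lerD; apply: tent1_arc; rewrite ?coord_itv ?coord_le.
Unshelve. all: by end_near. Qed.

End GreenFunction.

(** * The Green function of a measure with constant densities *)

Section PiecewiseConstantMeasure.
Variables (R : realType) (Gam : metrized_graph R) (b : vert Gam).
Hypothesis Gam_conn : connected_graph Gam.
Implicit Types (e : edge Gam) (v w : vert Gam) (x y : mpoint Gam).
Implicit Types (u m : vert Gam -> R) (c : edge Gam -> R).
Implicit Types (mu : charge (mpoint Gam) R) (f : mpoint Gam -> R).
Local Notation L := (@len R Gam).
Let L_gt0 e : 0 < L e. Proof. exact: len_gt0. Qed.

Lemma charge_integral_pc mu m c f : (forall A, measurable A -> mu A = pc_measure m c A) ->
  continuous f -> charge_integral mu f = \sum_v m v * f (vpt v) +
    \sum_e c e * \int[lebesgue_measure]_(t in `]0, L e[) f (edge_pt e t).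
Proof.
move=> mu_pc fc.
pose nu := charge_add (charge_sum (fun v => charge_scale (m v) (charge_dirac (@vpt R Gam v))))
  (charge_sum (fun e => charge_scale (c e) (charge_dx e))).
have [p [n [pfin nfin nupn nuf]]] := charge_jordan nu.
rewrite (charge_integralE fc pfin nfin) => [|A mA].
  rewrite -nuf /nu charge_integral_add // !charge_integral_sum //.
  congr (_ + _); apply: eq_bigr => i _; rewrite charge_integral_scale //.
    by rewrite charge_integral_dirac.
  by rewrite charge_integral_dx.
rewrite mu_pc // -nupn // /pc_measure.
suff -> : nu A = (charge_sum (fun v => charge_scale (m v) (charge_dirac (@vpt R Gam v))) A
   + charge_sum (fun e => charge_scale (c e) (charge_dx e)) A)%E by rewrite !charge_sumE.
by [].
Qed.

(** The measure with the mass of each edge moved in halves to its ends.  It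
    integrates affine interpolations like the measure itself, see
    [sum_vertex_weight]. *)
Definition vertex_weight m c v : R := m v + 2^-1 *
  (\sum_(e | src e == v) c e * L e + \sum_(e | tgt e == v) c e * L e).

Lemma sum_vertex_weight m c u : \sum_v vertex_weight m c v * u v =
  \sum_v m v * u v + \sum_e c e * (L e * ((u (src e) + u (tgt e)) / 2)).
Proof.
rewrite /vertex_weight; under eq_bigr do rewrite mulrDl mulrDr !mulr_sumr mulrDl !mulr_suml.
rewrite !big_split /= (sum_fibres _ (fun v e => 2^-1 * (c e * L e) * u v)).
rewrite (sum_fibres _ (fun v e => 2^-1 * (c e * L e) * u v)) -big_split /=.
by congr (_ + _); apply: eq_bigr => e _; field.
Qed.

Lemma integral_shape_edge u c y e :
  \int[lebesgue_measure]_(t in `]0, L e[) shape u c y (edge_pt e t) =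
  L e * ((u (src e) + u (tgt e)) / 2) - c e * L e ^+ 3 / 12
  + coord e y * (L e - coord e y) / 2.
Proof.
rewrite (Rintegral_kink (coord_le e y) (fun t => @shape_edge R Gam u c y e t)).
by rewrite /primitive /left_slope; field; rewrite gt_eqF.
Qed.

Lemma bump_coord c y : bump c y = \sum_e c e * (coord e y * (L e - coord e y)).
Proof.
case: (mpointP y) => [v|e t t_in].
  by rewrite big1 // => e _; rewrite /= mul0r mulr0.
rewrite bump_edge; last by lra.
rewrite (bigD1 e) //=.
rewrite big1 ?addr0 => [|e' e'e]; last by rewrite coord_neq ?mul0r ?mulr0 // eq_sym.
by rewrite coord_edge_pt // mulrA.
Qed.

(** Minus the contribution of the quadratic parts of a shape to its integral, see
    [charge_integral_shape]. *)
Definition spread c : R := 12^-1 * \sum_e c e ^+ 2 * L e ^+ 3.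

(** The last two terms come from the quadratic part and from the kink. *)
Lemma charge_integral_shape mu m c u y :
  (forall A, measurable A -> mu A = pc_measure m c A) ->
  charge_integral mu (shape u c y) =
  \sum_v vertex_weight m c v * u v - spread c + bump c y / 2.
Proof.
move=> mu_pc; rewrite (charge_integral_pc mu_pc); last exact: continuous_shape.
under [X in _ + X]eq_bigr do rewrite integral_shape_edge mulrDr mulrBr.
rewrite big_split sumrB /= sum_vertex_weight bump_coord /spread.
under eq_bigr do rewrite shape_vpt.
rewrite mulr_sumr mulr_suml addrA addrA; congr (_ + _ - _ + _); apply: eq_bigr => e _.
  by field.
by field.
Qed.

Section Green.
Variables (m : vert Gam -> R) (c : edge Gam -> R) (mu : charge (mpoint Gam) R).
Hypothesis mu_pc : forall A, measurable A -> mu A = pc_measure m c A.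
Local Notation M := (vertex_weight m c).
Hypothesis mass1 : \sum_v M v = 1.

Definition vgreen v w : R := pgreen L b M v w + spread c.

(** The values at the vertices [v] of the Green function with pole [y]. *)
Definition green_column y v : R := \sum_w hat w y * vgreen v w - bump c y / 2.

(** For fixed [y] the Green function is a shape; the formula that is symmetric
    in [x] and [y] is [green_explicitE]. *)
Definition green_explicit x y : R := shape (green_column y) c y x.

Lemma green_explicitE x y : green_explicit x y =
  \sum_v \sum_w hat v x * hat w y * vgreen v w - bump c x / 2 - bump c y / 2 + tent x y.
Proof.
rewrite /green_explicit /shape /green_column interp_hat_const interp_hat.
under [X in X - bump c y / 2]eq_bigr do rewrite mulr_sumr.
under [X in X - bump c y / 2]eq_bigr => v _ do under eq_bigr do rewrite mulrA.
by ring.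
Qed.

Lemma green_explicit_sym x y : green_explicit x y = green_explicit y x.
Proof.
rewrite !green_explicitE (tent_sym x) exchange_big /=.
rewrite (eq_bigr (fun v => \sum_w hat v y * hat w x * vgreen v w)); first by ring.
move=> v _; apply: eq_bigr => w _.
by rewrite /vgreen (pgreen_sym Gam_conn b L_gt0 M w); ring.
Qed.

Lemma green_explicit_continuous :
  continuous (fun z : mpoint Gam * mpoint Gam => green_explicit z.1 z.2).
Proof.
have fstc (f : mpoint Gam -> R) : continuous f ->
    continuous (fun z : mpoint Gam * mpoint Gam => f z.1).
  by move=> fc z; apply: (@continuous_comp _ _ _ fst f z); [exact: cvg_fst|exact: fc].
have sndc (f : mpoint Gam -> R) : continuous f ->
    continuous (fun z : mpoint Gam * mpoint Gam => f z.2).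
  by move=> fc z; apply: (@continuous_comp _ _ _ snd f z); [exact: cvg_snd|exact: fc].
under eq_fun do rewrite green_explicitE.
move=> z; apply: cvgD; last exact: continuous_tent.
have halfc (f : mpoint Gam -> R) : continuous f -> continuous (fun x => f x / 2).
  by move=> fc x; exact: (cvgM (fc x) (cvg_cst (2^-1 : R))).
apply: cvgB; last exact: (sndc _ (halfc _ (@continuous_bump R Gam c))).
apply: cvgB; last exact: (fstc _ (halfc _ (@continuous_bump R Gam c))).
apply: sum_cvg => v; apply: sum_cvg => w.
have hv := fstc _ (@continuous_interp R Gam (fun w => (w == v)%:R)).
have hw := sndc _ (@continuous_interp R Gam (fun v => (v == w)%:R)).
exact: (cvgM (cvgM (hv z) (hw z)) (cvg_cst (vgreen v w : R))).
Qed.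

Lemma green_column_lap y v : lap L (green_column y) v = hat v y - M v.
Proof.
have -> : lap L (green_column y) v =
    lap L (fun z => \sum_w hat w y * pgreen L b M w z) v.
  apply: eq_div => e; congr (_ / _); rewrite /green_column.
  rewrite opprB addrA subrK -!sumrB; apply: eq_bigr => w _.
  by rewrite /vgreen !(pgreen_sym Gam_conn b L_gt0 M w); ring.
rewrite lap_sum; under eq_bigr do rewrite lap_pgreen // mulrBr mulrC eq_sym.
by rewrite sumrB -mulr_suml sum_hat mul1r sum_pred1.
Qed.

(** The quadratic term in [y] is the one needed to cancel the mean of the kink
    in [charge_integral_shape]. *)
Lemma green_explicit_mean y : \sum_v M v * green_column y v = spread c - bump c y / 2.
Proof.
rewrite /green_column; under eq_bigr do rewrite mulrBr mulr_sumr.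
rewrite sumrB -mulr_suml mass1 mul1r exchange_big /=; congr (_ - _).
rewrite -[RHS]mul1r -(sum_hat y) mulr_suml; apply: eq_bigr => w _.
under eq_bigr do rewrite mulrCA /vgreen mulrDr.
by rewrite -mulr_sumr big_split /= -mulr_suml mass1 sum_pgreen // add0r mul1r.
Qed.

Lemma is_green_explicit : is_green mu green_explicit.
Proof.
split; [exact: green_explicit_continuous|exact: green_explicit_sym| |] => y.
  apply: (@has_laplacian_eq _ _ _ (fun A => \d_y A - pc_measure m c A)%E).
    by move=> A mA; rewrite mu_pc.
  apply: has_laplacian_shape => v; rewrite green_column_lap /vertex_weight; ring.
rewrite (charge_integral_shape _ _ mu_pc) green_explicit_mean; ring.
Qed.

(** Two Green functions differ, for each [y], by a constant in [x], and the
    normalisation of the mean makes it 0 as the measure has total mass 1. *)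
Lemma greenE : green mu = green_explicit.
Proof.
apply: xget_unique => [|g [_ _ g_lap g_mean]]; first exact: is_green_explicit.
have [_ _ e_lap e_mean] := is_green_explicit.
apply/funext => x; apply/funext => y.
have pcl g' : has_laplacian g' (fun A => \d_y A - mu A)%E ->
    has_laplacian g' (fun A => \d_y A - pc_measure m c A)%E.
  by apply: has_laplacian_eq => A mA; rewrite mu_pc.
have [k gk] := laplacian_uniq Gam_conn (pcl _ (g_lap y)) (pcl _ (e_lap y)).
rewrite gk; suff -> : k = 0 by rewrite addr0.
have := g_mean y.
rewrite (_ : g^~ y = shape (fun v => green_column y v + k) c y); last first.
  by apply/funext => z; rewrite gk shape_const.
rewrite (charge_integral_shape _ _ mu_pc).
under eq_bigr do rewrite mulrDr.
rewrite big_split /= -mulr_suml mass1 green_explicit_mean; lra.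
Qed.

Lemma green_vertex v w : green_explicit (vpt v) (vpt w) = vgreen v w.
Proof.
rewrite /green_explicit shape_vpt /green_column /= mul0r subr0.
rewrite (eq_bigr (fun z => (z == w)%:R * vgreen v z)) ?sum_pred1 // => z _.
by rewrite /hat /= eq_sym.
Qed.

Lemma green_diag_edge e t : 0 <= t <= L e ->
  green_explicit (edge_pt e t) (edge_pt e t) =
  quad (vgreen (src e) (src e))
    (2 * (vgreen (src e) (tgt e) - vgreen (src e) (src e)) / L e + 1 - c e * L e)
    (2 * ((vgreen (src e) (src e) + vgreen (tgt e) (tgt e)
           - 2 * vgreen (src e) (tgt e)) / L e ^+ 2 - (L e)^-1 + c e)) t.
Proof.
move=> t_in; rewrite green_explicitE bump_edge //.
have -> : \sum_v \sum_w hat v (edge_pt e t) * hat w (edge_pt e t) * vgreen v w =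
    interp (fun v => interp (vgreen v) (edge_pt e t)) (edge_pt e t).
  rewrite interp_hat; apply: eq_bigr => v _; rewrite interp_hat mulr_sumr.
  by apply: eq_bigr => w _; rewrite mulrA.
rewrite !interp_edge // tent_edge // /tent1.
have -> : vgreen (tgt e) (src e) = vgreen (src e) (tgt e) by rewrite /vgreen pgreen_sym.
have L0 : L e != 0 by rewrite gt_eqF.
rewrite (_ : Num.min _ _ = t * (L e - t)); last first.
  have Le0 := L_gt0 e; have /andP[t_ge0 t_leL] := t_in.
  have [->|t0] := eqVneq t 0; first by rewrite edge_pt_le0 //= !mul0r minxx.
  have [->|tL] := eqVneq t (L e).
    rewrite edge_pt_ge //= subrr mulr0 subr0 min_r ?mulr0 //.
    by rewrite mulr_ge0 // ltW.
  rewrite coord_edge_pt ?minxx // !lt_neqAle tL t_leL eq_sym t0 t_ge0 //.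
by rewrite /quad; field.
Qed.

(** On the diagonal the Green function is quadratic along each edge, and the
    polarisation [pgreen_res] turns its mixed values into resistances. *)
Lemma charge_integral_green_diag (nu : charge (mpoint Gam) R) n d :
  (forall A, measurable A -> nu A = pc_measure n d A) ->
  charge_integral nu (fun x => green mu x x) =
  \sum_v vertex_weight n d v * vgreen v v +
  \sum_e d e * (L e / 6 * (L e - res L b (src e) (tgt e) - c e * L e ^+ 2)).
Proof.
move=> nu_pc; rewrite greenE (charge_integral_pc nu_pc); last first.
  move=> x; apply: (@continuous_comp _ _ _ (fun x => (x, x))
    (fun z : mpoint Gam * mpoint Gam => green_explicit z.1 z.2) x).
    exact: (cvg_pair (@cvg_id _ (nbhs x)) (@cvg_id _ (nbhs x))).
  exact: green_explicit_continuous.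
under eq_bigr do rewrite green_vertex.
rewrite sum_vertex_weight -addrA -big_split /=; congr (_ + _); apply: eq_bigr => e _.
rewrite -mulrDr; congr (_ * _).
have LL : 0 <= L e <= L e by rewrite lexx ltW.
rewrite (Rintegral_kink LL (A := vgreen (src e) (src e))
    (B := 2 * (vgreen (src e) (tgt e) - vgreen (src e) (src e)) / L e + 1 - c e * L e)
    (c := 2 * ((vgreen (src e) (src e) + vgreen (tgt e) (tgt e)
           - 2 * vgreen (src e) (tgt e)) / L e ^+ 2 - (L e)^-1 + c e))); last first.
  move=> t t_in; rewrite green_diag_edge // max_r ?subr0 //; lra.
rewrite -(pgreen_res Gam_conn b L_gt0 M) /primitive.
have -> : pgreen L b M (src e) (src e) + pgreen L b M (tgt e) (tgt e) -
    2 * pgreen L b M (src e) (tgt e) = vgreen (src e) (src e) + vgreen (tgt e) (tgt e) -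
    2 * vgreen (src e) (tgt e) by rewrite /vgreen; ring.
by field; rewrite gt_eqF.
Qed.

End Green.
End PiecewiseConstantMeasure.

(** * Voltages and the density of the canonical measure *)

Lemma big_sig_cond (R : nmodType) (T : finType) (P C : pred T) (F : T -> R) :
  \sum_(x : {x | P x} | C (val x)) F (val x) = \sum_(x | P x && C x) F x.
Proof.
rewrite [RHS](reindex_omap (val : {x | P x} -> T) insub); last first.
  by move=> x /andP[Px _]; rewrite insubT.
by apply: eq_bigl => -[x Px] /=; rewrite insubT Px /= eqxx andbT.
Qed.

Section Resistance.
Variables (R : realType) (Gam : metrized_graph R).
Hypothesis Gam_conn : connected_graph Gam.
Implicit Types (e : edge Gam) (p q v w : vert Gam) (x y : mpoint Gam).

Lemma pc_measure_dirac q (A : set (mpoint Gam)) :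
  pc_measure (fun v => (v == q)%:R) (fun=> 0 : R) A = \d_(vpt q : mpoint Gam) A.
Proof.
rewrite /pc_measure [X in (_ + X)%E]big1 => [|e _]; last by rewrite mul0e.
rewrite adde0 (bigD1 q) //= eqxx mul1e big1 ?adde0 // => v /negbTE->.
by rewrite mul0e.
Qed.

(** Between vertices the voltage function interpolates the discrete potential. *)
Lemma is_voltage_interp p q u : lap (@len R Gam) u =1 dipole R p q ->
  is_voltage (vpt q) (vpt p) (interp (fun v => u v - u q)).
Proof.
move=> lu; set u' := fun v => u v - u q.
have E : interp u' = shape u' (fun=> 0) (vpt p).
  by apply/funext => z; rewrite interp_shape /shape !tent_vpt.
split; last by rewrite /= /u' subrr.
- exact: continuous_interp.
- exists [::] => e t t_in _; exists (left_slope u' (fun=> 0) e 0 - 1), (u' (src e)).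
  have : t \in `]0, len e[ by rewrite in_itv.
  move/near_in_itvoo; apply: filterS => s; rewrite in_itv /= => s_in.
  by rewrite E shape_quad_r /quad /=; [ring|lra].
- rewrite E; have V : has_laplacian (shape u' (fun=> 0) (vpt p))
      (fun A => \d_(vpt p) A - pc_measure (fun v => (v == q)%:R : R)%R (fun=> 0%R) A)%E.
    apply: has_laplacian_shape => v.
    rewrite (_ : lap _ _ v = dipole R p q v); last first.
      by rewrite -lu; apply: eq_div => e; rewrite /u'; congr (_ / _); ring.
    rewrite big1 => [|e _]; last by rewrite mul0r.
    rewrite big1 => [|e _]; last by rewrite mul0r.
    by rewrite /dipole /hat /= eq_sym; ring.
  by apply: has_laplacian_eq V => A mA; rewrite pc_measure_dirac.
Qed.

Lemma resistance_vertex p q u i : is_pot (@len R Gam) (dipole R p q) u i ->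
  resistance (vpt p : mpoint Gam) (vpt q) = u p - u q.
Proof.
move=> ui; have lu := lap_pot (@len_gt0 R Gam) ui.
have V := is_voltage_interp lu.
rewrite /resistance /voltage (xget_unique _ V) // => f [fc _ fl fq].
have [_ _ vl vq] := V.
have E g : has_laplacian g (fun A => \d_(vpt p) A - \d_(vpt q) A)%E ->
    has_laplacian g (fun A => \d_(vpt p) A -
      pc_measure (fun v => (v == q)%:R : R)%R (fun=> 0%R) A)%E.
  by apply: has_laplacian_eq => A mA; rewrite pc_measure_dirac.
have [k fk] := laplacian_uniq Gam_conn (E _ fl) (E _ vl).
apply/funext => x; rewrite fk; have := fk (vpt q); rewrite fq vq; lra.
Qed.

End Resistance.

Section EdgeDensity.
Variables (R : realType) (Gam : metrized_graph R).
Hypothesis Gam_conn : connected_graph Gam.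
Variables (e : edge Gam) (b : vert Gam).
Implicit Types (v w : vert Gam).
Local Notation L := (@len R Gam).
Let L_gt0 e' : 0 < L e'. Proof. exact: len_gt0. Qed.
Local Notation H := (del_edge e).

Lemma connect_del_edge v w : connect (adj (predT : pred (edge Gam))) v w ->
  connect (adj (predT : pred (edge H))) (src e) (tgt e) ->
  connect (adj (predT : pred (edge H))) v w.
Proof.
move=> vw st.
have Hsym : connect_sym (adj (predT : pred (edge H))).
  apply: sym_connect_sym => x y; apply/existsP/existsP => -[f]; exists f; by rewrite orbC.
move: v w vw; apply: connect_sub => v w /existsP[f /= vwf].
have [fe|fe] := eqVneq f e.
  move: vwf; rewrite fe => /orP[]/andP[/eqP<- /eqP<-]; first exact: st.
  by rewrite Hsym.
by apply: connect1; apply/existsP; exists (exist _ f fe).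
Qed.

(** Two resistors in parallel, [1 / r = 1 / L + 1 / R], with the convention that
    [R] is infinite and [r = L] for a bridge.  In the first case the current of
    the graph without [e] is completed by [R / L] through [e] and normalised; in
    the second one all the current passes through [e]. *)
Lemma edge_density : fine (1 / ((len e)%:E + edge_resistance e))%E =
  (L e - res L b (src e) (tgt e)) / L e ^+ 2.
Proof.
have Le := L_gt0 e; rewrite /edge_resistance; case: asboolP => [H_conn|H_disc].
- have Hlen f : 0 < @len R H f by exact: len_gt0.
  have [|u [i ui]] := @pot_exists R H H_conn (@len R H) (dipole R (src e) (tgt e))
      (fun f => ltW (Hlen f)).
    under eq_bigr do rewrite -[dipole _ _ _ _]mul1r.
    by rewrite (sum_dipole (fun=> 1)) subrr.
  pose r := u (src e) - u (tgt e).
  have -> : @resistance R H (vpt (src e : vert H)) (vpt (tgt e : vert H)) = r.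
    exact: (@resistance_vertex R H H_conn _ _ u i ui).
  have r0 : 0 <= r.
    by rewrite /r -(resE H_conn b (fun f => ltW (Hlen f)) ui) (res_ge0 H_conn) // => f; exact: ltW.
  (* With the same potentials, [e] carries the current [r / L e]. *)
  pose i' f := if insub f is Some g then i g else r / L e.
  have divi' v : div i' v = (1 + r / L e) * dipole R (src e) (tgt e) v.
    have i'e : i' e = r / L e by rewrite /i' insubF ?eqxx.
    have i'g (g : edge H) : i' (val g) = i g by rewrite /i' valK.
    have split_sum (C : pred (edge Gam)) : \sum_(f | C f) i' f =
        (C e)%:R * (r / L e) + \sum_(g : edge H | C (val g)) i g.
      under [X in _ + X]eq_bigr do rewrite -i'g.
      rewrite (@big_sig_cond R _ (fun f => f != e) C i') [LHS]big_mkcond (bigD1 e) //= i'e.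
      rewrite -big_mkcondr; congr (_ + _); case: (C e) => /=; ring.
    have kir : div i v = dipole R (src e) (tgt e) v := ui.2 v.
    transitivity (r / L e * dipole R (src e) (tgt e) v + div i v); last by rewrite kir; ring.
    by rewrite /div !split_sum /dipole !(eq_sym v); ring.
  have k0 : 1 + r / L e != 0 by rewrite gt_eqF // ltr_pwDl // divr_ge0 // ltW.
  have flow : is_pot L (dipole R (src e) (tgt e)) (fun v => u v / (1 + r / L e))
      (fun f => i' f / (1 + r / L e)).
    split=> [f|v].
      rewrite -mulrBl mulrA; congr (_ / _); rewrite /i'.
      case: insubP => [g _ <-|]; first exact: ui.1.
      by rewrite negbK => /eqP->; rewrite mulrC divfK // gt_eqF.
    rewrite (eq_div (i' := fun f => (1 + r / L e)^-1 * i' f + 0)) => [|f]; last first.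
      by rewrite addr0 mulrC.
    rewrite (div_lin _ i' (fun=> 0)) divi' mulKf // /div !big1 //; ring.
  rewrite (resE Gam_conn b (fun f => ltW (L_gt0 f)) flow) -mulrBl -/r.
  rewrite -EFinD /inve ifF; last by rewrite gt_eqF // ltr_pwDl.
  rewrite -EFinM /= mul1r; field.
  by rewrite !gt_eqF // ltr_pwDl.
- have disc : ~ connect (adj (predT : pred (edge H))) (src e) (tgt e).
    by move=> st; apply: H_disc => v w; apply: connect_del_edge => //; exact: Gam_conn.
  have -> : (1 / ((len e)%:E + +oo) = 0 :> \bar R)%E by rewrite addey // /inve mule0.
  (* [e] is a bridge: the potential is [L e] on the side of [src e], and 0 on the
     other one. *)
  pose u v : R := L e * (connect (adj (predT : pred (edge H))) (src e) v)%:R.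
  have Hsym : connect_sym (adj (predT : pred (edge H))).
    by apply: sym_connect_sym => x y; apply/existsP/existsP => -[f]; exists f; rewrite orbC.
  have flow : is_pot L (dipole R (src e) (tgt e)) u (fun f => (f == e)%:R).
    split=> [f|v].
      have [->|fe] := eqVneq f e.
        by rewrite /u connect0 (negbTE (introN idP disc)) /=; ring.
      rewrite mulr0 /u; apply/eqP; rewrite subr_eq0; apply/eqP; congr (_ * (_ : bool)%:R).
      apply: (same_connect_r Hsym); apply: connect1; apply/existsP.
      by exists (exist _ f fe); rewrite /= !eqxx.
    have sum1 (C : pred (edge Gam)) : \sum_(f | C f) (f == e)%:R = (C e)%:R :> R.
      rewrite big_mkcond (bigD1 e) //= eqxx big1 ?addr0 => [|f /negbTE->].
        by case: (C e).
      by rewrite if_same.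
    by rewrite /div !sum1 /dipole !(eq_sym v).
  rewrite (resE Gam_conn b (fun f => ltW (L_gt0 f)) flow) /u connect0.
  by rewrite (negbTE (introN idP disc)) /= mulr1 mulr0 subr0 subrr mul0r.
Qed.

End EdgeDensity.

(** * The phi-invariant in terms of resistances *)

(** The kernel of the coboundary of a connected graph consists of constants. *)
Lemma genus_connected (G : multigraph) : connected_graph G ->
  (genus G + #|vert G| = #|edge G| + 1)%N.
Proof.
move=> G_conn; have V0 := vert_gt0 G.
pose A := coboundary G; rewrite /genus mxrank_coker.
have ker1 : \rank (kermx A) = 1%N.
  pose J : 'rV[rat]_#|vert G| := const_mx 1.
  have uA (u : 'rV[rat]_#|vert G|) j : (u *m A) 0 j =
      u 0 (enum_rank (tgt (enum_val j))) - u 0 (enum_rank (src (enum_val j))).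
    rewrite mxE; under eq_bigr do rewrite mxE mulrBr.
    rewrite sumrB; congr (_ - _).
      rewrite (bigD1 (enum_rank (tgt (enum_val j)))) //= enum_rankK eqxx mulr1.
      rewrite big1 ?addr0 // => i ij; rewrite (negbTE (_ : _ != _)) ?mulr0 //.
      by apply: contraNneq ij => ->; rewrite enum_valK.
    rewrite (bigD1 (enum_rank (src (enum_val j)))) //= enum_rankK eqxx mulr1.
    rewrite big1 ?addr0 // => i ij; rewrite (negbTE (_ : _ != _)) ?mulr0 //.
    by apply: contraNneq ij => ->; rewrite enum_valK.
  have JA : J *m A = 0 by apply/rowP => j; rewrite uA !mxE subrr.
  have rJ : \rank J = 1%N.
    rewrite rank_rV; apply/eqP; rewrite eqb1; apply/eqP => /rowP/(_ (Ordinal V0)).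
    by rewrite !mxE => /eqP; rewrite oner_eq0.
  rewrite -rJ; apply/eqP; rewrite eqn_leq; apply/andP; split; apply: mxrankS; last first.
    by rewrite sub_kermx JA.
  apply/row_subP => k; set u := row k _.
  have u0 : u *m A = 0 by rewrite -row_mul mulmx_ker row0.
  pose w v := u 0 (enum_rank v).
  have wc v : w v = w (base_vert G).
    apply: (connect_const (B := predT)) (G_conn _ _) => e _.
    have /rowP/(_ (enum_rank e)) := u0.
    by rewrite uA enum_rankK [X in _ = X -> _]mxE => /subr0_eq /esym.
  apply/sub_rVP; exists (w (base_vert G)); apply/rowP => i.
  by rewrite [RHS]mxE [in RHS]mxE mulr1 -[in LHS](enum_valK i) -/(w _) wc.
have := mxrank_ker A; rewrite ker1.
have := rank_leq_row A; have := rank_leq_col A; rewrite -/A; lia.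
Qed.

Section PhiFormula.
Variables (R : realType).

(** The coefficient of [v] in [delta_K]. *)
Definition kweight (G : multigraph) (q : vert G -> nat) v : R :=
  (valence v)%:R - 2 + 2 * (q v)%:R.

(** Since [1 / 0 = 0], the edges of length 0 do not contribute. *)
Definition phi_formula (G : multigraph) (L : edge G -> R) (b : vert G)
    (q : vert G -> nat) : R :=
  let g := (genus G + \sum_v q v)%N%:R in
  - 4^-1 * \sum_e L e
  + (5 * g - 2) / g * (
      4^-1 * \sum_e (res L b (tgt e) b - res L b (src e) b) ^+ 2 / L e
      + 12^-1 * \sum_e (L e - res L b (src e) (tgt e)) ^+ 2 / L e)
  + (4 * g)^-1 * \sum_v \sum_w kweight q v * kweight q w * res L b v w.

Lemma sum_kweight (G : multigraph) (q : vert G -> nat) : connected_graph G ->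
  \sum_v kweight q v = 2 * (genus G + \sum_v q v)%N%:R - 2 :> R.
Proof.
move=> /genus_connected gE.
have vE : (\sum_(v : vert G) valence v = 2 * #|edge G|)%N.
  rewrite /valence big_split /= mul2n -addnn; congr addn.
    under eq_bigr do rewrite -sum1_card.
    by rewrite (sum_fibres (R := nat) (@src G) (fun _ _ => 1%N)) sum1_card.
  under eq_bigr do rewrite -sum1_card.
  by rewrite (sum_fibres (R := nat) (@tgt G) (fun _ _ => 1%N)) sum1_card.
rewrite /kweight big_split sumrB /= -natr_sum vE natrM natrD natr_sum.
rewrite -mulr_sumr sumr_const -[2 *+ _]mulr_natr.
have : (genus G)%:R + #|vert G|%:R = #|edge G|%:R + 1 :> R.
  by rewrite -natrD gE natrD.
lra.
Qed.

(** The diagonal values of the Green function are expressed by resistances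
    ([pgreen_diag]).  The admissible measure moved to the vertices is
    [(2 F + K) / (2 g)] with [F] the Foster weights, so all integrals reduce to
    [sum F = 1], [sum K = 2 g - 2], the constant [sum_x F x r(x, v) = X / 2] and
    the double sum [theta] of [K]. *)
Lemma phi_formulaE (Gam : metrized_graph R) (b : vert Gam) (q : vert Gam -> nat) :
  connected_graph Gam -> (0 < genus Gam + \sum_v q v)%N ->
  phi q = phi_formula (@len R Gam) b q.
Proof.
move=> Gam_conn; rewrite -(ltr0n R).
set gn := (_ + _)%N; set g : R := gn%:R => g_gt0.
pose L := @len R Gam; have L_gt0 e : 0 < L e by exact: len_gt0.
have L_neq0 e : L e != 0 by rewrite gt_eqF.
have g_neq0 : g != 0 by rewrite gt_eqF.
pose r e := res L b (src e) (tgt e).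
pose m v := (2 * g)^-1 * (2 * (1 - 2^-1 * (valence v)%:R) + kweight q v).
pose c e := (L e - r e) / (g * L e ^+ 2).
have pcE (m' : vert Gam -> R) (c' : edge Gam -> R) A : measurable A -> pc_measure m' c' A =
    (\sum_v m' v * \1_A (vpt v) + \sum_e c' e * fine (dx_edge e A))%:E.
  move=> mA; rewrite /pc_measure EFinD -!sumEFin; congr (_ + _)%E; apply: eq_bigr => i _.
  by rewrite EFinM fineK // fin_num_measure.
have dKE A : delta_K q A = (\sum_v kweight q v * \1_(A : set (mpoint Gam)) (vpt v))%:E :> \bar R.
  rewrite /delta_K charge_sumE -sumEFin; apply: eq_bigr => v _.
  by rewrite EFinM indicE -diracE.
have canE A : measurable A -> mu_can Gam A = pc_measure
    (fun v => 1 - 2^-1 * (valence v)%:R) (fun e => (L e - r e) / L e ^+ 2) A.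
  move=> mA; rewrite /pc_measure.
  pose m1 := charge_sum (fun v : vert Gam =>
       charge_scale (1 - 2^-1 * (valence v)%:R) (charge_dirac (@vpt R Gam v))).
  pose m2 := charge_sum (fun e : edge Gam =>
       charge_scale (fine (1 / ((len e)%:E + edge_resistance e)))%E (charge_dx e)).
  have -> : mu_can Gam A = (m1 A + m2 A)%E by [].
  rewrite !charge_sumE; congr (_ + _)%E; apply: eq_bigr => e _.
  by rewrite /charge_scale (edge_density Gam_conn e b).
have mu_pc A : measurable A -> mu_ad q A = pc_measure m c A.
  move=> mA; pose h : R := (2 * (pol_genus q)%:R)^-1.
  have -> : mu_ad q A = (h%:E * (2%:E * mu_can Gam A + delta_K q A))%E by [].
  rewrite canE // !pcE // dKE -EFinM; congr EFin.
  rewrite [2 * _]mulrDr !mulr_sumr addrAC -big_split /= mulrDr !mulr_sumr.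
  congr (_ + _); apply: eq_bigr => i _.
    by rewrite /m /h -/gn -/g; ring.
  rewrite /c /h -/gn -/g; field.
  by rewrite g_neq0 L_neq0.
pose n v := (10 * g + 2) * m v - kweight q v.
pose d e := (10 * g + 2) * c e.
pose nu : charge (mpoint Gam) R := charge_add (charge_scale (10 * gn%:R + 2) (mu_ad q)) (charge_scale (-1) (@delta_K R Gam q)).
have nu_pc A : measurable A -> nu A = pc_measure n d A.
  move=> mA.
  have -> : nu A = ((10 * gn%:R + 2)%:E * mu_ad q A + (-1)%:E * delta_K q A)%E by [].
  rewrite mu_pc // !pcE // dKE -EFinD; congr EFin.
  rewrite mulrDr !mulr_sumr addrAC -big_split /=; congr (_ + _); apply: eq_bigr => i _.
    by rewrite /n -/g; ring.
  by rewrite /d -/g; ring.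
pose F := foster L b.
have ME v : vertex_weight m c v = (2 * g)^-1 * (2 * F v + kweight q v).
  have cL (P : pred (edge Gam)) : \sum_(e | P e) c e * len e =
      g^-1 * (#|P|%:R - \sum_(e | P e) r e / L e).
    rewrite -sum1_card natr_sum -sumrB mulr_sumr; apply: eq_bigr => e _.
    by rewrite /c -/L; field; rewrite g_neq0 L_neq0.
  rewrite /vertex_weight !cL /m /F /foster /valence natrD -/L -/r.
  by field.
have NE v : vertex_weight n d v = (10 * g + 2) * vertex_weight m c v - kweight q v.
  rewrite /vertex_weight /n /d.
  have dL (P : pred (edge Gam)) : \sum_(e | P e) (10 * g + 2) * c e * len e =
      (10 * g + 2) * \sum_(e | P e) c e * len e.
    by rewrite mulr_sumr; apply: eq_bigr => e _; rewrite mulrA.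
  by rewrite !dL; ring.
have sumF : \sum_v F v = 1 by exact: sum_foster.
have sumK : \sum_v kweight q v = 2 * g - 2 by exact: sum_kweight.
have mass1 : \sum_v vertex_weight m c v = 1.
  under eq_bigr do rewrite ME.
  by rewrite -mulr_sumr big_split /= -mulr_sumr sumF sumK; field.
rewrite /phi -/gn (charge_integral_green_diag b Gam_conn mu_pc mass1 nu_pc).
pose M := vertex_weight m c; pose rs := res L b.
pose X := \sum_e (rs (tgt e) b - rs (src e) b) ^+ 2 / L e.
pose W := \sum_e (L e - r e) ^+ 2 / L e.
pose theta := \sum_v \sum_w kweight q v * kweight q w * rs v w.
pose A v := \sum_x M x * rs x v; pose B v := \sum_x kweight q x * rs x v.
have FX v : \sum_x F x * rs x v = X / 2.
  by have := sum_foster_res Gam_conn b L_gt0 v; rewrite -/F -/rs -/X; lra.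
have AE v : A v = (2 * g)^-1 * (X + B v).
  rewrite /A (eq_bigr (fun x => (2 * g)^-1 * (2 * (F x * rs x v) + kweight q x * rs x v))).
    by rewrite -mulr_sumr big_split /= -mulr_sumr FX /B; field.
  by move=> x _; rewrite /M ME; field.
have rs_sym v w : rs v w = rs w v.
  by rewrite /rs res_sym // => e; exact: ltW.
have KB : \sum_v kweight q v * B v = theta.
  rewrite /theta /B; apply: eq_bigr => v _; rewrite mulr_sumr; apply: eq_bigr => w _.
  by rewrite (rs_sym v); ring.
have FB : \sum_v F v * B v = (2 * g - 2) * (X / 2).
  rewrite /B; under eq_bigr do rewrite mulr_sumr.
  rewrite exchange_big /= -sumK mulr_suml; apply: eq_bigr => x _.
  rewrite -(FX x) mulr_sumr; apply: eq_bigr => v _; rewrite (rs_sym x); ring.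
have KA : \sum_v kweight q v * A v = (2 * g)^-1 * (X * (2 * g - 2) + theta).
  rewrite (eq_bigr (fun v => (2 * g)^-1 * (kweight q v * X + kweight q v * B v))).
    by rewrite -mulr_sumr big_split /= KB -mulr_suml sumK (mulrC X).
  by move=> v _; rewrite AE; field.
have MA : \sum_v M v * A v = (2 * g)^-1 ^+ 2 * (X * (4 * g - 2) + theta).
  have FA : \sum_v F v * A v = (2 * g)^-1 * (X + (2 * g - 2) * (X / 2)).
    rewrite (eq_bigr (fun v => (2 * g)^-1 * (F v * X + F v * B v))).
      by rewrite -mulr_sumr big_split /= FB -mulr_suml sumF mul1r.
    by move=> v _; rewrite AE; field.
  rewrite (eq_bigr (fun v => (2 * g)^-1 * (2 * (F v * A v) + kweight q v * A v))).
    by rewrite -mulr_sumr big_split /= -mulr_sumr KA FA; field.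
  by move=> v _; rewrite /M ME; field.
have MMr : \sum_x \sum_y M x * M y * rs x y = \sum_v M v * A v.
  apply: eq_bigr => x _; rewrite /A mulr_sumr; apply: eq_bigr => y _.
  by rewrite (rs_sym y); ring.
have spreadE : spread c = W / (12 * g ^+ 2).
  rewrite /spread /W mulr_suml mulr_sumr; apply: eq_bigr => e _; rewrite /c -/L.
  by field; rewrite g_neq0 L_neq0.
have vg v : vgreen b m c v v = A v - 2^-1 * (\sum_v M v * A v) + W / (12 * g ^+ 2).
  by rewrite /vgreen pgreen_diag // spreadE -MMr.
have sumN : \sum_v vertex_weight n d v = (10 * g + 2) - (2 * g - 2).
  under eq_bigr do rewrite NE.
  by rewrite sumrB -mulr_sumr mass1 sumK mulr1.
have NA : \sum_v vertex_weight n d v * A v = (10 * g + 2) * (\sum_v M v * A v)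
    - \sum_v kweight q v * A v.
  rewrite (eq_bigr (fun v => (10 * g + 2) * (M v * A v) - kweight q v * A v)).
    by rewrite sumrB -mulr_sumr.
  by move=> v _; rewrite NE /M; ring.
have -> : \sum_v vertex_weight n d v * vgreen b m c v v =
    \sum_v vertex_weight n d v * A v +
    (8 * g + 4) * (W / (12 * g ^+ 2) - 2^-1 * (\sum_v M v * A v)).
  rewrite (eq_bigr (fun v => vertex_weight n d v * A v + vertex_weight n d v *
      (W / (12 * g ^+ 2) - 2^-1 * (\sum_v M v * A v)))).
    by rewrite big_split /= -mulr_suml sumN; congr (_ + _); field.
  by move=> v _; rewrite vg; ring.
have -> : \sum_e d e * (len e / 6 * (len e - res (@len R Gam) b (src e) (tgt e) - c e * len e ^+ 2))
   = (10 * g + 2) * (g - 1) / (6 * g ^+ 2) * W.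
  rewrite /W mulr_sumr; apply: eq_bigr => e _; rewrite /d /c -/L -/(r e).
  by field; rewrite g_neq0 L_neq0.
rewrite NA MA KA /phi_formula /total_length -/gn -/g -/L -/rs -/X -/theta.
have -> : \sum_e (L e - rs (src e) (tgt e)) ^+ 2 / L e = W by [].
field.
exact: g_neq0.
Qed.

End PhiFormula.

(** * Contraction of the edges of length zero *)

Lemma sum_preim (K : nmodType) (I J : finType) (f : I -> J) (P : pred J) (F : I -> K) :
  \sum_(j | P j) \sum_(i | f i == j) F i = \sum_(i | P (f i)) F i.
Proof.
rewrite (exchange_big_dep (fun i => P (f i))) /=; last by move=> j i Pj /eqP->.
apply: eq_bigr => i Pi; rewrite (big_pred1 (f i)) // => j /=.
by rewrite eq_sym; case: eqP => [->|_]; rewrite ?Pi ?andbF.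
Qed.

Section Contraction.
Variables (R : realType) (G : multigraph) (L : edge G -> R).
Hypothesis G_conn : connected_graph G.
Hypothesis L_ge0 : forall e, 0 <= L e.
Implicit Types (e : edge G) (v w p q b : vert G).
Local Notation G' := (contr_graph L).
Local Notation quot := (@quot_map R G L).
Let L' (e : edge G') : R := L (val e).

Let L'_ge0 (e : edge G') : 0 <= L' e. Proof. by rewrite /L' ltW ?(valP e). Qed.

Lemma zero_edge_sym : connect_sym (adj (zero_edge L)).
Proof.
apply: sym_connect_sym => v w; apply/existsP/existsP => -[e /andP[e0 ee]];
  by exists e; rewrite e0 orbC.
Qed.

Lemma quotE v w : (quot v == quot w) = connect (adj (zero_edge L)) v w.
Proof.
rewrite -val_eqE /=; apply/eqP/idP => [vw|vw].
  have : w \in zero_comp L w by rewrite finset.inE connect0.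
  by rewrite -vw finset.inE.
by apply/finset.setP => x; rewrite !finset.inE; exact: (same_connect zero_edge_sym vw).
Qed.

Lemma in_quot v w : (v \in val (quot w)) = (quot v == quot w).
Proof. by rewrite /= finset.inE eq_sym quotE. Qed.

Lemma quot_surj (C : vert G') : exists v, C = quot v.
Proof.
have /imsetP[v _ Cv] := valP C; exists v; exact: val_inj.
Qed.

Lemma in_block v (C : vert G') : (v \in val C) = (quot v == C).
Proof. by have [w ->] := quot_surj C; exact: in_quot. Qed.

Lemma quot_zero_edge e : L e = 0 -> quot (src e) = quot (tgt e).
Proof.
move=> e0; apply/eqP; rewrite quotE; apply: connect1; apply/existsP; exists e.
by rewrite /zero_edge e0 !eqxx.
Qed.

(** Paths descend to the contraction. *)
Lemma contr_connected : connected_graph G'.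
Proof.
move=> C D; have [v ->] := quot_surj C; have [w ->] := quot_surj D.
have /connectP[s + ->] := G_conn v w; elim: s v => [|x s IH] v /=.
  by rewrite connect0.
move=> /andP[/existsP[e /= vx]] /IH; apply: connect_trans.
have [e0|Le0] := eqVneq (L e) 0.
  suff -> : quot v = quot x by exact: connect0.
  by case/orP: vx => /andP[/eqP<- /eqP<-]; rewrite (quot_zero_edge e0).
have e_gt0 : 0 < L e by rewrite lt_neqAle eq_sym Le0 L_ge0.
apply: connect1; apply/existsP; exists (exist _ e e_gt0) => /=.
by case/orP: vx => /andP[/eqP-> /eqP->]; rewrite !eqxx ?orbT.
Qed.

Lemma sum_block (K : nmodType) (F : vert G -> K) (C : vert G') :
  \sum_(v | quot v == C) F v = \sum_(v in val C) F v.
Proof. by apply: eq_bigl => v; rewrite in_block. Qed.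

(** The currents along contracted edges cancel in the sum over a block. *)
Lemma div_contr (i : edge G -> R) (C : vert G') :
  div (fun e : edge G' => i (val e)) C = \sum_(v | quot v == C) div i v.
Proof.
rewrite /div sumrB !(sum_preim _ (fun v => quot v == C)).
rewrite (big_sig_cond (fun e => 0 < L e) (fun e => quot (src e) == C)).
rewrite (big_sig_cond (fun e => 0 < L e) (fun e => quot (tgt e) == C)).
rewrite [in RHS](bigID (fun e => 0 < L e)) [X in _ = _ - X](bigID (fun e => 0 < L e)) /=.
rewrite [X in _ = _ + X - _](eq_bigl (fun e => (quot (tgt e) == C) && ~~ (0 < L e))).
  rewrite opprD addrACA subrr addr0.
  by congr (_ - _); apply: eq_bigl => e; rewrite andbC.
move=> e; case: ltP => Le; rewrite ?andbF // !andbT.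
by rewrite (@quot_zero_edge e) //; apply/eqP; rewrite eq_le Le L_ge0.
Qed.

(** By Ohm's law potentials are constant on the blocks. *)
Lemma pot_contr p q u i : is_pot L (dipole R p q) u i ->
  exists u', (forall v, u' (quot v) = u v) /\
    @is_pot R G' L' (@dipole R G' (quot p) (quot q)) u' (fun e : edge G' => i (val e)).
Proof.
move=> ui; have uconst v w : quot v = quot w -> u v = u w.
  move/eqP; rewrite quotE; apply: connect_const => e /eqP e0.
  by apply/eqP; rewrite -subr_eq0 ui.1 e0 mul0r.
have [rep repE] := choice quot_surj.
exists (fun C => u (rep C)).
have u'E v : u (rep (quot v)) = u v by apply: uconst; rewrite -repE.
split=> //; split=> [e|C]; first by rewrite /= !u'E ui.1.
rewrite div_contr; under eq_bigr do rewrite ui.2 /dipole.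
rewrite sumrB.
have S v : \sum_(w | quot w == C) (w == v)%:R = (C == quot v)%:R :> R.
  rewrite big_mkcond (bigD1 v) //= eqxx big1 ?addr0 => [|w /negbTE->].
    by rewrite eq_sym; case: eqP.
  by rewrite if_same.
by rewrite !S.
Qed.

Lemma res_contr b p q :
  @res R G' L' (quot b) (quot p) (quot q) = res L b p q.
Proof.
have [i ui] := gpotB G_conn b L_ge0 p q.
have [u' [u'E u'i]] := pot_contr ui.
by rewrite (@resE R G' contr_connected L' (quot b) L'_ge0 _ _ _ _ u'i) !u'E (resE G_conn b L_ge0 ui).
Qed.

Lemma sum_contr_edge (F : edge G -> R) : (forall e, L e = 0 -> F e = 0) ->
  \sum_(e : edge G') F (val e) = \sum_e F e.
Proof.
move=> F0; rewrite (big_sig_cond (fun e => 0 < L e) xpredT F) [RHS](bigID (fun e => 0 < L e)) /=.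
rewrite [X in _ = _ + X]big1 ?addr0 => [|e Le]; first by apply: eq_bigl => e; rewrite andbT.
by apply: F0; apply/eqP; rewrite eq_le L_ge0 leNgt Le.
Qed.

Lemma fibre_connected (C : vert G') : connected_graph (fibre C).
Proof.
move=> [v vC] [w wC].
have : connect (adj (zero_edge L)) v w.
  by rewrite -quotE; move: vC wC; rewrite !in_block => /eqP-> /eqP->.
move=> /connectP[s]; elim: s v vC => [|x s IH] v vC /=.
  by move=> _ wv; subst w; rewrite (bool_irrelevance wC vC) connect0.
move=> /andP[/existsP[e /andP[e0 vx]] xs] wE.
have xC : x \in val C.
  move: vC; rewrite !in_block => /eqP<-.
  by case/orP: vx => /andP[/eqP<- /eqP<-]; rewrite (quot_zero_edge (eqP e0)).
apply: connect_trans (IH x xC xs wE); apply: connect1; apply/existsP.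
have eC : (L e == 0) && (src e \in val C).
  apply/andP; split; first exact: e0.
  by case/orP: vx => /andP[/eqP-> _].
by exists (exist _ e eC); rewrite -!val_eqE.
Qed.

Lemma fibre_genus (C : vert G') :
  (genus (fibre C) + #|val C| = \sum_(e | (L e == 0%R) && (quot (src e) == C)) 1 + 1)%N.
Proof.
have := genus_connected (@fibre_connected C).
rewrite card_sig [X in (_ = X + 1)%N -> _]card_sig.
rewrite -[X in (_ = X + 1)%N -> _]sum1_card => gE.
rewrite (_ : #|val C| = #|[pred x | x \in val C]|) ?gE //; congr (_ + _)%N.
by apply: eq_bigl => e; rewrite !inE in_block.
Qed.

Lemma count_contr (f : edge G -> vert G) (C : vert G') :
  (\sum_(v | quot v == C) #|[pred e | f e == v]| =
   #|[pred e : edge G' | quot (f (val e)) == C]| +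
   \sum_(e | (L e == 0%R) && (quot (f e) == C)) 1)%N.
Proof.
under eq_bigr do rewrite -sum1_card.
rewrite (sum_preim (K := nat) f (fun v => quot v == C) (fun=> 1%N)) -sum1_card.
rewrite (big_sig_cond (R := nat) (fun e => 0 < L e) (fun e => quot (f e) == C) (fun=> 1%N)).
rewrite (bigID (fun e => 0 < L e)) /=; congr (_ + _)%N; apply: eq_bigl => e.
  by rewrite andbC.
by rewrite -leNgt andbC eq_le L_ge0 andbT.
Qed.

(** The divisor [K] of the contracted graph is the direct image of [K].  A
    contracted edge counts twice in the valences; by [fibre_genus] this makes up
    for the difference between [-2] and the sum of [-2] over the block, together
    with the genus of the block. *)
Lemma kweight_contr (q : vert G -> nat) (C : vert G') :
  @kweight R G' (contr_polarization q) C = \sum_(v | quot v == C) kweight R q v.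
Proof.
have val_sum : (\sum_(v | quot v == C) valence v = @valence G' C +
    2 * \sum_(e | (L e == 0%R) && (quot (src e) == C)) 1)%N.
  rewrite /valence big_split /= !count_contr mul2n -addnn.
  rewrite [X in (_ + (_ + X))%N](eq_bigl (fun e => (L e == 0%R) && (quot (src e) == C))).
    by rewrite addnACA.
  by move=> e; case: eqP => //= e0; rewrite (quot_zero_edge e0).
have gE := fibre_genus C; move: val_sum gE.
set Z := (\sum_(e | _) 1)%N => val_sum gE.
rewrite /kweight big_split sumrB /= -natr_sum val_sum -mulr_sumr sumr_const.
rewrite -[2 *+ _]mulr_natr /contr_polarization sum_block mul2n -addnn !natrD natr_sum.
rewrite (_ : #|[pred v | quot v == C]| = #|val C|); last first.
  by apply: eq_card => v; rewrite !inE in_block.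
have := congr1 (fun n => n%:R : R) gE; rewrite !natrD; lra.
Qed.

Lemma pol_genus_contr (q : vert G -> nat) :
  (genus G' + \sum_(C : vert G') contr_polarization q C = genus G + \sum_v q v)%N.
Proof.
have gG := genus_connected G_conn; have gG' := genus_connected contr_connected.
rewrite /contr_polarization big_split /=.
have -> : (\sum_(C : vert G') \sum_(v in val C) q v = \sum_v q v)%N.
  under eq_bigr do rewrite -sum_block.
  exact: (sum_fibres (R := nat) quot (fun _ v => q v)).
have : (\sum_(C : vert G') (genus (fibre C) + #|val C|) =
    \sum_(C : vert G') (\sum_(e | (L e == 0%R) && (quot (src e) == C)) 1 + 1))%N.
  by apply: eq_bigr => C _; exact: fibre_genus.
rewrite !big_split /= sum1_card.
have -> : (\sum_(C : vert G') #|val C| = #|vert G|)%N.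
  under eq_bigr do rewrite -sum1_card -sum_block.
  by rewrite (sum_fibres (R := nat) quot (fun _ _ => 1%N)) sum1_card.
have -> : (\sum_(C : vert G') \sum_(e | (L e == 0%R) && (quot (src e) == C)) 1 =
    #|[pred e | L e == 0%R]|)%N.
  rewrite -sum1_card (exchange_big_dep (fun e => L e == 0%R)) /=; last by move=> C e _ /andP[].
  apply: eq_bigr => e e0; rewrite (big_pred1 (quot (src e))) // => C.
  by rewrite e0 /= eq_sym.
have : (#|edge G'| + #|[pred e | L e == 0%R]| = #|edge G|)%N.
  rewrite card_sig -(cardID [pred e | 0 < L e] (edge G)); congr (_ + _)%N.
  by apply: eq_card => e; rewrite !inE andbT -leNgt eq_le L_ge0 andbT.
move: gG gG'; move: #|edge G| #|vert G| #|edge G'| #|vert G'| => /=; lia.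
Qed.

Lemma phi_formula_contr b (q : vert G -> nat) :
  @phi_formula R G' L' (quot b) (contr_polarization q) = phi_formula L b q.
Proof.
rewrite /phi_formula pol_genus_contr; congr (_ + _ * (_ * _ + _ * _) + _ * _).
- by rewrite (sum_contr_edge (F := L)).
- under eq_bigr do rewrite /= !res_contr.
  apply: (sum_contr_edge (F := fun e => (res L b (tgt e) b - res L b (src e) b) ^+ 2 / L e)).
  by move=> e ->; rewrite invr0 mulr0.
- under eq_bigr do rewrite /= !res_contr.
  apply: (sum_contr_edge (F := fun e => (L e - res L b (src e) (tgt e)) ^+ 2 / L e)).
  by move=> e ->; rewrite invr0 mulr0.
have group (h : vert G' -> R) : \sum_C kweight R (contr_polarization q) C * h C =
    \sum_v kweight R q v * h (quot v).
  rewrite -(sum_fibres quot (fun C v => kweight R q v * h C)).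
  by apply: eq_bigr => C _; rewrite kweight_contr mulr_suml.
have fold_sum (H : multigraph) (k : vert H -> R) (f : vert H -> vert H -> R) :
    \sum_v \sum_w k v * k w * f v w = \sum_v k v * \sum_w k w * f v w.
  by apply: eq_bigr => v _; rewrite mulr_sumr; apply: eq_bigr => w _; rewrite mulrA.
rewrite !fold_sum group; apply: eq_bigr => v _; rewrite group; congr (_ * _).
by apply: eq_bigr => w _; rewrite res_contr.
Qed.

End Contraction.

(** * Continuity up to the boundary *)

Section Continuity.
Variables (R : realType) (G : multigraph) (G_conn : connected_graph G).
Variables (T : topologicalType) (F : set_system T) (FF : ProperFilter F).
Variables (len_ : T -> edge G -> R) (L0 : edge G -> R) (b : vert G).
Hypothesis L0_ge0 : forall e, 0 <= L0 e.
Hypothesis len_ge0 : \forall t \near F, forall e, 0 <= len_ t e.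
Hypothesis len_cvg : forall e, len_ t e @[t --> F] --> L0 e.

(** Lengths that are positive at the limit are positive nearby; the other ones
    may vanish or not. *)
Lemma len_pos_near : \forall t \near F, forall e, 0 < L0 e -> 0 < len_ t e.
Proof.
have H e : \forall t \near F, 0 < L0 e -> 0 < len_ t e.
  have [Le|Le] := ltP 0 (L0 e); last by near=> t.
  by near=> t => _; near: t; exact: (cvgr_gt (L0 e) (@len_cvg e) 0 Le).
have : \forall t \near F, forall e, e \in enum (edge G) -> (0 < L0 e -> 0 < len_ t e).
  elim: (enum _) => [|e s IH]; first by near=> t.
  near=> t => f; rewrite in_cons => /predU1P[->|fs]; first by near: t; exact: H.
  by move: f fs; near: t.
by apply: filterS => t Ht e; apply: Ht; rewrite mem_enum.
Unshelve. all: by end_near. Qed.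

Lemma gpot_cvg p q : gpot (len_ t) b p q @[t --> F] --> gpot L0 b p q.
Proof.
have [c cP] := gpot_lipschitz G_conn b p q L0_ge0.
have S0 : (\sum_e `|len_ t e - L0 e| * c e) @[t --> F] --> 0.
  rewrite [X in _ --> X](_ : 0 = \sum_e 0 * c e); last by rewrite big1 // => e _; rewrite mul0r.
  apply: sum_cvg => e; apply: cvgM; last exact: cvg_cst.
  by apply/norm_cvg0P/subr_cvg0.
apply/subr_cvg0/norm_cvg0P.
apply: (@squeeze_cvgr _ _ _ _ (cst 0) (fun t => \sum_e `|len_ t e - L0 e| * c e)) S0; last exact: cvg_cst.
near=> t; rewrite normr_ge0 /=; apply: cP; near: t.
  exact: len_ge0.
exact: len_pos_near.
Unshelve. all: by end_near. Qed.

Lemma res_cvg p q : res (len_ t) b p q @[t --> F] --> res L0 b p q.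
Proof.
apply: cvgB; first by apply: cvgD; exact: gpot_cvg.
by apply: cvgM; [exact: cvg_cst|exact: gpot_cvg].
Qed.

(** When the limit length is 0, the quotient is at most [k ^+ 2 * len_ t e]: the
    numerators of the edge terms are of second order in the length. *)
Lemma ratio_cvg (h : T -> R) (h0 k : R) e : h t @[t --> F] --> h0 -> 0 <= k ->
  (\forall t \near F, `|h t| <= k * len_ t e) ->
  h t ^+ 2 / len_ t e @[t --> F] --> h0 ^+ 2 / L0 e.
Proof.
move=> hh0 k0 hk.
have hsq : h t ^+ 2 @[t --> F] --> h0 ^+ 2 by rewrite expr2; under eq_fun do rewrite expr2; exact: cvgM.
have [Le0|Le0] := eqVneq (L0 e) 0; last first.
  by apply: cvgM => //; apply: cvgV.
rewrite Le0 invr0 mulr0.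
have B0 : k ^+ 2 * len_ t e @[t --> F] --> 0.
  rewrite [X in _ --> X](_ : 0 = k ^+ 2 * L0 e); last by rewrite Le0 mulr0.
  by apply: cvgM => //; exact: cvg_cst.
apply: (@squeeze_cvgr _ _ _ _ (cst 0) (fun t => k ^+ 2 * len_ t e)) B0; last exact: cvg_cst.
near=> t => /=.
have Lt : 0 <= len_ t e by near: t; apply: filterS len_ge0.
rewrite mulr_ge0 ?sqr_ge0 ?invr_ge0 //=.
have [->|Lt0] := eqVneq (len_ t e) 0; first by rewrite invr0 !mulr0.
have {}Lt0 : 0 < len_ t e by rewrite lt_neqAle eq_sym Lt0.
rewrite ler_pdivrMr // -mulrA -expr2 -exprMn -real_normK ?num_real //.
apply: lerXn2r; rewrite ?nnegrE ?mulr_ge0 ?normr_ge0 //.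
near: t; exact: hk.
Unshelve. all: by end_near. Qed.

Lemma phi_formula_cvg (q : vert G -> nat) :
  phi_formula (len_ t) b q @[t --> F] --> phi_formula L0 b q.
Proof.
apply: cvgD; last first.
  apply: cvgM; first exact: cvg_cst.
  apply: sum_cvg => v; apply: sum_cvg => w.
  by apply: cvgM; [exact: cvg_cst|exact: res_cvg].
apply: cvgD; first by apply: cvgM; [exact: cvg_cst|exact: sum_cvg].
apply: cvgM; first exact: cvg_cst.
apply: cvgD; (apply: cvgM; first exact: cvg_cst); apply: sum_cvg => e.
  apply: (@ratio_cvg _ _ 2) => //; first by apply: cvgB; exact: res_cvg.
  near=> t; have Lt : forall f, 0 <= len_ t f by near: t; exact: len_ge0.
  by rewrite !res_base //; exact: gpot_diag_drop.
apply: (@ratio_cvg _ _ 1) => //; first by apply: cvgB => //; exact: res_cvg.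
near=> t; have Lt : forall f, 0 <= len_ t f by near: t; exact: len_ge0.
rewrite mul1r ger0_norm ?subr_ge0 ?res_edge_le //.
by rewrite gerBl res_ge0.
Unshelve. all: by end_near. Qed.

End Continuity.

(** A nonnegative divisor [K] has degree [2 g - 2 >= 0]. *)
Lemma pol_genus_gt0 (R : realType) (G : multigraph) (q : vert G -> nat) :
  connected_graph G -> polarization q -> (0 < genus G + \sum_v q v)%N.
Proof.
move=> G_conn q_pol; have := sum_kweight R q G_conn.
have : 0 <= \sum_v kweight R q v.
  apply: sumr_ge0 => v _; have := q_pol v; rewrite /kweight => qv.
  have : (2 <= valence v + 2 * q v)%N by lia.
  by rewrite -(ler_nat R) natrD natrM; lra.
by move=> + E; rewrite E -(ltr0n R); lra.
Qed.

Theorem theorem1p1 (R : realType) (G : multigraph) (q : vert G -> nat)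
    (G_connected : connected_graph G) (q_pol : polarization q) :
  exists Phi : 'rV[R]_#|edge G| -> R,
    [/\ {within [set L : 'rV[R]_#|edge G| | forall i, 0 <= L 0 i],
           continuous Phi},
        (forall (L : 'rV[R]_#|edge G|) (L_gt0 : forall e, 0 < edge_len L e),
           Phi L = @phi R (@MetrizedGraph R G (edge_len L) L_gt0) q) &
        (forall L : 'rV[R]_#|edge G|,
           (forall i, 0 <= L 0 i) -> (exists i, L 0 i = 0) ->
           Phi L = @phi R (contr_mgraph (edge_len L))
                          (@contr_polarization R G (edge_len L) q))].
Proof.
have g_gt0 := pol_genus_gt0 R G_connected q_pol.
pose b := base_vert G.
pose Phi (L : 'rV[R]_#|edge G|) := phi_formula (edge_len L) b q.
have ge0 (L : 'rV[R]_#|edge G|) : (forall i, 0 <= L 0 i) -> forall e, 0 <= edge_len L e.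
  by move=> L0 e; exact: L0.
exists Phi; split=> [|L L_gt0|L L0 _].
- apply/subspace_continuousP => L0 L0_ge0.
  have FF : ProperFilter (within [set L : 'rV[R]_#|edge G| | forall i, 0 <= L 0 i] (nbhs L0)).
    by apply: within_nbhs_proper; exact: subset_closure.
  apply: phi_formula_cvg => //; first exact: ge0.
  + by near=> L; apply: ge0; near: L; exact: withinT.
  + move=> e; apply: cvg_within_filter; exact: coord_continuous.
- by rewrite (@phi_formulaE R (@MetrizedGraph R G (edge_len L) L_gt0) b q).
- have L_ge0 := ge0 L L0.
  have genusE := pol_genus_contr G_connected L_ge0 q.
  rewrite (@phi_formulaE R (contr_mgraph (edge_len L)) (quot_map (edge_len L) b)); last 2 first.
  + exact: contr_connected.
  + by rewrite genusE.
  + by rewrite /Phi -(phi_formula_contr G_connected L_ge0).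
Unshelve. all: by end_near. Qed.
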